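(* Let $X$ be a Hilbert space with inner product $\langle\cdot,\cdot\rangle$, and let $A:D(A)\subset X\to X$ be diagonalizable and the generator of a $C_0$-semigroup on $X$. Let $(\varphi_n)_{n\in\mathbb{N}}$ be a Riesz basis in $X$ consisting of eigenvectors of $A$, with biorthogonal sequence $(\psi_n)_{n\in\mathbb{N}}$, and let $\lambda_n$ be the eigenvalue corresponding to $\varphi_n$. Let $B\in\mathcal{L}(\mathbb{C},X)$ be represented as $Bv=bv$ for some $b\in X$ and all $v\in\mathbb{C}$. Assume that there exists $p>0$ such that $$\inf\{|\operatorname{Im}\lambda_n-\operatorname{Im}\lambda_m|:\ n,m\in\mathbb{N},\ n\ne m,\ |\operatorname{Re}\lambda_n|,|\operatorname{Re}\lambda_m|<p\}>0 .$$ For $k\in\mathbb{Z}$ let $S_k:=\{\lambda\in\mathbb{C}:2^k\le\operatorname{Re}\lambda<2^{k+1}\}$ and $$\Phi_k:=\begin{cases}\displaystyle\sup_{-\lambda_n\in S_k}\frac{|\langle b,\psi_n\rangle|^2}{|\operatorname{Re}\lambda_n|^2}&\text{if }\{-\lambda_n:n\in\mathbb{N}\}\cap S_k\ne\emptyset,\\[1ex]0&\text{if }\{-\lambda_n:n\in\mathbb{N}\}\cap S_k=\emptyset.\end{cases}$$ Let $\alpha>0$. Then $\Sigma_{\mathrm{lin}}(A,B)$ is polynomially ISS with parameter $\alpha$ for $\mathcal{U}=L^\infty(\mathbb{R}_+,\mathbb{C})$ if and only if $A$ generates a polynomially stable semigroup with parameter $\alpha$ and $$\sum_{k\in\mathbb{Z}}\Phi_k<\infty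 .$$
   Context: $\mathcal{L}(\mathbb{C},X)$ denotes the bounded linear operators from $\mathbb{C}$ to $X$; $\mathbb{R}_+=[0,\infty)$; $\|u\|_\infty=\operatorname{ess\,sup}_{t\ge0}|u(t)|$. The infimum of the empty set is $+\infty$. The graph norm is $\|x\|_A:=\|x\|+\|Ax\|$, $x\in D(A)$. For real functions, $f(t)=O(g(t))$ as $t\to\infty$ means there are $M>0$, $t_0$ with $f(t)\le Mg(t)$ for $t\ge t_0$. Comparison functions: $\mathcal{K}$ is the set of continuous strictly increasing $\mu:\mathbb{R}_+\to\mathbb{R}_+$ with $\mu(0)=0$; $\mathcal{K}_\infty$ is the set of unbounded $\mu\in\mathcal{K}$; $\mathcal{L}$ is the set of continuous strictly decreasing $\mu:\mathbb{R}_+\to\mathbb{R}_+$ with $\lim_{t\to\infty}\mu(t)=0$; $\mathcal{KL}$ is the set of continuous $\kappa:\mathbb{R}_+\times\mathbb{R}_+\to\mathbb{R}_+$ with $\kappa(\cdot,t)\in\mathcal{K}$ for all $t\ge0$ and $\kappa(r,\cdot)\in\mathcal{L}$ for all $r>0$. A linear operator $A:D(A)\subset X\to X$ on a (complex) Hilbert space $X$ is diagonalizable if its resolvent set is nonempty and there is a Riesz basis in $X$ consisting of eigenvectors of $A$. A $C_0$-semigroup $(T(t))_{t\ge0}$ with generator $A$ is semi-uniformly stable if it is uniformly bounded and $\|T(t)(I-A)^{-1}\|\to0$ as $t\to\infty$ (it is known that then $\sigma(A)\cap i\mathbb{R}=\emptyset$, so $A^{-1}$ is a bounded operator). It is polynomially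 stable with parameter $\alpha>0$ if it is semi-uniformly stable and $\|T(t)A^{-1}\|=O(t^{-1/\alpha})$ as $t\to\infty$. The linear system $\Sigma_{\mathrm{lin}}(A,B)$, where $A$ generates a $C_0$-semigroup $(T(t))_{t\ge0}$ on $X$, is $\dot x(t)=Ax(t)+Bu(t)$, $t\ge0$, $x(0)=x_0\in X$, with $u\in L^\infty(\mathbb{R}_+,\mathbb{C})$; its unique mild solution is $\phi(t,x_0,u)=T(t)x_0+\int_0^tT(t-s)Bu(s)\,\mathrm{d}s$. $\Sigma_{\mathrm{lin}}(A,B)$ is uniformly globally stable (UGS) for $\mathcal{U}=L^\infty(\mathbb{R}_+,\mathbb{C})$ if there exist $\gamma,\mu\in\mathcal{K}_\infty$ such that $\|\phi(t,x_0,u)\|\le\gamma(\|x_0\|)+\mu(\|u\|_\infty)$ for all $x_0\in X$, $u\in L^\infty(\mathbb{R}_+,\mathbb{C})$, $t\ge0$. It is polynomially input-to-state stable (polynomially ISS) with parameter $\alpha>0$ for $\mathcal{U}=L^\infty(\mathbb{R}_+,\mathbb{C})$ if it is UGS and there exist $\kappa\in\mathcal{KL}$ and $\mu\in\mathcal{K}_\infty$ such that $\|\phi(t,x_0,u)\|\le\kappa(\|x_0\|_A,t)+\mu(\|u\|_\infty)$ for all $x_0\in D(A)$, $u\in L^\infty(\mathbb{R}_+,\mathbb{C})$, $t\ge0$, and $\kappa(r,t)=O(t^{-1/\alpha})$ as $t\to\infty$ for every $r>0$. *)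

(* Defs.v *)
From HB Require Import structures.
From mathcomp Require Import all_boot all_order all_algebra.
From mathcomp Require Import sesquilinear complex.
From mathcomp Require Import all_classical all_reals all_analysis ess_sup_inf.

Set Implicit Arguments.
Unset Strict Implicit.
Unset Printing Implicit Defensive.

Import Order.TTheory GRing.Theory Num.Theory.
Import numFieldNormedType.Exports.

Local Open Scope classical_set_scope.
Local Open Scope complex_scope.
Local Open Scope ring_scope.

(* The norm of a normed space over [R[i]] takes its values in [R[i]];
   [rnorm] is the same norm, read as a real number. *)
Definition rnorm (R : realType) (V : normedZmodType R[i]) (x : V) : R :=
  complex.Re `|x|.

Definition bigO_infty (R : realType) (f g : R -> R) : Prop :=
  exists2 M : R, 0 < M & \forall t \near +oo, f t <= M * g t.

Section ComparisonFunctions.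
Variable R : realType.

(* Functions on [0, +oo[ are represented by functions on R of which only the
   restriction to [0, +oo[ matters. *)
Definition classK (mu : R -> R) : Prop :=
  [/\ {within `[0, +oo[, continuous mu},
      forall r, 0 <= r -> 0 <= mu r,
      forall r s, 0 <= r -> r < s -> mu r < mu s
    & mu 0 = 0].

Definition classKinfty (mu : R -> R) : Prop :=
  classK mu /\ forall M, exists2 r, 0 <= r & M < mu r.

Definition classL (mu : R -> R) : Prop :=
  [/\ {within `[0, +oo[, continuous mu},
      forall t, 0 <= t -> 0 <= mu t,
      forall s t, 0 <= s -> s < t -> mu t < mu s
    & mu t @[t --> +oo] --> (0 : R)].

Definition classKL (kappa : R -> R -> R) : Prop :=
  [/\ {within [set p : R * R | 0 <= p.1 /\ 0 <= p.2],
         continuous (fun p : R * R => kappa p.1 p.2)},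
      forall t, 0 <= t -> classK (kappa ^~ t)
    & forall r, 0 < r -> classL (kappa r)].

End ComparisonFunctions.

Section BochnerIntegral.
Context (R : realType) (d : measure_display) (T : measurableType d).
Variables (V : normedModType R[i]) (mu : {measure set T -> \bar R}).

Definition bochner_simple (D : set T) (s : T -> V) : Prop :=
  forall v, measurable (s @^-1` [set v]) /\
    (v != 0 -> (mu (D `&` s @^-1` [set v]) < +oo)%E).

(* [fine] sends an infinite measure to 0; by [bochner_simple] this can only
   concern the term of the value 0. *)
Definition simple_integral (D : set T) (s : T -> V) : V :=
  \sum_(v \in range s) (fine (mu (D `&` s @^-1` [set v])))%:C *: v.

Definition is_bochner_integral (D : set T) (f : T -> V) (y : V) : Prop :=
  exists s : nat -> {fimfun T >-> V},
    [/\ forall n, bochner_simple D (s n),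
        {ae mu, forall x, D x -> s n x @[n --> \oo] --> f x},
        (\int[mu]_(x in D) (rnorm (f x - s n x))%:E)%E @[n --> \oo] --> 0%E
      & simple_integral D (s n) @[n --> \oo] --> y].

(* 0 if [f] is not Bochner integrable over [D] *)
Definition bochner_integral (D : set T) (f : T -> V) : V :=
  xget 0 [set y | is_bochner_integral D f y].

End BochnerIntegral.

Section BoundedOperators.
Variable R : realType.

Definition bounded_linear (U V : normedModType R[i]) (L : U -> V) : Prop :=
  linear L /\ exists M : R, forall x, rnorm (L x) <= M * rnorm x.

Definition opnorm (U V : normedModType R[i]) (L : U -> V) : R :=
  sup [set rnorm (L x) | x in [set x | rnorm x <= 1]].

End BoundedOperators.

(* A linear operator [D(A) -> X]; the values of [A] off [dom A] are
   irrelevant. *)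
Record operator (R : realType) (X : normedModType R[i]) := Operator {
  dom : set X;
  op_fun :> X -> X;
  dom0 : dom 0;
  op_linear : forall (a : R[i]) (x y : X), dom x -> dom y ->
    dom (a *: x + y) /\ op_fun (a *: x + y) = a *: op_fun x + op_fun y
}.

Section Operators.
Context (R : realType) (X : normedModType R[i]).
Implicit Types (A : operator X) (T : R -> X -> X) (S : X -> X).

(* [S] is a bounded everywhere defined inverse of [L : D -> X]. *)
Definition bounded_inverse (D : set X) (L : X -> X) (S : X -> X) : Prop :=
  [/\ bounded_linear S,
      forall y, D (S y) /\ L (S y) = y
    & forall x, D x -> S (L x) = x].

Definition resolvent_set A : set R[i] :=
  [set l | exists S, bounded_inverse (dom A) (fun x => l *: x - A x) S].

Definition op_eigenvector A (l : R[i]) (x : X) : Prop :=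
  [/\ dom A x, x != 0 & A x = l *: x].

Definition riesz_basis (phi : nat -> X) : Prop :=
  dense [set x | exists N (a : nat -> R[i]), x = \sum_(n < N) a n *: phi n] /\
  exists m M : R, [/\ 0 < m, 0 < M & forall N (a : nat -> R[i]),
    m * \sum_(n < N) rnorm (a n) ^+ 2
      <= rnorm (\sum_(n < N) a n *: phi n) ^+ 2
      <= M * \sum_(n < N) rnorm (a n) ^+ 2].

Definition op_diagonalizable A : Prop :=
  resolvent_set A !=set0 /\
  exists (phi : nat -> X) (lambda : nat -> R[i]),
    riesz_basis phi /\ forall n, op_eigenvector A (lambda n) (phi n).

(* Only the values of [T] at nonnegative times matter. *)
Definition C0_semigroup T : Prop :=
  [/\ forall t, 0 <= t -> bounded_linear (T t),
      forall x, T 0 x = x,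
      forall s t, 0 <= s -> 0 <= t -> forall x, T (s + t) x = T s (T t x)
    & forall x, T t x @[t --> 0^'+] --> x].

Definition generator A T : Prop :=
  forall x y, (dom A x /\ A x = y) <->
    (h^-1)%:C *: (T h x - x) @[h --> (0 : R)^'+] --> y.

Definition semi_uniformly_stable A T : Prop :=
  (exists M : R, forall t, 0 <= t -> opnorm (T t) <= M) /\
  exists2 S, bounded_inverse (dom A) (fun x => x - A x) S
    & opnorm (T t \o S) @[t --> +oo] --> (0 : R).

Definition polynomially_stable A T (alpha : R) : Prop :=
  semi_uniformly_stable A T /\
  exists2 S, bounded_inverse (dom A) A S
    & bigO_infty (fun t => opnorm (T t \o S)) (fun t => t `^ (- alpha^-1)).

Definition graph_norm A (x : X) : R := rnorm x + rnorm (A x).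

End Operators.

Section LinearSystem.
Context (R : realType) (X : normedModType R[i]).
Implicit Types (A : operator X) (T : R -> X -> X) (B : R[i] -> X).
Implicit Types (u : R -> R[i]).

Definition Linf_norm u : \bar R :=
  ess_sup (@lebesgue_measure R)
    ((fun t => (rnorm (u t))%:E) \_ `[0, +oo[).

(* Elements of L^oo are given by Borel representatives. *)
Definition Linf u : Prop :=
  [/\ measurable_fun (`[0, +oo[ : set R) (fun t => complex.Re (u t)),
      measurable_fun (`[0, +oo[ : set R) (fun t => complex.Im (u t))
    & (Linf_norm u < +oo)%E].

Definition mild_solution T B (t : R) (x0 : X) u : X :=
  T t x0 +
  bochner_integral (@lebesgue_measure R) `[0, t] (fun s => T (t - s) (B (u s))).

Definition UGS T B : Prop :=
  exists gamma mu : R -> R, [/\ classKinfty gamma, classKinfty mu &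
    forall x0 u t, Linf u -> 0 <= t ->
      rnorm (mild_solution T B t x0 u)
        <= gamma (rnorm x0) + mu (fine (Linf_norm u))].

Definition polynomially_ISS A T B (alpha : R) : Prop :=
  UGS T B /\
  exists (kappa : R -> R -> R) (mu : R -> R),
    [/\ classKL kappa,
        classKinfty mu,
        forall x0 u t, dom A x0 -> Linf u -> 0 <= t ->
          rnorm (mild_solution T B t x0 u)
            <= kappa (graph_norm A x0) t + mu (fine (Linf_norm u))
      & forall r, 0 < r ->
          bigO_infty (kappa r) (fun t => t `^ (- alpha^-1))].

End LinearSystem.

Section DyadicStrips.
Variable R : realType.

Definition strip (k : int) : set R[i] :=
  [set l | 2 ^ k <= complex.Re l /\ complex.Re l < 2 ^ (k + 1)].

(* [c n] stands for the coefficient <b, psi_n> *)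
Definition Phi (lambda c : nat -> R[i]) (k : int) : \bar R :=
  if `[< exists n, strip k (- lambda n) >] then
    ereal_sup [set (rnorm (c n) ^+ 2 / `|complex.Re (lambda n)| ^+ 2)%:E
              | n in [set n | strip k (- lambda n)]]
  else 0%E.

End DyadicStrips.

(* Main.v *)
Require Import Defs.
From HB Require Import structures.
From mathcomp Require Import all_boot all_order all_algebra.
From mathcomp Require Import sesquilinear complex.
From mathcomp Require Import all_classical all_reals all_analysis.
From mathcomp Require Import measurable_realfun ess_sup_inf finmap ring lra zify.

Set Implicit Arguments.
Unset Strict Implicit.
Unset Printing Implicit Defensive.

Import Order.TTheory GRing.Theory Num.Theory.
Import numFieldNormedType.Exports.

Local Open Scope classical_set_scope.
Local Open Scope complex_scope.
Local Open Scope ring_scope.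

(** Write mu_n = - lambda_n, c_n = <b, psi_n>, and let y = y(t, u) be the state
    reached at time t from 0 under the input u. The semigroup is diagonal in the
    Riesz basis, hence the coefficients of y are the scalar convolutions

      y_n = c_n int_0^t e^(- mu_n (t - s)) u(s) ds,

    and |y|^2 is comparable to the sum of the |y_n|^2 ([bessel], [upper_riesz]).
    Since the system is linear, the theorem splits into a statement on the
    semigroup (u = 0) and one on the bound |y| <= C |u|_oo.

    The semigroup. Stability of the orbits that start in the domain gives
    polynomial stability as soon as A and 1 - A have bounded inverses. An inverse
    of some l - A is given, and another resolvent differs from it by a bounded
    diagonal operator provided that the eigenvalues stay away from the new point
    ([bounded_inverse_shift]). They stay away from 1 since their real parts are
    nonpositive, and from 0 since eigenvectors of bounded graph norm decay
    uniformly ([eigenvalues_away_from_0]). Conversely, the kappa of the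
    definition is C r (1 + t)^(- 1 / alpha) ([stable_orbit_decay]).

    Necessity of the sum condition. Pick a mode n in each of finitely many strips
    S_k. A resonant input, supported in the time window where t - s lies between
    2^(-k) / 2 and 2^(-k), makes |y_n| at least a constant times
    |c_n| / |Re lambda_n| ([pulse_state_ge]). The windows of different strips are
    disjoint, so the sum of such inputs with any signs is bounded by 1, and by
    the parallelogram law suitable signs make the squared norms of the
    states add up ([superpose]). As |y| is bounded, so are the sums of the
    |c_n|^2 / |Re lambda_n|^2.

    Sufficiency. Modes with Re mu_n >= p contribute at most a constant times
    |u|_oo^2, as (c_n) is square summable ([coef_state_le]). For the others it
    suffices to show that the sum of the |y_n|^2 over the strip S_k is at most a
    constant times Phi_k |u|_oo^2. By duality this sum is the integral of u
    against P(t - s), where P is the exponential sum with coefficients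
    conj(y_n) c_n and exponents - mu_n. With r = 2^k, the arithmetic-geometric
    mean inequality bounds the integral of |P| by those of e^(- r s) and of
    e^(r s) |P(s)|^2. The second is estimated by a large sieve inequality
    ([sieve]): averaged with the sum with conjugate exponents, e^(r s) |P(s)|^2
    has an integral over [0, oo[ given by the kernel X / (X^2 + Y^2), with X
    comparable to r and Y a difference of imaginary parts. As these are
    separated by the gap condition, the rows of the kernel sum to at most a
    constant times 1 / r ([schur_row]), and Schur's test applies. Optimizing the
    parameter of the mean inequality yields the claim ([strip_state_le]).

    All of this uses the Bochner integral only through its inner products with
    fixed vectors ([functional_bochner]), apart from its existence for bounded
    measurable inputs ([bochner_state]), which the pulses require. *)

(** * The real-valued norm and the inner product *)

Section RealNorm.
Context (R : realType).

Lemma Re_sub (x y : R[i]) : complex.Re (x - y) = complex.Re x - complex.Re y.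
Proof. by case: x y => [a b] [c d]. Qed.

Lemma Re_add (x y : R[i]) : complex.Re (x + y) = complex.Re x + complex.Re y.
Proof. by case: x y => [a b] [c d]. Qed.

Lemma Re_mul (x y : R[i]) : complex.Re (x * y) =
  complex.Re x * complex.Re y - complex.Im x * complex.Im y.
Proof. by case: x y => [a b] [c d]. Qed.

Lemma Im_sub (x y : R[i]) : complex.Im (x - y) = complex.Im x - complex.Im y.
Proof. by case: x y => [a b] [c d]. Qed.

Lemma Im_add (x y : R[i]) : complex.Im (x + y) = complex.Im x + complex.Im y.
Proof. by case: x y => [a b] [c d]. Qed.

Lemma Im_mul (x y : R[i]) : complex.Im (x * y) =
  complex.Re x * complex.Im y + complex.Im x * complex.Re y.
Proof. by case: x y => [a b] [c d]. Qed.

(** Both conjugations satisfy |x|^2 = x x^*, which determines x^*. *)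
Lemma conjE (x : R[i]) : Num.conj x = conjc x.
Proof.
suff h : `|x| ^+ 2 * Num.conj x = `|x| ^+ 2 * conjc x.
  have [->|x0] := eqVneq x 0; first by rewrite conjC0 conjc0.
  by apply: (mulfI _ h); rewrite expf_neq0// normr_eq0.
by rewrite {1}sqr_normc normCK mulrAC.
Qed.

Lemma rnorm_sqrE (z : R[i]) : 
  rnorm z ^+ 2 = complex.Re z ^+ 2 + complex.Im z ^+ 2.
Proof. by rewrite /rnorm normc_def/= sqr_sqrtr// addr_ge0// sqr_ge0. Qed.

Section Normed.
Context {V : normedZmodType R[i]}.
Implicit Types x y : V.

Lemma rnormE x : `|x| = (rnorm x)%:C.
Proof. by rewrite /rnorm RRe_real// normr_real. Qed.

Lemma rnorm_ge0 x : 0 <= rnorm x.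
Proof. by rewrite -lecR -rnormE normr_ge0. Qed.

Lemma rnorm0 : rnorm (0 : V) = 0.
Proof. by rewrite /rnorm normr0. Qed.

Lemma rnorm_eq0 x : (rnorm x == 0) = (x == 0).
Proof. by rewrite -(normr_eq0 x) rnormE eq_complex/= eqxx andbT. Qed.

Lemma rnorm_gt0 x : (0 < rnorm x) = (x != 0).
Proof. by rewrite lt_neqAle rnorm_ge0 andbT eq_sym rnorm_eq0. Qed.

Lemma rnormN x : rnorm (- x) = rnorm x.
Proof. by rewrite /rnorm normrN. Qed.

Lemma rdistC x y : rnorm (x - y) = rnorm (y - x).
Proof. by rewrite /rnorm distrC. Qed.

Lemma ler_rnormD x y : rnorm (x + y) <= rnorm x + rnorm y.
Proof. by rewrite -lecR rmorphD/= -!rnormE ler_normD. Qed.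

Lemma ler_rnormB x y : rnorm (x - y) <= rnorm x + rnorm y.
Proof. by rewrite -(rnormN y) ler_rnormD. Qed.

Lemma ler_rdist x y : `|rnorm x - rnorm y| <= rnorm (x - y).
Proof.
have h1 := ler_rnormD (x - y) y; have h2 := ler_rnormD (y - x) x.
rewrite !subrK in h1 h2; rewrite (rdistC y) in h2.
by rewrite ler_norml; apply/andP; split; lra.
Qed.

End Normed.

Lemma rnormZ (V : normedModType R[i]) (a : R[i]) (x : V) :
  rnorm (a *: x) = rnorm a * rnorm x.
Proof. by apply: complexI; rewrite rmorphM/= -!rnormE normrZ. Qed.

Lemma rnormM (a b : R[i]) : rnorm (a * b) = rnorm a * rnorm b.
Proof. by apply: complexI; rewrite rmorphM/= -!rnormE normrM. Qed.

Lemma rnormV (a : R[i]) : rnorm a^-1 = (rnorm a)^-1.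
Proof. by apply: complexI; rewrite fmorphV/= -!rnormE normfV. Qed.

Lemma rnorm_real (a : R) : rnorm a%:C = `|a|.
Proof. by rewrite /rnorm normc_def/= expr0n addr0 sqrtr_sqr. Qed.

Lemma rnorm1 : rnorm (1 : R[i]) = 1.
Proof. by rewrite /rnorm normr1. Qed.

Lemma rnormJ (a : R[i]) : rnorm (conjc a) = rnorm a.
Proof. by rewrite /rnorm normcJ. Qed.

Lemma Re_le_rnorm (z : R[i]) : `|complex.Re z| <= rnorm z.
Proof. by rewrite -lecR -rnormE normc_ge_Re. Qed.

Lemma Im_le_rnorm (z : R[i]) : `|complex.Im z| <= rnorm z.
Proof.
rewrite -(ler_pXn2r (n:=2))// ?nnegrE ?rnorm_ge0//.
by rewrite rnorm_sqrE real_normK ?num_real// lerDr sqr_ge0.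
Qed.

Lemma rnorm_le_ReIm (z : R[i]) : rnorm z <= `|complex.Re z| + `|complex.Im z|.
Proof.
rewrite -(ler_pXn2r (n:=2))// ?nnegrE ?rnorm_ge0// ?addr_ge0//.
rewrite rnorm_sqrE sqrrD !real_normK ?num_real// addrAC lerDl.
by rewrite mulrn_wge0// mulr_ge0.
Qed.

Lemma cvg_bigsum (T I : Type) (F : set_system T) {FF : Filter F} (r : seq I) (P : pred I)
    (f : I -> T -> R) (l : I -> R) :
  (forall i, P i -> f i @ F --> l i) ->
  \sum_(i <- r | P i) f i x @[x --> F] --> \sum_(i <- r | P i) l i.
Proof.
move=> h; elim: r => [|i r IH].
  by under eq_fun do rewrite big_nil; rewrite big_nil; exact: cvg_cst.
under eq_fun do rewrite big_cons; rewrite big_cons.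
by case: ifP => Pi //; apply: cvgD => //; exact: h.
Qed.

(** Every positive element of R[i] is real, so that balls of complex radius are
    balls of real radius. *)
Lemma cvg_rnormP (V : normedModType R[i]) (T : Type) (F : set_system T) {FF : Filter F}
    (f : T -> V) (y : V) :
  (f @ F --> y) <-> (rnorm (f x - y) @[x --> F] --> (0 : R)).
Proof.
split.
  move=> /cvgrPdist_lt h; apply/cvgrPdist_lt => e e0.
  have /h : 0 < e%:C by rewrite ltcR.
  apply: filterS => x; rewrite rnormE ltcR sub0r normrN ger0_norm ?rnorm_ge0//.
  by rewrite rdistC.
move=> /cvgrPdist_lt h; apply/cvgrPdist_lt => e e0.
have eE : e = (complex.Re e)%:C by rewrite RRe_real// gtr0_real.
have /h : 0 < complex.Re e by rewrite -ltcR -eE.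
apply: filterS => x; rewrite rnormE eE ltcR sub0r normrN ger0_norm ?rnorm_ge0//.
by rewrite rdistC.
Qed.

Lemma cvg_rnorm (V : normedModType R[i]) (T : Type) (F : set_system T) {FF : Filter F}
    (f : T -> V) (y : V) :
  f @ F --> y -> rnorm (f x) @[x --> F] --> rnorm y.
Proof.
move=> /cvg_rnormP/cvgrPdist_lt h; apply/cvgrPdist_lt => e /h.
apply: filterS => x; rewrite sub0r normrN ger0_norm ?rnorm_ge0//.
by apply: le_lt_trans; rewrite distrC ler_rdist.
Qed.

Lemma cvg_rnorm_squeeze (V : normedModType R[i]) (T : Type) (F : set_system T) {FF : Filter F}
    (f : T -> V) (y : V) (g : T -> R) :
  (\forall x \near F, rnorm (f x - y) <= g x) -> g x @[x --> F] --> (0 : R) ->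
  f @ F --> y.
Proof.
move=> fg g0; apply/cvg_rnormP.
apply: (squeeze_cvgr _ _ g0); last exact: cvg_cst.
by apply: filterS fg => x ->; rewrite rnorm_ge0.
Qed.

Lemma rnorm_cauchy_cvg (V : completeNormedModType R[i]) (x : nat -> V) :
  (forall e : R, 0 < e -> exists N, forall n m, (N <= n)%N -> (N <= m)%N ->
     rnorm (x n - x m) <= e) ->
  exists y : V, x n @[n --> \oo] --> y.
Proof.
move=> h; suff /cvg_ex : cvg (x @ \oo) by [].
apply/cauchy_cvgP.
apply/cauchy_ballP => e e0.
have eE : e = (complex.Re e)%:C by rewrite RRe_real// gtr0_real.
have e2 : 0 < complex.Re e / 2 by rewrite divr_gt0// -ltcR -eE.
have [N hN] := h _ e2.
pose S := [set y : V | exists2 n, (N <= n)%N & y = x n].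
exists (S, S) => /=; first by split; exists N => // n; exists n.
move=> [_ _] [[n Nn ->] [k Nk ->]]/=.
rewrite -ball_normE/= eE rnormE ltcR (le_lt_trans (hN _ _ Nn Nk))//.
by rewrite ltr_pdivrMr// ltr_pMr ?ltr1n// -ltcR -eE.
Qed.

End RealNorm.

Definition rdot (R : realType) (X : normedModType R[i])
  (dot : {dot X for Num.conj}) (x y : X) : R := complex.Re (dot x y).

Section InnerProduct.
Context (R : realType) (X : normedModType R[i]) (dot : {dot X for Num.conj}).
Hypothesis dot_norm : forall x : X, dot x x = `|x| ^+ 2.
Implicit Types x y z : X.

Lemma dotZr a x y : dot x (a *: y) = conjc a * dot x y.
Proof. by rewrite -conjE; exact: (linearZr_LR dot x a y). Qed.

Lemma dotZl a x y : dot (a *: x) y = a * dot x y.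
Proof. exact: (linearZl_LR dot y a x). Qed.

Lemma dotBl x y z : dot (x - y) z = dot x z - dot y z.
Proof. exact: linearBl. Qed.

Lemma dotDl x y z : dot (x + y) z = dot x z + dot y z.
Proof. exact: linearDl. Qed.

Lemma dot_suml I (r : seq I) (P : pred I) (F : I -> X) y :
  dot (\sum_(i <- r | P i) F i) y = \sum_(i <- r | P i) dot (F i) y.
Proof.
apply: (big_morph (fun x => dot x y)); last by rewrite linear0l.
by move=> a b; rewrite linearDl.
Qed.

Lemma rdot_sqr x : rdot dot x x = rnorm x ^+ 2.
Proof. by rewrite /rdot dot_norm rnormE -rmorphXn. Qed.

Lemma rdotDl x y z : rdot dot (x + y) z = rdot dot x z + rdot dot y z.
Proof. by rewrite /rdot dotDl Re_add. Qed.

Lemma rdotBl x y z : rdot dot (x - y) z = rdot dot x z - rdot dot y z.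
Proof. by rewrite /rdot dotBl Re_sub. Qed.

Lemma rdotBr x y z : rdot dot x (y - z) = rdot dot x y - rdot dot x z.
Proof. by rewrite /rdot linearBr Re_sub. Qed.

Lemma rdotC x y : rdot dot x y = rdot dot y x.
Proof.
rewrite /rdot (hermC dot x y) expr0 mul1r.
by transitivity (complex.Re (conjc (dot y x))); [rewrite -conjE|case: (dot y x)].
Qed.

Lemma rdotZl (a : R) x y : rdot dot (a%:C *: x) y = a * rdot dot x y.
Proof. by rewrite /rdot dotZl Re_mul/= mul0r subr0. Qed.

Lemma rdotZr (a : R) x y : rdot dot x (a%:C *: y) = a * rdot dot x y.
Proof. by rewrite rdotC rdotZl rdotC. Qed.

Lemma rdotDr x y z : rdot dot x (y + z) = rdot dot x y + rdot dot x z.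
Proof. by rewrite !(rdotC x) rdotDl. Qed.

Lemma rdot_suml I (r : seq I) (P : pred I) (F : I -> X) y :
  rdot dot (\sum_(i <- r | P i) F i) y = \sum_(i <- r | P i) rdot dot (F i) y.
Proof.
elim/big_rec2 : _ => [|i y1 y2 _ h]; first by rewrite /rdot linear0l.
by rewrite rdotDl h.
Qed.

Lemma rdot_sumr I (r : seq I) (P : pred I) (F : I -> X) y :
  rdot dot y (\sum_(i <- r | P i) F i) = \sum_(i <- r | P i) rdot dot y (F i).
Proof. by rewrite rdotC rdot_suml; apply: eq_bigr => i _; rewrite rdotC. Qed.

Lemma rnorm_addZ_sqr (e : R) x y : rnorm (x + e%:C *: y) ^+ 2 =
  rnorm x ^+ 2 + e ^+ 2 * rnorm y ^+ 2 + 2 * (e * rdot dot x y).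
Proof.
rewrite -!rdot_sqr rdotDl !rdotDr !rdotZl !rdotZr (rdotC y x).
by ring.
Qed.

(** This is |x - t y|^2 >= 0 at t = |x| / |y|. *)
Lemma rdot_le x y : rdot dot x y <= rnorm x * rnorm y.
Proof.
have [->|y0] := eqVneq y 0.
  by rewrite rnorm0 mulr0 /rdot linear0r.
have ny : 0 < rnorm y by rewrite rnorm_gt0.
have nx := rnorm_ge0 x.
have h (t : R) : 0 <= rnorm x ^+ 2 - 2 * t * rdot dot x y + t ^+ 2 * rnorm y ^+ 2.
  have := sqr_ge0 (rnorm (x - t%:C *: y)).
  rewrite -(rdot_sqr (x - _)) !rdotBl !rdotBr !rdotZr !rdotZl (rdotC y x) !rdot_sqr.
  by move/le_trans; apply; rewrite le_eqVlt; apply/orP; left; apply/eqP; ring.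
rewrite leNgt; apply/negP => hlt.
have := h (rnorm x / rnorm y).
have -> : (rnorm x / rnorm y) ^+ 2 * rnorm y ^+ 2 = rnorm x ^+ 2.
  by rewrite expr_div_n divfK// expf_neq0// gt_eqF.
have [x0|xn0] := eqVneq (rnorm x) 0.
  move: x0 hlt => /eqP; rewrite rnorm_eq0 => /eqP ->.
  by rewrite rnorm0 mul0r /rdot linear0l/= ltxx.
have {}nx : 0 < rnorm x by rewrite lt_neqAle eq_sym xn0.
have : rnorm x / rnorm y * (rnorm x * rnorm y) < rnorm x / rnorm y * rdot dot x y.
  by rewrite ltr_pM2l// divr_gt0.
have -> : rnorm x / rnorm y * (rnorm x * rnorm y) = rnorm x ^+ 2.
  by rewrite mulrACA mulVf ?gt_eqF// mulr1 expr2.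
rewrite -(mulrA 2); set w := rnorm x / rnorm y * _; lra.
Qed.

(** Multiplying x by the conjugate of <x, y> makes the inner product real. *)
Lemma dot_le x y : rnorm (dot x y) <= rnorm x * rnorm y.
Proof.
have [->|w0] := eqVneq (dot x y) 0; first by rewrite rnorm0 mulr_ge0 ?rnorm_ge0.
have wgt : 0 < rnorm (dot x y) by rewrite rnorm_gt0.
have := rdot_le (conjc (dot x y) *: x) y.
rewrite rnormZ rnormJ -mulrA.
suff -> : rdot dot (conjc (dot x y) *: x) y = rnorm (dot x y) * rnorm (dot x y).
  by rewrite ler_pM2l.
rewrite /rdot dotZl -expr2 rnorm_sqrE; case: (dot x y) => a b /=.
by rewrite !expr2 mulNr opprK.
Qed.

Lemma norm_rdot_le x y : `|rdot dot x y| <= rnorm x * rnorm y.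
Proof. by rewrite (le_trans (Re_le_rnorm _))// dot_le. Qed.

Lemma cvg_dotl (T : Type) (F : set_system T) {FF : Filter F} (f : T -> X) x y :
  f @ F --> x ->
  (dot (f t) y : R[i]^o) @[t --> F] --> (dot x y : R[i]^o).
Proof.
move=> /cvg_rnormP fx; apply: (cvg_rnorm_squeeze (g := fun t => rnorm (f t - x) * rnorm y)).
  by apply: nearW => t; rewrite -dotBl dot_le.
by rewrite -[X in _ --> X](mul0r (rnorm y)); apply: cvgM => //; exact: cvg_cst.
Qed.

Lemma cvg_rdotl (T : Type) (F : set_system T) {FF : Filter F} (f : T -> X) x y :
  f @ F --> x -> rdot dot (f t) y @[t --> F] --> rdot dot x y.
Proof.
move=> /(cvg_dotl (y:=y))/cvg_rnormP/cvgrPdist_lt fx; apply/cvgrPdist_lt => e /fx.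
apply: filterS => t; rewrite sub0r normrN ger0_norm ?rnorm_ge0//.
by apply: le_lt_trans; rewrite distrC -Re_sub Re_le_rnorm.
Qed.

End InnerProduct.

(** * Expansions in a Riesz basis *)

Section RieszBasis.
Context (R : realType) (X : completeNormedModType R[i]).
Context (dot : {dot X for Num.conj}).
Hypothesis dot_norm : forall x : X, dot x x = `|x| ^+ 2.
Context (phi psi : nat -> X) (m M : R).
Hypothesis phi_dense :
  dense [set x | exists N (a : nat -> R[i]), x = \sum_(n < N) a n *: phi n].
Hypotheses (m_gt0 : 0 < m) (M_gt0 : 0 < M).
Hypothesis phi_bounds : forall N (a : nat -> R[i]),
  m * \sum_(n < N) rnorm (a n) ^+ 2
    <= rnorm (\sum_(n < N) a n *: phi n) ^+ 2
    <= M * \sum_(n < N) rnorm (a n) ^+ 2.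
Hypothesis biorthogonal : forall n k, dot (phi n) (psi k) = (n == k)%:R.
Implicit Types (x y : X) (a : nat -> R[i]).

Definition partial_expansion x N := \sum_(n < N) dot x (psi n) *: phi n.

Lemma dot_span N a n :
  dot (\sum_(k < N) a k *: phi k) (psi n) = if (n < N)%N then a n else 0.
Proof.
rewrite dot_suml; under eq_bigr do rewrite dotZl biorthogonal.
case: ltnP => nN.
  rewrite (bigD1 (Ordinal nN))//= eqxx mulr1 big1 ?addr0// => i /negP h.
  by case: eqP => [e|]; [case: h; apply/eqP/val_inj|rewrite mulr0].
by rewrite big1// => i _; rewrite ltn_eqF ?mulr0// (leq_trans _ nN).
Qed.

Lemma big_ord_widen0 (V : zmodType) N N' (F : nat -> V) : (N <= N')%N ->
  \sum_(n < N) F n = \sum_(n < N') if (n < N)%N then F n else 0.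
Proof. by move=> h; rewrite (big_ord_widen _ _ h) big_mkcond. Qed.

Lemma partial_expansion_span N a N' : (N <= N')%N ->
  let x := \sum_(k < N) a k *: phi k in partial_expansion x N' = x.
Proof.
move=> h x; rewrite {2}/x (big_ord_widen0 (fun k => a k *: phi k) h).
by apply: eq_bigr => i _; rewrite dot_span; case: ifP; rewrite ?scale0r.
Qed.

Lemma span_approx x (e : R) : 0 < e -> exists N a,
  rnorm (x - \sum_(n < N) a n *: phi n) < e.
Proof.
move=> e0; have e0' : 0 < e%:C by rewrite ltcR.
have [||y [xy [N [a ya]]]] := phi_dense (O := ball x e%:C).
- by exists x; exact: ballxx.
- exact: ball_open.
by exists N, a; rewrite -ya -ltcR -rnormE; move: xy; rewrite -ball_normE.
Qed.

Lemma span_sequence x : exists y : nat -> X,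
  (forall k, exists N a, y k = \sum_(n < N) a n *: phi n) /\ y @ \oo --> x.
Proof.
have h k : exists y, (exists N a, y = \sum_(n < N) a n *: phi n) /\
    rnorm (y - x) <= k.+1%:R^-1.
  have [|N [a ha]] := @span_approx x k.+1%:R^-1; first by rewrite invr_gt0.
  exists (\sum_(n < N) a n *: phi n); rewrite rdistC ltW//.
  by split=> //; exists N, a.
have [y hy] := choice h; exists y; split=> [k|]; first by case: (hy k).
apply: (cvg_rnorm_squeeze (g := fun k => k.+1%:R^-1)).
  by apply: nearW => k; case: (hy k).
exact: cvg_harmonic.
Qed.

(** Known for finite combinations of basis vectors, and both sides are
    continuous. *)
Lemma bessel x N : m * \sum_(n < N) rnorm (dot x (psi n)) ^+ 2 <= rnorm x ^+ 2.
Proof.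
have [y [yS yx]] := span_sequence x.
apply: (@ler_cvg_to _ \oo _ _ (fun k => m * \sum_(n < N) rnorm (dot (y k) (psi n)) ^+ 2)
  (fun k => rnorm (y k) ^+ 2)).
- apply: cvgM; first exact: cvg_cst.
  apply: cvg_bigsum => n _; rewrite expr2.
  under eq_fun do rewrite expr2.
  by apply: cvgM; apply: (@cvg_rnorm _ R[i]^o); exact: cvg_dotl.
- by rewrite expr2; under eq_fun do rewrite expr2; apply: cvgM; exact: cvg_rnorm.
apply: nearW => k; have [K [a ya]] := yS k.
have h := @partial_expansion_span K a (maxn K N) (leq_maxl _ _).
rewrite /= -ya in h; rewrite -{2}h.
have /andP[+ _] := phi_bounds (maxn K N) (fun n => dot (y k) (psi n)).
apply: le_trans; rewrite ler_pM2l//.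
rewrite (big_ord_widen0 (fun n => rnorm (dot (y k) (psi n)) ^+ 2) (leq_maxr K N)).
by apply: ler_sum => n _; case: ifP => // _; rewrite sqr_ge0.
Qed.

Lemma partial_expansion_bound x N :
  rnorm (partial_expansion x N) <= (1 + M / m) * rnorm x.
Proof.
have C1 : 1 <= 1 + M / m by rewrite lerDl divr_ge0// ltW.
rewrite -(ler_pXn2r (n:=2))// ?nnegrE ?rnorm_ge0//; last first.
  by rewrite mulr_ge0 ?rnorm_ge0// (le_trans _ C1).
have /andP[_ h] := phi_bounds N (fun n => dot x (psi n)).
rewrite (le_trans h)// exprMn.
apply: (@le_trans _ _ (M / m * rnorm x ^+ 2)).
  by rewrite -mulrA ler_pM2l// mulrC ler_pdivlMr// mulrC bessel.
rewrite ler_wpM2r ?sqr_ge0//; set q := M / m.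
have : 0 <= q by rewrite divr_ge0// ltW.
by move=> q0; rewrite expr2; nra.
Qed.

(** The partial expansions are exact from some rank on for finite combinations,
    and they are uniformly bounded operators. *)
Lemma cvg_partial_expansion x : partial_expansion x @ \oo --> x.
Proof.
apply/cvg_rnormP/cvgrPdist_le => e e0.
have C0 : 0 < 1 + M / m by rewrite addr_gt0// divr_gt0.
have [|N [a ha]] := @span_approx x (e / (1 + M / m + 1)).
  by rewrite divr_gt0// addr_gt0.
exists N => // N' /= NN'; rewrite sub0r normrN ger0_norm ?rnorm_ge0//.
have hy := partial_expansion_span a NN'.
set y := \sum_(n < N) a n *: phi n in ha hy; rewrite /= in hy.
have -> : partial_expansion x N' - x = partial_expansion (x - y) N' - (x - y).
  suff -> : partial_expansion (x - y) N' = partial_expansion x N' - partial_expansion y N'.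
    by rewrite hy opprB addrA subrK.
  rewrite -sumrB; apply: eq_bigr => i _.
  by rewrite dotBl scalerBl.
rewrite (le_trans (ler_rnormB _ _))//.
rewrite (le_trans (lerD (partial_expansion_bound (x - y) N') (lexx _)))//.
rewrite -[X in _ + X]mul1r -mulrDl mulrC -ler_pdivlMr; last by rewrite addr_gt0.
exact: ltW.
Qed.

Lemma upper_riesz x K :
  (forall N, \sum_(n < N) rnorm (dot x (psi n)) ^+ 2 <= K) ->
  rnorm x ^+ 2 <= M * K.
Proof.
move=> h.
apply: (@ler_cvg_to _ \oo _ _ (fun N => rnorm (partial_expansion x N) ^+ 2)
  (fun=> M * K)); last 2 first.
- exact: cvg_cst.
- apply: nearW => N; have /andP[_ +] := phi_bounds N (fun n => dot x (psi n)).
  by move/le_trans; apply; rewrite ler_pM2l.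
rewrite expr2; under eq_fun do rewrite expr2.
by apply: cvgM; apply: cvg_rnorm; exact: cvg_partial_expansion.
Qed.

Lemma coef_inj x y : (forall n, dot x (psi n) = dot y (psi n)) -> x = y.
Proof.
move=> h; apply/eqP; rewrite -subr_eq0 -rnorm_eq0 -sqrf_eq0 eq_le sqr_ge0 andbT.
rewrite (le_trans (upper_riesz (K := 0) _)) ?mulr0// => N.
by rewrite big1// => n _; rewrite dotBl h subrr rnorm0 expr0n.
Qed.

(** Riesz-Fischer: the partial sums are Cauchy because the tails of a convergent
    series are. *)
Lemma riesz_fischer a K : (forall N, \sum_(n < N) rnorm (a n) ^+ 2 <= K) ->
  exists x, forall n, dot x (psi n) = a n.
Proof.
move=> aK; pose s N := \sum_(n < N) rnorm (a n) ^+ 2.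
have s_nd : nondecreasing_seq s.
  apply/nondecreasing_seqP => n; rewrite /s big_ord_recr/= lerDl.
  by rewrite sqr_ge0.
have s_cvg : cvgn s.
  by apply: nondecreasing_is_cvgn => //; exists K => _ [N _ <-]; exact: aK.
have tail N N' : (N <= N')%N ->
    rnorm (\sum_(n < N') a n *: phi n - \sum_(n < N) a n *: phi n) ^+ 2
      <= M * (limn s - s N).
  move=> NN'.
  have sl : s N' <= limn s by exact: nondecreasing_cvgn_le.
  pose b n := if (n < N)%N then 0 else a n.
  have -> : \sum_(n < N') a n *: phi n - \sum_(n < N) a n *: phi n =
      \sum_(n < N') b n *: phi n.
    rewrite (big_ord_widen0 (fun n => a n *: phi n) NN') -sumrB.
    by apply: eq_bigr => i _; rewrite /b; case: ifP; rewrite ?scale0r ?subrr ?subr0.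
  have /andP[_ h] := phi_bounds N' b; rewrite (le_trans h)// ler_pM2l//.
  rewrite lerBrDr (le_trans _ sl)// /s.
  rewrite (big_ord_widen0 (fun n => rnorm (a n) ^+ 2) NN') -big_split/=.
  apply: ler_sum => i _; rewrite /b; case: ifP => _; rewrite ?addr0//.
  by rewrite rnorm0 expr0n add0r.
have [x hx] : exists x : X, (fun N => \sum_(n < N) a n *: phi n) @ \oo --> x.
  apply: rnorm_cauchy_cvg => e e0.
  have d0 : 0 < (e / 2) ^+ 2 / M by rewrite divr_gt0// exprn_gt0// divr_gt0.
  have /cvgrPdist_lt/(_ _ d0)[N _ hN] := s_cvg.
  have near N' : (N <= N')%N ->
      rnorm (\sum_(n < N') a n *: phi n - \sum_(n < N) a n *: phi n) <= e / 2.
    move=> NN'; rewrite -(ler_pXn2r (n:=2))// ?nnegrE ?rnorm_ge0//; last first.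
      by rewrite divr_ge0// ltW.
    rewrite (le_trans (tail _ _ NN'))// mulrC -ler_pdivlMr//.
    by rewrite (le_trans _ (ltW (hN N (leqnn _))))//= ler_norm.
  exists N => n k Nn Nk.
  have -> : \sum_(i < n) a i *: phi i - \sum_(i < k) a i *: phi i =
    (\sum_(i < n) a i *: phi i - \sum_(i < N) a i *: phi i)
    - (\sum_(i < k) a i *: phi i - \sum_(i < N) a i *: phi i).
    by rewrite opprB addrA subrK.
  rewrite (le_trans (ler_rnormB _ _))// [leRHS](splitr e).
  by rewrite lerD// near.
exists x => n.
have /cvg_rnormP h : (dot (\sum_(k < N) a k *: phi k) (psi n) : R[i]^o) @[N --> \oo] -->
    (dot x (psi n) : R[i]^o) by exact: cvg_dotl.
apply/eqP; rewrite -subr_eq0 -rnorm_eq0; apply/eqP.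
apply: (cvg_unique (@Rhausdorff R) _ h).
apply: cvg_near_cst; exists n.+1 => // N /= nN.
by rewrite dot_span nN rdistC.
Qed.

(** Diagonal operators with bounded entries; they relate the resolvents of A at
    different points. *)
Lemma multiplier (mu : nat -> R[i]) C : (forall n, rnorm (mu n) <= C) ->
  exists L : X -> X, bounded_linear L /\
    forall x n, dot (L x) (psi n) = mu n * dot x (psi n).
Proof.
move=> muC.
have C0 : 0 <= C by rewrite (le_trans _ (muC 0%N))// rnorm_ge0.
have hsum x N : \sum_(n < N) rnorm (mu n * dot x (psi n)) ^+ 2
    <= C ^+ 2 * (rnorm x ^+ 2 / m).
  apply: (@le_trans _ _ (C ^+ 2 * \sum_(n < N) rnorm (dot x (psi n)) ^+ 2)).
    rewrite mulr_sumr; apply: ler_sum => n _.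
    rewrite rnormM exprMn ler_wpM2r ?sqr_ge0//.
    by rewrite ler_pXn2r// nnegrE rnorm_ge0.
  by rewrite ler_wpM2l ?sqr_ge0// ler_pdivlMr// mulrC bessel.
have ex x : exists y, forall n, dot y (psi n) = mu n * dot x (psi n).
  exact: (riesz_fischer (a := fun n => mu n * dot x (psi n)) (hsum x)).
have [L hL] := choice ex.
exists L; split=> //; split.
  move=> a x y; apply: coef_inj => n.
  by rewrite hL dotDl dotZl dotDl dotZl !hL; ring.
exists (C * (1 + M / m)) => x.
have q0 : 0 <= M / m by rewrite divr_ge0// ltW.
rewrite -(ler_pXn2r (n:=2))// ?nnegrE ?rnorm_ge0//; last first.
  by rewrite !mulr_ge0 ?rnorm_ge0// addr_ge0.
rewrite (le_trans (upper_riesz (K := C ^+ 2 * (rnorm x ^+ 2 / m)) _))//.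
  by move=> N; under eq_bigr do rewrite hL; exact: hsum.
rewrite !exprMn.
have -> : M * (C ^+ 2 * (rnorm x ^+ 2 / m)) = C ^+ 2 * (M / m) * rnorm x ^+ 2 by ring.
rewrite ler_wpM2r ?sqr_ge0// ler_wpM2l ?sqr_ge0//.
by move: q0; set q := M / m => q0; rewrite expr2; nra.
Qed.

End RieszBasis.

(** * The complex exponential *)

Section ComplexExponential.
Context (R : realType).
Implicit Types (z w : R[i]) (t : R).

Definition cexp z : R[i] :=
  (expR (complex.Re z) * cos (complex.Im z)) +i*
  (expR (complex.Re z) * sin (complex.Im z)).

Lemma cexp0 : cexp 0 = 1.
Proof. by rewrite /cexp/= expR0 cos0 sin0 mulr1 mulr0. Qed.

Lemma cexpD z w : cexp (z + w) = cexp z * cexp w.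
Proof.
apply/eqP; rewrite eq_complex; apply/andP; split; apply/eqP.
  by rewrite Re_mul/= Re_add Im_add expRD cosD; ring.
by rewrite Im_mul/= Re_add Im_add expRD sinD; ring.
Qed.

Lemma rnorm_cexp z : rnorm (cexp z) = expR (complex.Re z).
Proof.
apply/eqP; rewrite -(eqrXn2 (n := 2))// ?rnorm_ge0 ?expR_ge0//; apply/eqP.
by rewrite rnorm_sqrE/= !exprMn -mulrDr cos2Dsin2 mulr1.
Qed.

Lemma is_derive1_cvg_right (f : R -> R) (a : R) : is_derive (0 : R) 1 f a ->
  h^-1 * (f h - f 0) @[h --> (0 : R)^'+] --> a.
Proof.
move=> [df <-].
have h : h^-1 *: ((f \o shift 0) (h *: 1) - f 0) @[h --> (0 : R)^'] --> 'D_1 f 0.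
  exact: df.
apply: cvg_dnbhs_at_right; apply: cvg_trans h.
apply: near_eq_cvg; apply: nearW => x.
by rewrite /= /GRing.scale/= mulr1 addr0.
Qed.

Lemma cvg_cexp_quotient z :
  ((h^-1)%:C * (cexp (z * h%:C) - 1) : R[i]^o) @[h --> (0 : R)^'+] --> (z : R[i]^o).
Proof.
pose a := complex.Re z; pose b := complex.Im z.
have e h : cexp (z * h%:C) = (expR (a * h) * cos (b * h)) +i* (expR (a * h) * sin (b * h)).
  by rewrite /cexp Re_mul Im_mul/= !mulr0 subr0 add0r.
have dRe : is_derive (0 : R) 1 (fun h => expR (a * h) * cos (b * h)) a.
  apply: is_derive_eq.
  by rewrite !mulr0 expR0 cos0 sin0 /GRing.scale/=; ring.
have dIm : is_derive (0 : R) 1 (fun h => expR (a * h) * sin (b * h)) b.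
  apply: is_derive_eq.
  by rewrite !mulr0 expR0 cos0 sin0 /GRing.scale/=; ring.
have := is_derive1_cvg_right dRe; have := is_derive1_cvg_right dIm.
rewrite !mulr0 expR0 cos0 sin0 mulr1 mulr0.
under eq_fun do rewrite subr0.
move=> cI cR.
apply: (cvg_rnorm_squeeze (g := fun h =>
  `|h^-1 * (expR (a * h) * cos (b * h) - 1) - a| +
  `|h^-1 * (expR (a * h) * sin (b * h)) - b|)).
  apply: nearW => h; rewrite (le_trans (rnorm_le_ReIm _))//.
  by rewrite Re_sub Im_sub Re_mul Im_mul Re_sub Im_sub e/= !mul0r subr0 addr0 subr0.
rewrite -[X in _ --> X](addr0 (0 : R)); apply: cvgD.
  by apply/norm_cvg0P; rewrite -[X in _ --> X](subrr a); apply: cvgB => //; exact: cvg_cst.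
by apply/norm_cvg0P; rewrite -[X in _ --> X](subrr b); apply: cvgB => //; exact: cvg_cst.
Qed.

End ComplexExponential.

(** * Bounded semigroups with a Riesz basis of eigenvectors *)

Section OperatorNorm.
Context (R : realType).

Lemma opnorm_ub (U V : normedModType R[i]) (L : U -> V) x :
  bounded_linear L -> rnorm x <= 1 -> rnorm (L x) <= opnorm L.
Proof.
move=> [_ [K LK]] x1; apply: ub_le_sup; last by exists x.
exists `|K| => _ [y /= y1 <-]; rewrite (le_trans (LK y))//.
rewrite (le_trans (ler_wpM2r (rnorm_ge0 y) (ler_norm K)))//.
by rewrite ler_piMr.
Qed.

Lemma le_opnorm (U V : normedModType R[i]) (L : U -> V) x :
  bounded_linear L -> rnorm (L x) <= opnorm L * rnorm x.
Proof.
move=> Lb; have [->|x0] := eqVneq x 0.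
  have [_ [K LK]] := Lb; have := LK 0; rewrite rnorm0 !mulr0 => h.
  by rewrite h.
have nx : 0 < rnorm x by rewrite rnorm_gt0.
have := @opnorm_ub _ _ L ((rnorm x)^-1%:C *: x) Lb.
have [Ll _] := Lb.
have -> : L ((rnorm x)^-1%:C *: x) = (rnorm x)^-1%:C *: L x.
  have L0 : L 0 = 0.
    by have := Ll 1 0 0; rewrite scaler0 addr0 scale1r => /eqP; rewrite -subr_eq subrr eq_sym => /eqP.
  by have := Ll (rnorm x)^-1%:C x 0; rewrite L0 !addr0.
rewrite !rnormZ !rnorm_real ger0_norm ?invr_ge0 ?rnorm_ge0// mulVf ?gt_eqF//.
by move=> /(_ (lexx _)); rewrite mulrC ler_pdivrMr.
Qed.

Lemma opnorm_le (U V : normedModType R[i]) (L : U -> V) K :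
  (forall x, rnorm x <= 1 -> rnorm (L x) <= K) -> opnorm L <= K.
Proof.
move=> h; apply: ge_sup; first by exists (rnorm (L 0)), 0 => //=; rewrite rnorm0.
by move=> _ [y /= y1 <-]; exact: h.
Qed.

Lemma opnorm_ge0 (U V : normedModType R[i]) (L : U -> V) :
  bounded_linear L -> 0 <= opnorm L.
Proof.
by move=> Lb; rewrite (le_trans (rnorm_ge0 (L 0)))// opnorm_ub// rnorm0.
Qed.

Lemma bounded_linear_comp (U V W : normedModType R[i]) (L : V -> W) (S : U -> V) :
  bounded_linear L -> bounded_linear S -> bounded_linear (L \o S).
Proof.
move=> Lb Sb; split.
  by move=> a x y /=; rewrite Sb.1 Lb.1.
exists (opnorm L * opnorm S) => x /=.
by rewrite (le_trans (le_opnorm _ Lb))// -mulrA ler_wpM2l ?opnorm_ge0// le_opnorm.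
Qed.

Lemma bounded_linear_opp (U V : normedModType R[i]) (L : U -> V) :
  bounded_linear L -> bounded_linear (fun x => - L x).
Proof.
move=> [Ll [K LK]]; split; last by exists K => x; rewrite rnormN.
by move=> a x y; rewrite Ll opprD scalerN.
Qed.

Lemma bounded_linearB (U V : normedModType R[i]) (L : U -> V) x y :
  bounded_linear L -> L (x - y) = L x - L y.
Proof. by move=> [Ll _]; rewrite addrC -scaleN1r Ll scaleN1r addrC. Qed.

Lemma bounded_linearZ (U V : normedModType R[i]) (L : U -> V) a x :
  bounded_linear L -> L (a *: x) = a *: L x.
Proof.
move=> Lb; have L0 : L 0 = 0 by rewrite -(subrr 0) bounded_linearB// subrr.
by rewrite -[a *: x]addr0 Lb.1 L0 addr0.
Qed.

Lemma bounded_linearD (U V : normedModType R[i]) (L : U -> V) x y :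
  bounded_linear L -> L (x + y) = L x + L y.
Proof. by move=> [Ll _]; rewrite -[x]scale1r Ll !scale1r. Qed.

Lemma bounded_linear_sum (U V : normedModType R[i]) (L : U -> V) I (r : seq I)
    (F : I -> U) :
  bounded_linear L -> L (\sum_(i <- r) F i) = \sum_(i <- r) L (F i).
Proof.
move=> Lb; apply: (big_morph L) => [x y|]; first exact: bounded_linearD.
by rewrite -(subrr 0) bounded_linearB// subrr.
Qed.

End OperatorNorm.

Section BoundedSemigroup.
Context (R : realType) (X : completeNormedModType R[i]).
Context (A : operator X) (T : R -> X -> X).
Hypotheses (T_C0 : C0_semigroup T) (A_gen : generator A T).
Context (K : R).
Hypothesis T_bound : forall t x, 0 <= t -> rnorm (T t x) <= K * rnorm x.

Lemma semigroup_bounded_linear t : 0 <= t -> bounded_linear (T t).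
Proof. by case: T_C0 => h _ _ _; exact: h. Qed.

(** On an eigenvector, the N-th powers of T (t / N) and of the scalar exponential
    differ by a telescoping sum of N terms, each o(t / N) since both factors have
    the same derivative at 0. *)
Lemma semigroup_eigenvector l v t : op_eigenvector A l v -> 0 <= t ->
  T t v = cexp (l * t%:C) *: v.
Proof.
move=> [vA v0 Av] t0; have [T_lin T0 TD _] := T_C0.
have K0 : 0 <= K.
  have := T_bound v (lexx (0 : R)); rewrite T0.
  by rewrite -[leLHS]mul1r ler_pM2r ?rnorm_gt0// => /(le_trans ler01).
pose a := `|complex.Re l|.
pose g (s : R) := rnorm (T s v - cexp (l * s%:C) *: v).
have gE : h^-1 * g h @[h --> (0 : R)^'+] --> (0 : R).
  have [/(_ (conj vA Av)) dT _] := A_gen v (l *: v).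
  have dE := @cvg_cexp_quotient R l.
  have d : ((h^-1)%:C *: (T h v - v) - ((h^-1)%:C * (cexp (l * h%:C) - 1)) *: v)
      @[h --> (0 : R)^'+] --> (l *: v - l *: v).
    by apply: cvgB => //; apply: cvgZr_tmp.
  move/cvg_rnorm : d; rewrite subrr rnorm0; apply: cvg_trans.
  apply: near_eq_cvg; near=> h.
  have h0 : 0 < h by near: h; exact: nbhs_right_gt.
  rewrite /g -scalerA -scalerBr rnormZ rnorm_real ger0_norm ?invr_ge0 ?ltW//.
  congr (_ * rnorm _); rewrite scalerBl scale1r opprB addrA.
  by rewrite subrK.
have gstep s h : 0 <= s -> 0 <= h -> g (s + h) <= K * g h + expR (a * h) * g s.
  move=> s0 h0.
  have -> : g (s + h) = rnorm (T s (T h v - cexp (l * h%:C) *: v) +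
      cexp (l * h%:C) *: (T s v - cexp (l * s%:C) *: v)).
    have Tb := T_lin s s0.
    rewrite /g TD// (bounded_linearB _ _ Tb) (bounded_linearZ _ _ Tb).
    rewrite scalerBr scalerA -cexpD -mulrDr -rmorphD (addrC h).
    by rewrite addrA subrK.
  rewrite (le_trans (ler_rnormD _ _))// lerD ?T_bound// rnormZ rnorm_cexp.
  rewrite ler_wpM2r ?rnorm_ge0// ler_expR Re_mul/= mulr0 subr0.
  by rewrite ler_wpM2r// ler_norm.
have giter h N : 0 <= h -> g (N%:R * h) <= N%:R * (K * g h) * expR (a * (N%:R * h)).
  move=> h0; elim: N => [|N IH].
    by rewrite !mul0r /g mulr0 cexp0 scale1r T0 subrr rnorm0.
  have e1 : 1 <= expR (a * (N.+1%:R * h)).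
    rewrite -[leLHS]expR0 ler_expR; apply: mulr_ge0; first exact: normr_ge0.
    by apply: mulr_ge0.
  have Kg : 0 <= K * g h by rewrite mulr_ge0// rnorm_ge0.
  have -> : N.+1%:R * h = N%:R * h + h by rewrite -natr1 mulrDl mul1r.
  have e2 : N.+1%:R * h = N%:R * h + h by rewrite -natr1 mulrDl mul1r.
  rewrite (le_trans (gstep _ _ _ _))// ?mulr_ge0//.
  rewrite e2 in e1; rewrite -natr1 mulrDl mul1r mulrDl addrC lerD//.
    rewrite (le_trans (ler_wpM2l (expR_ge0 _) IH))//.
    by rewrite mulrCA -expRD -mulrDr (addrC h).
  by rewrite ler_peMr.
have gt0 : g t <= 0.
  apply/ler_addgt0Pr => e e0; rewrite add0r.
  have [->|tn0] := eqVneq t 0.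
    by rewrite /g mulr0 cexp0 scale1r T0 subrr rnorm0 ltW.
  have {}t0 : 0 < t by rewrite lt_neqAle eq_sym tn0.
  pose C := t * K * expR (a * t) + 1.
  have C0 : 0 < C by rewrite ltr_pwDr// !mulr_ge0// ?expR_ge0// ltW.
  have eC : 0 < e / C by rewrite divr_gt0.
  have /cvgrPdist_le/(_ _ eC) [d /= d0 hd] := gE.
  pose N := (Num.truncn (t / d)).+1.
  have Nt : t / d < N%:R by rewrite /N truncnS_gt.
  have h0 : 0 < t / N%:R by rewrite divr_gt0.
  have hlt : t / N%:R < d by rewrite ltr_pdivrMr// mulrC -ltr_pdivrMr.
  have := hd (t / N%:R); rewrite /= sub0r normrN gtr0_norm// => /(_ hlt h0).
  rewrite sub0r normrN ger0_norm; last first.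
    by rewrite mulr_ge0 ?rnorm_ge0// invr_ge0 ltW.
  rewrite mulrC ler_pdivrMr// => gh.
  have := giter (t / N%:R) N (ltW h0).
  rewrite [N%:R * (t / N%:R)]mulrC divfK ?pnatr_eq0// => /le_trans; apply.
  apply: (@le_trans _ _ (N%:R * (K * (e / C * (t / N%:R))) * expR (a * t))).
    by rewrite ler_wpM2r ?expR_ge0// ler_wpM2l// ler_wpM2l.
  have -> : N%:R * (K * (e / C * (t / N%:R))) * expR (a * t) = e / C * (t * K * expR (a * t)).
    by field; rewrite pnatr_eq0 gt_eqF.
  by rewrite mulrAC ler_pdivrMr// ler_pM2l// /C lerDl.
apply/eqP; rewrite -subr_eq0 -rnorm_eq0 eq_le rnorm_ge0 andbT; exact: gt0.
Unshelve. all: by end_near. Qed.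

End BoundedSemigroup.


Section DiagonalSemigroup.
Context (R : realType) (X : completeNormedModType R[i]).
Context (dot : {dot X for Num.conj}).
Hypothesis dot_norm : forall x : X, dot x x = `|x| ^+ 2.
Context (A : operator X) (T : R -> X -> X).
Hypotheses (T_C0 : C0_semigroup T) (A_gen : generator A T).
Context (K : R).
Hypothesis T_bound : forall t x, 0 <= t -> rnorm (T t x) <= K * rnorm x.
Context (phi psi : nat -> X) (lambda : nat -> R[i]) (m M : R).
Hypothesis phi_dense :
  dense [set x | exists N (a : nat -> R[i]), x = \sum_(n < N) a n *: phi n].
Hypotheses (m_gt0 : 0 < m) (M_gt0 : 0 < M).
Hypothesis phi_bounds : forall N (a : nat -> R[i]),
  m * \sum_(n < N) rnorm (a n) ^+ 2
    <= rnorm (\sum_(n < N) a n *: phi n) ^+ 2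
    <= M * \sum_(n < N) rnorm (a n) ^+ 2.
Hypothesis phi_eigen : forall n, op_eigenvector A (lambda n) (phi n).
Hypothesis biorthogonal : forall n k, dot (phi n) (psi k) = (n == k)%:R.

(** Both sides are continuous in x and agree on finite combinations of
    eigenvectors. *)
Lemma coef_semigroup t x n : 0 <= t ->
  dot (T t x) (psi n) = cexp (lambda n * t%:C) * dot x (psi n).
Proof.
move=> t0; have Tt := semigroup_bounded_linear T_C0 t0.
pose F x := dot (T t x) (psi n) - cexp (lambda n * t%:C) * dot x (psi n).
have Fspan N (a : nat -> R[i]) : F (\sum_(k < N) a k *: phi k) = 0.
  rewrite /F (bounded_linear_sum _ _ Tt) !dot_suml mulr_sumr -sumrB big1// => k _.
  rewrite (bounded_linearZ _ _ Tt) (semigroup_eigenvector T_C0 A_gen T_bound (phi_eigen k) t0).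
  rewrite !dotZl biorthogonal; case: eqVneq => [->|_]; last by rewrite !mulr0 subrr.
  by rewrite mulrCA subrr.
have FB y : F (x - y) = F x - F y.
  rewrite /F (bounded_linearB _ _ Tt) !dotBl.
  by ring.
pose C := (K + rnorm (cexp (lambda n * t%:C))) * rnorm (psi n) .
have FC y : rnorm (F y) <= C * rnorm y.
  rewrite (le_trans (ler_rnormB _ _))// /C 2!mulrDl lerD//.
    rewrite (le_trans (dot_le dot_norm _ _))// mulrAC ler_wpM2r ?rnorm_ge0//.
    exact: T_bound.
  by rewrite rnormM -mulrA ler_wpM2l ?rnorm_ge0// mulrC dot_le.
apply/eqP; rewrite -subr_eq0 -rnorm_eq0 eq_le rnorm_ge0 andbT.
rewrite -/(F x); apply/ler_addgt0Pr => e e0; rewrite add0r.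
have C1 : 0 < `|C| + 1 by rewrite ltr_pwDr.
have [N [a h]] := span_approx phi_dense x (divr_gt0 e0 C1).
rewrite -[F x]subr0 -(Fspan N a) -FB (le_trans (FC _))//.
rewrite (le_trans (ler_wpM2r (rnorm_ge0 _) (ler_norm C)))//.
rewrite (le_trans (ler_wpM2r (rnorm_ge0 _) (_ : _ <= `|C| + 1)))// ?lerDl//.
by rewrite mulrC -ler_pdivlMr// ltW.
Qed.

(** The derivative at 0 of the coefficients of the orbit. *)
Lemma coef_generator x n : dom A x ->
  dot (A x) (psi n) = lambda n * dot x (psi n).
Proof.
move=> xA.
have [/(_ (conj xA erefl)) dT _] := A_gen x (A x).
have {}dT : (dot ((h^-1)%:C *: (T h x - x)) (psi n) : R[i]^o) @[h --> (0 : R)^'+]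
    --> (dot (A x) (psi n) : R[i]^o) by exact: cvg_dotl.
have dE := @cvg_cexp_quotient R (lambda n).
have {}dE : ((h^-1)%:C * (cexp (lambda n * h%:C) - 1) * dot x (psi n) : R[i]^o)
    @[h --> (0 : R)^'+] --> (lambda n * dot x (psi n) : R[i]^o).
  exact: (cvgM dE (cvg_cst _)).
have : (0 : R[i]^o) @[h --> (0 : R)^'+] -->
    (dot (A x) (psi n) - lambda n * dot x (psi n) : R[i]^o).
  apply: cvg_trans (cvgB dT dE).
  apply: near_eq_cvg; near=> h.
  have h0 : 0 < h by near: h; exact: nbhs_right_gt.
  change (dot ((h^-1)%:C *: (T h x - x)) (psi n)
    - (h^-1)%:C * (cexp (lambda n * h%:C) - 1) * dot x (psi n) = 0).
  rewrite dotZl dotBl coef_semigroup ?ltW//.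
  by ring.
move/cvg_rnorm; rewrite rnorm0 => h.
apply/eqP; rewrite -subr_eq0 -rnorm_eq0; apply/eqP.
exact: (cvg_unique (@Rhausdorff R) h (cvg_cst _)).
Unshelve. all: by end_near. Qed.

(** Otherwise the orbit of the eigenvector would be unbounded. *)
Lemma Re_eigenvalue_le0 n : complex.Re (lambda n) <= 0.
Proof.
rewrite leNgt; apply/negP => a0; set a := complex.Re _ in a0.
have [_ v0 _] := phi_eigen n.
have h t : 0 <= t -> expR (a * t) <= K.
  move=> t0; have := T_bound (phi n) t0.
  rewrite (semigroup_eigenvector T_C0 A_gen T_bound (phi_eigen n) t0).
  by rewrite rnormZ ler_pM2r ?rnorm_gt0// rnorm_cexp Re_mul/= mulr0 subr0.
have K0 : 0 <= K by rewrite (le_trans _ (h 0 (lexx _)))// expR_ge0.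
have := h (K / a) (divr_ge0 K0 (ltW a0)).
rewrite mulrC divfK ?gt_eqF//; apply/negP; rewrite -ltNge.
by rewrite (lt_le_trans _ (expR_ge1Dx K))// ltrDr.
Qed.

(** The inverse of l' - A is a bounded multiplier times that of l - A, because the
    quotients of their eigenvalues are bounded. *)
Lemma bounded_inverse_shift l l' (d : R) : resolvent_set A l -> 0 < d ->
  (forall n, d <= rnorm (l' - lambda n)) ->
  exists S, bounded_inverse (dom A) (fun x => l' *: x - A x) S.
Proof.
move=> [S [Sb SR SL]] d0 dl.
have l'0 n : l' - lambda n != 0 by rewrite -rnorm_gt0 (lt_le_trans d0).
have coefR n x : dom A x ->
    dot (l *: x - A x) (psi n) = (l - lambda n) * dot x (psi n).
  by move=> xA; rewrite dotBl dotZl coef_generator// mulrBl.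
have coefR' n x : dom A x ->
    dot (l' *: x - A x) (psi n) = (l' - lambda n) * dot x (psi n).
  by move=> xA; rewrite dotBl dotZl coef_generator// mulrBl.
pose nu n := (l - lambda n) / (l' - lambda n).
have nuC n : rnorm (nu n) <= 1 + rnorm (l - l') / d.
  have -> : nu n = 1 + (l - l') / (l' - lambda n).
    rewrite /nu -{1}(divff (l'0 n)) -mulrDl; congr (_ / _).
    by ring.
  rewrite (le_trans (ler_rnormD _ _))// rnorm1 lerD2l rnormM rnormV.
  by rewrite ler_wpM2l ?rnorm_ge0// lef_pV2 ?posrE ?rnorm_gt0.
have [L [Lb hL]] := multiplier dot_norm phi_dense m_gt0 M_gt0 phi_bounds biorthogonal nuC.
have inj := coef_inj dot_norm phi_dense m_gt0 M_gt0 phi_bounds biorthogonal.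
have SLR y n : (l' - lambda n) * dot (S (L y)) (psi n) = dot y (psi n).
  have [lA lS] := SR (L y).
  have := coefR n _ lA; rewrite lS hL /nu => h.
  have [e0|e0] := eqVneq (l - lambda n) 0.
    have [vA v0 Av] := phi_eigen n; case/negP: v0; apply/eqP.
    have S0 : S 0 = 0 by rewrite -[in LHS](subrr 0) (bounded_linearB _ _ Sb) subrr.
    by rewrite -(SL _ vA) Av -scalerBl e0 scale0r S0.
  have -> : dot (S (L y)) (psi n) =
      (l - lambda n)^-1 * ((l - lambda n) * dot (S (L y)) (psi n)) by rewrite mulKf.
  by rewrite -h; field; apply/andP; split.
exists (S \o L); split.
- exact: bounded_linear_comp.
- move=> y /=; have [lA _] := SR (L y); split=> //; apply: inj => n.
  by rewrite coefR'.
move=> x xA /=; apply: inj => n.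
by rewrite -[LHS](mulKf (l'0 n)) SLR coefR'// mulKf.
Qed.

End DiagonalSemigroup.

(** * The Bochner integral tested against a vector *)

Section BochnerFunctional.
Context (R : realType) (X : completeNormedModType R[i]).
Context (dot : {dot X for Num.conj}).
Hypothesis dot_norm : forall x : X, dot x x = `|x| ^+ 2.
Context (d : measure_display) (S : measurableType d).
Context (mu : {measure set S -> \bar R}) (D : set S).
Hypotheses (mD : measurable D) (D_fin : (mu D < +oo)%E).

(** The integral is a supremum over simple functions, hence monotone also on
    functions of unknown measurability, such as the norm of the error in the
    definition of the Bochner integral. *)
Lemma le_integral_nonmeasurable (f g : S -> \bar R) :
  (forall x, D x -> (0 <= f x)%E) -> (forall x, D x -> (f x <= g x)%E) ->
  (\int[mu]_(x in D) f x <= \int[mu]_(x in D) g x)%E.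
Proof.
move=> f0 fg.
have g0 x : D x -> (0 <= g x)%E by move=> Dx; rewrite (le_trans (f0 _ Dx))// fg.
rewrite !ge0_integralE//; apply: le_ereal_sup => _ [h hf <-]; exists h => // x.
rewrite (le_trans (hf x))//= /patch; case: ifPn => // /set_mem Dx.
exact: fg.
Qed.

Lemma fimfun_functionalE (s : {fimfun S >-> X}) z x :
  rdot dot (s x) z =
  \sum_(v <- fset_set (range s)) rdot dot v z * \1_(s @^-1` [set v]) x.
Proof.
rewrite -fsbig_finite//=.
rewrite (fsbigD1 (s x))// /= indicE mem_set// mulr1 fsbig1 ?addr0//.
by move=> y [fy /= /nesym yfx]; rewrite indicE memNset ?mulr0.
Qed.

Lemma measurable_simple_functional (s : {fimfun S >-> X}) z :
  bochner_simple mu D s -> measurable_fun D (fun x => rdot dot (s x) z).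
Proof.
move=> ss; under eq_fun do rewrite fimfun_functionalE.
apply: measurable_sum => v; apply: measurable_funM; first exact: measurable_cst.
by apply: measurable_indic; case: (ss v).
Qed.

Lemma integrable_simple_functional (s : {fimfun S >-> X}) z :
  bochner_simple mu D s ->
  mu.-integrable D (EFin \o (fun x => rdot dot (s x) z)).
Proof.
move=> ss; apply: measurable_bounded_integrable => //.
  exact: measurable_simple_functional.
exists (\sum_(v <- fset_set (range s)) `|rdot dot v z|); split; first exact: num_real.
move=> K hK x _; apply: (le_trans _ (ltW hK)); rewrite /= fimfun_functionalE.
rewrite (le_trans (ler_norm_sum _ _ _))//; apply: ler_sum => v _.
rewrite normrM ler_piMr// indicE; case: (_ \in _); rewrite ?normr1 ?normr0//.
Qed.

Lemma functional_simple_integral (s : {fimfun S >-> X}) z :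
  bochner_simple mu D s ->
  rdot dot (simple_integral mu D s) z = \int[mu]_(x in D) rdot dot (s x) z.
Proof.
move=> ss; rewrite /simple_integral fsbig_finite//= rdot_suml.
rewrite /Rintegral.
under eq_integral do rewrite fimfun_functionalE -sumEFin.
have mI v : measurable (s @^-1` [set v]) by case: (ss v).
have fin v : (mu (s @^-1` [set v] `&` D) < +oo)%E.
  apply: le_lt_trans D_fin; apply: le_measure.
  - by apply: mem_set; apply: measurableI.
  - exact: mem_set.
  - by move=> x [].
have intI v : mu.-integrable D (EFin \o (\1_(s @^-1` [set v]) : S -> R)).
  apply: measurable_bounded_integrable => //.
  exists 1; split; first exact: num_real.
  move=> K hK x _; apply: (le_trans _ (ltW hK)); rewrite /= indicE.
  by case: (_ \in _); rewrite ?normr1 ?normr0.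
rewrite integral_sum//; last first.
  move=> v; under eq_fun do rewrite EFinM.
  by apply: integrableZl => //; exact: intI.
rewrite -sum_fine; last first.
  move=> v _; under eq_integral do rewrite EFinM.
  rewrite integralZl//; last exact: intI.
  by rewrite fin_numM//= integral_indic// ge0_fin_numE.
apply: eq_bigr => v _; rewrite rdotZl.
under [in RHS]eq_integral do rewrite EFinM.
rewrite integralZl//; last exact: intI.
rewrite integral_indic// fineM//; last by rewrite ge0_fin_numE.
by rewrite /= mulrC setIC.
Qed.

(** The Bochner integral is handled through its inner products, which are
    Lebesgue integrals; in particular it is unique. *)
Lemma functional_bochner f y z : is_bochner_integral mu D f y ->
  measurable_fun D (fun x => rdot dot (f x) z) ->
  mu.-integrable D (EFin \o (fun x => rdot dot (f x) z)) /\
  rdot dot y z = \int[mu]_(x in D) rdot dot (f x) z.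
Proof.
move=> [s [ss _ sf sy]] mf.
pose c := rnorm z + 1.
have c0 : 0 < c by rewrite ltr_pwDr// rnorm_ge0.
pose I n := (\int[mu]_(x in D) `|rdot dot (f x) z - rdot dot (s n x) z|%:E)%E.
have mfs n : measurable_fun D (fun x => rdot dot (f x) z - rdot dot (s n x) z).
  by apply: measurable_funB => //; exact: measurable_simple_functional.
have I0 n : (0 <= I n)%E by apply: integral_ge0 => x _; rewrite lee_fin.
have Ile n : (I n <= c%:E * \int[mu]_(x in D) (rnorm (f x - s n x))%:E)%E.
  rewrite -lee_pdivrMl//.
  rewrite -ge0_integralZl//; last 2 first.
  - by apply/measurable_EFinP; apply: measurableT_comp.
  - by rewrite lee_fin invr_ge0 ltW.
  apply: le_integral_nonmeasurable => x _.
    by rewrite -EFinM lee_fin mulr_ge0// invr_ge0 ltW.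
  rewrite -EFinM lee_fin mulrC ler_pdivrMr// -rdotBl.
  by rewrite (le_trans (norm_rdot_le _ _ _))// ler_wpM2l ?rnorm_ge0// lerDl.
have Icvg : I n @[n --> \oo] --> 0%E.
  apply: (@squeeze_cvge _ _ _ _ (cst 0%E) I
    (fun n => c%:E * \int[mu]_(x in D) (rnorm (f x - s n x))%:E)%E).
  - by apply: nearW => n; rewrite I0 Ile.
  - exact: cvg_cst.
  by rewrite -(mule0 c%:E); apply: cvgeZl.
have I_lt (e : R) : 0 < e -> \forall n \near \oo, (I n < e%:E)%E.
  move=> e0; apply: (Icvg [set y | (y < e%:E)%E]); apply: open_nbhs_nbhs; split.
    exact: open_ereal_lt_ereal.
  by rewrite /= lte_fin.
have [n In1] : exists n, (I n < 1%:E)%E.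
  by have [n _ h] := I_lt 1 ltr01; exists n; exact: h (leqnn _).
have intfs : mu.-integrable D (EFin \o (fun x => rdot dot (f x) z - rdot dot (s n x) z)).
  apply/integrableP; split; first exact/measurable_EFinP.
  exact: (lt_trans In1 (ltry _)).
have intf : mu.-integrable D (EFin \o (fun x => rdot dot (f x) z)).
  have -> : EFin \o (fun x => rdot dot (f x) z) =
    (fun x => (EFin \o (fun x => rdot dot (f x) z - rdot dot (s n x) z)%R) x
     + (EFin \o (fun x => rdot dot (s n x) z)) x)%E.
    by apply/funext => x /=; rewrite -EFinD subrK.
  by apply: integrableD => //; exact: integrable_simple_functional.
split=> //.
pose J := \int[mu]_(x in D) rdot dot (f x) z.
have cJ : rdot dot (simple_integral mu D (s k)) z @[k --> \oo] --> J.
  apply/cvgrPdist_lt => e e0.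
  move: (I_lt e e0).
  apply: filterS => k Ik; rewrite functional_simple_integral// -RintegralB//; last first.
    exact: integrable_simple_functional.
  rewrite -lte_fin; apply: le_lt_trans Ik.
  rewrite EFin_normr_Rintegral//; last first.
    rewrite (_ : _ \o _ = ((EFin \o (fun x => rdot dot (f x) z))
      \- (EFin \o (fun x => rdot dot (s k x) z)))%E)//.
    by apply: integrableB => //; exact: integrable_simple_functional.
  by apply: le_abse_integral => //; exact/measurable_EFinP.
have cy : rdot dot (simple_integral mu D (s k)) z @[k --> \oo] --> rdot dot y z.
  exact: cvg_rdotl.
exact: (cvg_unique (@Rhausdorff R) cy cJ).
Qed.

End BochnerFunctional.

(** * Existence of Bochner integrals *)

Section BochnerExistence.
Context (R : realType) (X : completeNormedModType R[i]).
Context (dot : {dot X for Num.conj}).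
Hypothesis dot_norm : forall x : X, dot x x = `|x| ^+ 2.
Context (d : measure_display) (S : measurableType d).
Context (mu : {measure set S -> \bar R}) (D : set S).
Hypotheses (mD : measurable D) (D_fin : (mu D < +oo)%E).

(** A function that nearly factors through a finite-valued map with measurable
    fibres is nearly simple. *)
Definition measurable_key (K : finType) (key : S -> K) :=
  forall k, measurable (key @^-1` [set k]).

Lemma measurable_key_preimage (K : finType) (key : S -> K) (P : set K) :
  measurable_key key -> measurable (key @^-1` P).
Proof.
move=> mk; rewrite (_ : _ @^-1` _ = \bigcup_(k in P) (key @^-1` [set k])).
  by apply: fin_bigcup_measurable => [|k _]; [exact: finite_finset|exact: mk].
by apply/seteqP; split=> [x Px|x [k Pk /= kx]]; [exists (key x)|rewrite /= kx].
Qed.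

Lemma measurable_key_pair (K L : finType) (k : S -> K) (l : S -> L) :
  measurable_key k -> measurable_key l -> measurable_key (fun x => (k x, l x)).
Proof.
move=> mk ml [a b].
rewrite (_ : _ @^-1` _ = (k @^-1` [set a]) `&` (l @^-1` [set b])).
  exact: measurableI.
by apply/seteqP; split=> [x /= [-> ->]|x /= [-> ->]].
Qed.

(** The key records which of finitely many equally spaced thresholds the value
    lies below. *)
Lemma finite_key (g : S -> R) (a b e : R) : measurable_fun setT g -> 0 < e ->
  exists (K : finType) (key : S -> K), measurable_key key /\
    forall x x', D x -> D x' -> a <= g x <= b -> a <= g x' <= b ->
      key x = key x' -> `|g x - g x'| <= e.
Proof.
move=> mg e0.
pose L := (Num.truncn ((b - a) / e)).+2.
pose key x := [ffun i : 'I_L => g x < a + i%:R * e].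
exists _, key; split.
  move=> k; rewrite (_ : _ @^-1` _ =
      \bigcap_(i in [set: 'I_L]) [set x | (g x < a + i%:R * e) = k i]).
    apply: fin_bigcap_measurable; first exact: finite_finset.
    move=> i _; have m : measurable [set x | g x < a + i%:R * e].
      rewrite (_ : [set _ | _] = setT `&` g @^-1` `]-oo, a + i%:R * e[%classic).
        by apply: mg => //; exact: measurable_itv.
      by rewrite setTI; apply/seteqP; split=> x /=; rewrite in_itv.
    case: (k i); first by rewrite (_ : [set _ | _] = [set x | g x < a + i%:R * e]).
    rewrite (_ : [set _ | _] = ~` [set x | g x < a + i%:R * e]).
      exact: measurableC.
    by apply/seteqP; split=> x /=; [move=> ->|move/negP/negbTE].
  apply/seteqP; split=> [x <- i _|x h] /=; first by rewrite ffunE.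
  by apply/ffunP => i; rewrite ffunE; exact: h.
suff h x x' : a <= g x <= b -> key x = key x' -> g x' - g x <= e.
  move=> x x' _ _ gx gx' kk; rewrite ler_norml; apply/andP; split.
    by rewrite lerNl opprB h.
  by rewrite h.
move=> /andP[ax xb] kk.
have q0 : 0 <= (g x - a) / e by rewrite divr_ge0 ?subr_ge0// ltW.
have [l1 l2] : (Num.truncn ((g x - a) / e))%:R <= (g x - a) / e /\
   (g x - a) / e < (Num.truncn ((g x - a) / e)).+1%:R.
  by have /andP[] := truncn_itv q0.
set j := Num.truncn _ in l1 l2.
have jL : (j.+1 < L)%N.
  by rewrite ltnS ltnS le_truncn// ler_pM2r ?invr_gt0// lerB.
have : key x (Ordinal jL) = key x' (Ordinal jL) by rewrite kk.
rewrite !ffunE/= => kj.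
have : g x < a + j.+1%:R * e by rewrite -ltrBlDl -ltr_pdivrMr.
rewrite kj => h.
have : a + j%:R * e <= g x by rewrite -lerBrDl -ler_pdivlMr.
move: h; rewrite -natr1 mulrDl mul1r; lra.
Qed.

(** A function that is uniformly approximable by functions of a finite key is
    Bochner integrable: the integrals of the approximations form a Cauchy
    sequence, as testing them against their difference shows. *)
Lemma bochner_uniform (f : S -> X) :
  (forall e : R, 0 < e -> exists (K : finType) (key : S -> K),
     measurable_key key /\
     forall x x', D x -> D x' -> key x = key x' -> rnorm (f x - f x') <= e) ->
  exists y, is_bochner_integral mu D f y.
Proof.
move=> hf.
have approx n : exists s : {fimfun S >-> X}, bochner_simple mu D s /\
    forall x, D x -> rnorm (f x - s x) <= n.+1%:R^-1.
  have [|K [key [mk hk]]] := hf n.+1%:R^-1; first by rewrite invr_gt0.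
  pose rep k := xget point [set x | D x /\ key x = k].
  pose g k := f (rep k).
  have fin : finite_set (range (g \o key)).
    apply: (@sub_finite_set _ _ (g @` setT)) => [_ [x _ <-]|]; first by exists (key x).
    by apply: finite_image; exact: finite_finset.
  pose s := fimfun_Sub (mem_set fin : g \o key \in fimfun).
  exists s; split.
    move=> v; split; first exact: (measurable_key_preimage (g @^-1` [set v]) mk).
    move=> _; apply: le_lt_trans D_fin; apply: le_measure.
    - apply: mem_set; apply: measurableI => //.
      exact: (measurable_key_preimage (g @^-1` [set v]) mk).
    - exact: mem_set.
    - by move=> x [].
  move=> x Dx; have [Drep krep] : D (rep (key x)) /\ key (rep (key x)) = key x.
    by apply: (xgetPex point (P := [set y | D y /\ key y = key x])); exists x.
  exact: hk.
have [s hs] := choice approx.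
pose V := fine (mu D).
have VE : mu D = V%:E by rewrite fineK// ge0_fin_numE.
have V0 : 0 <= V by exact: fine_ge0.
pose I n := simple_integral mu D (s n).
have ss n : bochner_simple mu D (s n) by case: (hs n).
have sf n x : D x -> rnorm (f x - s n x) <= n.+1%:R^-1 by case: (hs n) => _; exact.
have IB n k : rnorm (I n - I k) <= V * (n.+1%:R^-1 + k.+1%:R^-1).
  set z := I n - I k; set c := _ + _.
  have c0 : 0 <= c by rewrite addr_ge0// invr_ge0.
  have h : rnorm z ^+ 2 <= V * (c * rnorm z).
    rewrite -(rdot_sqr dot_norm) {1}/z rdotBl !(functional_simple_integral _ mD D_fin)//.
    rewrite -RintegralB//; [|exact: integrable_simple_functional..].
    apply: (@le_trans _ _ (\int[mu]_(x in D) (c * rnorm z))).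
      apply: le_Rintegral => //.
      - rewrite (_ : _ \o _ = ((EFin \o (fun x => rdot dot (s n x) z))
          \- (EFin \o (fun x => rdot dot (s k x) z)))%E)//.
        by apply: integrableB => //; exact: integrable_simple_functional.
      - apply: measurable_bounded_integrable => //; exists `|c * rnorm z|; split=> //.
        by move=> B hB x _; exact: ltW.
      move=> x Dx; rewrite -rdotBl (le_trans (rdot_le dot_norm _ _))//.
      rewrite ler_wpM2r ?rnorm_ge0//.
      have -> : s n x - s k x = (f x - s k x) - (f x - s n x).
        by rewrite opprB [RHS]addrC addrA subrK.
      by rewrite (le_trans (ler_rnormB _ _))// /c addrC lerD// sf.
    by rewrite Rintegral_cst// mulrC.
  have [z0|z0] := eqVneq (rnorm z) 0; first by rewrite z0 mulr_ge0.
  move: h; rewrite expr2 mulrA ler_pM2r//.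
  by rewrite lt_neqAle eq_sym z0 rnorm_ge0.
have [y Iy] : exists y : X, I @ \oo --> y.
  apply: rnorm_cauchy_cvg => e e0.
  pose N := Num.truncn (2 * (V + 1) / e).
  have hN : 2 * (V + 1) / e < N.+1%:R by rewrite truncnS_gt.
  have V1 : 0 < V + 1 by rewrite ltr_pwDr.
  exists N => n k Nn Nk; rewrite (le_trans (IB n k))//.
  have small j : (N <= j)%N -> j.+1%:R^-1 <= e / (2 * (V + 1)).
    move=> Nj; rewrite -[leRHS]invf_div lef_pV2 ?posrE ?divr_gt0 ?mulr_gt0//.
    by rewrite (le_trans (ltW hN))// ler_nat ltnS.
  apply: (@le_trans _ _ (V * (e / (2 * (V + 1)) + e / (2 * (V + 1))))).
    by rewrite ler_wpM2l// lerD// small.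
  have -> : V * (e / (2 * (V + 1)) + e / (2 * (V + 1))) = V / (V + 1) * e.
    by field; rewrite gt_eqF.
  by rewrite ler_piMl ?ltW// ltr_pdivrMr// mul1r ltrDl.
exists y; exists s; split=> //.
  apply: aeW => x Dx; apply: (cvg_rnorm_squeeze (g := fun n => n.+1%:R^-1)).
    by apply: nearW => n; rewrite rdistC sf.
  exact: cvg_harmonic.
apply: (@squeeze_cvge _ _ _ _ (cst 0%E) _ (fun n => (n.+1%:R^-1)%:E * V%:E)%E).
- apply: nearW => n; apply/andP; split.
    by apply: integral_ge0 => x _; rewrite lee_fin rnorm_ge0.
  apply: (@le_trans _ _ (\int[mu]_(x in D) (cst (n.+1%:R^-1)%:E) x)%E).
    apply: le_integral_nonmeasurable => // x Dx; rewrite lee_fin ?rnorm_ge0//.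
    exact: sf.
  by rewrite integral_cst// VE.
- exact: cvg_cst.
rewrite -(mul0e V%:E); apply: cvgeZr => //.
apply: cvg_EFin; first by apply: nearW.
exact: cvg_harmonic.
Qed.

End BochnerExistence.

(** * The input-to-state integral *)

Section LebesgueFacts.
Context (R : realType).
Notation mu := (@lebesgue_measure R).

Lemma ae_imply (P Q : R -> Prop) : (forall x, P x -> Q x) ->
  {ae mu, forall x, P x} -> {ae mu, forall x, Q x}.
Proof. by move=> PQ; apply: filterS; first exact: (ae_filter_ringOfSetsType mu). Qed.

(** The function f agrees almost everywhere with the minimum of f and g. *)
Lemma ae_le_Rintegral (D : set R) (f g : R -> R) : measurable D ->
  mu.-integrable D (EFin \o f) -> mu.-integrable D (EFin \o g) ->
  {ae mu, forall x, D x -> f x <= g x} ->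
  \int[mu]_(x in D) f x <= \int[mu]_(x in D) g x.
Proof.
move=> mD fi gi fg.
have mf : measurable_fun D f by apply/measurable_EFinP; exact: measurable_int fi.
have mg : measurable_fun D g by apply/measurable_EFinP; exact: measurable_int gi.
pose k := f \min g.
have mk : measurable_fun D k by exact: measurable_minr.
have fk : ae_eq mu D (EFin \o f) (EFin \o k).
  by apply: ae_imply fg => x h Dx; rewrite /k/= min_l// h.
have -> : \int[mu]_(x in D) f x = \int[mu]_(x in D) k x.
  by congr fine; apply: ae_eq_integral => //; exact/measurable_EFinP.
apply: le_Rintegral => //; last by move=> x _; rewrite ge_min lexx orbT.
apply/integrableP; split; first exact/measurable_EFinP.
have /integrableP[_] := fi; apply: le_lt_trans.
rewrite le_eqVlt; apply/orP; left; apply/eqP; apply: ae_eq_integral => //.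
- by apply: measurableT_comp => //; exact/measurable_EFinP.
- by apply: measurableT_comp => //; exact/measurable_EFinP.
by apply: ae_imply fk => x h Dx; have /= [E] := h Dx; rewrite /= ?E.
Qed.

Lemma integrable_continuous (t : R) (h : R -> R) : continuous h ->
  mu.-integrable `[0, t] (EFin \o (fun s => h (t - s))).
Proof.
move=> ch; apply: continuous_compact_integrable; first exact: segment_compact.
apply: continuous_subspaceT => s.
apply: (@continuous_comp _ _ _ (fun s => t - s) h); last exact: ch.
by apply: cvgB; [exact: cvg_cst|exact: cvg_id].
Qed.

Lemma Rintegral_reverse (t : R) (H h : R -> R) : 0 <= t ->
  (forall x : R, is_derive x (1 : R) H (h x)) -> continuous h ->
  \int[mu]_(s in `[0, t]) h (t - s) = H t - H 0.
Proof.
move=> t0 dH ch; have [<-|tn0] := eqVneq 0 t.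
  by rewrite set_itv1 Rintegral_set1 subrr.
have {}t0 : 0 < t by rewrite lt_neqAle tn0.
pose F s := - H (t - s).
have dF s : is_derive s (1 : R) F (h (t - s)).
  have d1 : is_derive s (1 : R) (fun s : R => t - s) (-1).
    by apply: is_derive_eq; rewrite add0r mul1r.
  have := @is_derive1_comp _ H (fun s : R => t - s) s _ _ (dH (t - s)) d1.
  by move=> ?; apply: is_derive_eq; rewrite mulrN1 opprK.
have cF : continuous F.
  by move=> s; apply/differentiable_continuous/derivable1_diffP; case: (dF s).
rewrite /Rintegral (@continuous_FTC2 _ _ F)//.
- by rewrite /F subrr subr0/= opprK addrC.
- apply: continuous_subspaceT => s.
  apply: (@continuous_comp _ _ _ (fun s => t - s) h); last exact: ch.
  by apply: cvgB; [exact: cvg_cst|exact: cvg_id].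
- split; first by move=> s _; case: (dF s).
    by apply: cvg_at_right_filter; exact: cF.
  by apply: cvg_at_left_filter; exact: cF.
by move=> s _; rewrite derive1E; case: (dF s).
Qed.

End LebesgueFacts.

Section StateIntegral.
Context (R : realType) (X : completeNormedModType R[i]).
Context (dot : {dot X for Num.conj}).
Hypothesis dot_norm : forall x : X, dot x x = `|x| ^+ 2.
Context (A : operator X) (T : R -> X -> X).
Hypotheses (T_C0 : C0_semigroup T) (A_gen : generator A T).
Context (K : R).
Hypothesis T_bound : forall t x, 0 <= t -> rnorm (T t x) <= K * rnorm x.
Context (b : X).
Notation mu := (@lebesgue_measure R).

Lemma lebesgue_segment_fin (t : R) : (mu `[0%R, t]%classic < +oo)%E.
Proof. by rewrite lebesgue_measure_itv/=; case: ifP => _; rewrite ltry. Qed.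

(** The integrand oscillates little when both the time and the input value do. *)
Lemma bochner_state (u : R -> R[i]) (V t : R) : 
  measurable_fun setT (fun s => complex.Re (u s)) ->
  measurable_fun setT (fun s => complex.Im (u s)) ->
  (forall s, rnorm (u s) <= V) ->
  exists y, is_bochner_integral mu `[0, t] (fun s => T (t - s) (u s *: b)) y.
Proof.
move=> mRe mIm uV.
have V0 : 0 <= V by rewrite (le_trans _ (uV 0))// rnorm_ge0.
apply: (bochner_uniform dot_norm); [exact: measurable_itv|exact: lebesgue_segment_fin|].
have K0 : 0 <= `|K| by [].
move=> e e0.
pose C := `|K| * rnorm b + V * `|K| + 1.
have C0 : 0 < C by rewrite ltr_pwDr// addr_ge0// mulr_ge0// rnorm_ge0.
pose e1 := e / C; have e10 : 0 < e1 by rewrite divr_gt0.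
have [dl dl0 hd] : exists2 dl : R, 0 < dl &
    forall h, 0 <= h -> h < dl -> rnorm (T h b - b) <= e1.
  have [_ T0 _ /(_ b)/cvg_rnormP/cvgrPdist_le/(_ _ e10)[dl /= dl0 hd]] := T_C0.
  exists dl => // h h0 hdl; have [->|hn0] := eqVneq h 0.
    by rewrite T0 subrr rnorm0 ltW.
  have {}h0 : 0 < h by rewrite lt_neqAle eq_sym hn0.
  have := hd h; rewrite /= !sub0r !normrN (gtr0_norm h0) => /(_ hdl h0).
  by rewrite ger0_norm ?rnorm_ge0.
have [K1 [k1 [mk1 hk1]]] := @finite_key _ _ _ `[0, t] (fun s => s) 0 t (dl / 2)
  (@measurable_id _ _ setT) (divr_gt0 dl0 (ltr0n _ 2)).
have [K2 [k2 [mk2 hk2]]] := @finite_key _ _ _ `[0, t] _ (- V) V (e1 / 2)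
  mRe (divr_gt0 e10 (ltr0n _ 2)).
have [K3 [k3 [mk3 hk3]]] := @finite_key _ _ _ `[0, t] _ (- V) V (e1 / 2)
  mIm (divr_gt0 e10 (ltr0n _ 2)).
exists _, (fun s => (k1 s, (k2 s, k3 s))); split.
  by apply: measurable_key_pair => //; exact: measurable_key_pair.
move=> s s' sD s'D [h1 h2 h3].
have [s0 st] : 0 <= s /\ s <= t by apply/andP; move: sD; rewrite /= in_itv.
have [s'0 s't] : 0 <= s' /\ s' <= t by apply/andP; move: s'D; rewrite /= in_itv.
have {h1} ds : `|s - s'| <= dl / 2 by apply: hk1 => //; apply/andP; split.
have du : rnorm (u s - u s') <= e1.
  rewrite (le_trans (rnorm_le_ReIm _))// Re_sub Im_sub (splitr e1) lerD//.
    by apply: hk2 => //; rewrite -ler_norml (le_trans (Re_le_rnorm _)).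
  by apply: hk3 => //; rewrite -ler_norml (le_trans (Im_le_rnorm _)).
have [T_lin _ TD _] := T_C0.
have ts : 0 <= t - s by rewrite subr_ge0.
have ts' : 0 <= t - s' by rewrite subr_ge0.
have Tb r x : 0 <= r -> rnorm (T r x) <= `|K| * rnorm x.
  by move=> r0; rewrite (le_trans (T_bound _ r0))// ler_wpM2r ?rnorm_ge0// ler_norm.
have near_time r r' : 0 <= r -> 0 <= r' -> `|r - r'| <= dl / 2 ->
    rnorm (T r b - T r' b) <= `|K| * e1.
  have one p q : 0 <= p -> p <= q -> q - p <= dl / 2 -> rnorm (T q b - T p b) <= `|K| * e1.
    move=> p0 pq pqd.
    have -> : T q b = T p (T (q - p) b) by rewrite -TD ?subr_ge0// addrC subrK.
    rewrite -(bounded_linearB _ _ (T_lin _ p0)) (le_trans (Tb _ _ p0))// ler_wpM2l//.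
    by apply: hd; [rewrite subr_ge0|lra].
  move=> r0 r'0; have [rr|/ltW rr] := leP r r' => hr.
    rewrite rdistC; apply: one => //.
    by rewrite distrC in hr; rewrite (le_trans (ler_norm _)).
  by apply: one => //; rewrite (le_trans (ler_norm _)).
have Tz r a : 0 <= r -> T r (a *: b) = a *: T r b.
  by move=> r0; rewrite (bounded_linearZ _ _ (T_lin _ r0)).
rewrite !Tz//.
have -> : u s *: T (t - s) b - u s' *: T (t - s') b =
   (u s - u s') *: T (t - s) b + u s' *: (T (t - s) b - T (t - s') b).
  by rewrite scalerBl scalerBr addrA subrK.
rewrite (le_trans (ler_rnormD _ _))// !rnormZ.
apply: (@le_trans _ _ (e1 * (`|K| * rnorm b) + V * (`|K| * e1))).
  rewrite lerD// ler_pM ?rnorm_ge0//; first exact: Tb.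
  apply: near_time => //.
  by rewrite distrC opprB addrC addrA subrK.
have -> : e1 * (`|K| * rnorm b) + V * (`|K| * e1) = e1 * (`|K| * rnorm b + V * `|K|).
  by ring.
by rewrite /e1 mulrAC ler_pdivrMr// ler_pM2l// /C lerDl.
Qed.

(** The functional z turns the state into a scalar convolution with kernel P. *)
Lemma functional_integral (u : R -> R[i]) (t : R) (y z : X) (P : R -> R[i]) :
  measurable_fun (`[0, +oo[%classic : set R) (fun s => complex.Re (u s)) ->
  measurable_fun (`[0, +oo[%classic : set R) (fun s => complex.Im (u s)) ->
  is_bochner_integral mu `[0, t] (fun s => T (t - s) (u s *: b)) y ->
  (forall s, 0 <= s -> s <= t ->
     rdot dot (T (t - s) (u s *: b)) z = complex.Re (u s * P (t - s))) ->
  continuous (fun s => complex.Re (P s)) -> continuous (fun s => complex.Im (P s)) ->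
  mu.-integrable `[0, t] (EFin \o (fun s => complex.Re (u s * P (t - s)))) /\
  rdot dot y z = \int[mu]_(s in `[0, t]) complex.Re (u s * P (t - s)).
Proof.
move=> mRe mIm yint zP cRe cIm.
have sub : `[0, t]%classic `<=` (`[0, +oo[%classic : set R).
  by move=> s /=; rewrite !in_itv/= andbT => /andP[].
have cont_meas (g : R -> R) : continuous g ->
    measurable_fun `[0, t]%classic (fun s => g (t - s)).
  move=> cg; apply: measurable_funTS.
  apply: continuous_measurable_fun => s.
  apply: (@continuous_comp _ _ _ (fun s => t - s) g); last exact: cg.
  by apply: cvgB; [exact: cvg_cst|exact: cvg_id].
have zP' : {in `[0, t]%classic, (fun s => complex.Re (u s * P (t - s))) =1
    (fun s => rdot dot (T (t - s) (u s *: b)) z)}.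
  by move=> s /set_mem; rewrite /= in_itv/= => /andP[s0 st]; rewrite zP.
have m : measurable_fun `[0, t]%classic
    (fun s => rdot dot (T (t - s) (u s *: b)) z).
  apply: (eq_measurable_fun (fun s => complex.Re (u s) * complex.Re (P (t - s)) -
    complex.Im (u s) * complex.Im (P (t - s)))).
    by move=> s st; rewrite -zP'// Re_mul.
  have mRe' : measurable_fun `[0, t]%classic (fun s => complex.Re (u s)).
    exact: measurable_funS mRe.
  have mIm' : measurable_fun `[0, t]%classic (fun s => complex.Im (u s)).
    exact: measurable_funS mIm.
  apply: measurable_funB; apply: measurable_funM => //.
    exact: (cont_meas (fun s => complex.Re (P s))).
  exact: (cont_meas (fun s => complex.Im (P s))).
have mD : measurable (`[0, t]%classic : set R) by exact: measurable_itv.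
have [intf ->] := functional_bochner (mu := mu) dot_norm mD (lebesgue_segment_fin t) yint m.
split; last by congr fine; apply: eq_integral => s st; rewrite zP'.
by apply: eq_integrable intf => // s st; rewrite /= -zP'.
Qed.

(** The convolution is at most the integral of any majorant of V |P|; a majorant
    with an explicit primitive makes the bound computable. *)
Lemma functional_le (u : R -> R[i]) (V t : R) (y z : X) (P : R -> R[i]) (H h : R -> R) :
  0 <= t ->
  measurable_fun (`[0, +oo[%classic : set R) (fun s => complex.Re (u s)) ->
  measurable_fun (`[0, +oo[%classic : set R) (fun s => complex.Im (u s)) ->
  {ae mu, forall s, (`[0, +oo[%classic : set R) s -> rnorm (u s) <= V} ->
  is_bochner_integral mu `[0, t] (fun s => T (t - s) (u s *: b)) y ->
  (forall s, 0 <= s -> s <= t ->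
     rdot dot (T (t - s) (u s *: b)) z = complex.Re (u s * P (t - s))) ->
  continuous (fun s => complex.Re (P s)) -> continuous (fun s => complex.Im (P s)) ->
  (forall s : R, is_derive s (1 : R) H (h s)) -> continuous h ->
  (forall s, V * rnorm (P s) <= h s) ->
  rdot dot y z <= H t - H 0.
Proof.
move=> t0 mRe mIm uV yint zP cRe cIm dH ch Ph.
have [intf ->] := functional_integral mRe mIm yint zP cRe cIm.
rewrite -(Rintegral_reverse t0 dH ch); apply: ae_le_Rintegral => //.
  exact: integrable_continuous.
apply: ae_imply uV => s us sD.
have /us {}us : (`[0, +oo[%classic : set R) s.
  by move: sD; rewrite /= !in_itv/= andbT => /andP[].
rewrite (le_trans _ (Ph _))//.
rewrite (le_trans (le_trans (ler_norm _) (Re_le_rnorm _)))// rnormM.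
by rewrite ler_wpM2r ?rnorm_ge0.
Qed.

End StateIntegral.

(** * A large sieve inequality for exponential sums in a strip *)

Section SeparatedPoints.
Context (R : realType).

Lemma sum_inv_sqr (N : nat) : \sum_(k < N) (k.+1%:R ^- 2 : R) <= 2.
Proof.
case: N => [|N]; first by rewrite big_ord0.
apply: (@le_trans _ _ (2 - N.+1%:R^-1)); last by rewrite lerBlDr lerDl invr_ge0.
elim: N => [|N IH]; first by rewrite big_ord1 expr1n invr1; lra.
rewrite big_ord_recr/= (le_trans (lerD IH (lexx _)))// -addrA lerD2l.
have a0 : (0 : R) < N.+1%:R by rewrite ltr0n.
have -> : (N.+2%:R : R) = N.+1%:R + 1 by rewrite -natr1.
set a := N.+1%:R in a0 *; have a1 : 0 < a + 1 by rewrite addr_gt0.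
rewrite -subr_ge0.
have -> : - (a + 1)^-1 - (- a^-1 + (a + 1) ^- 2) = (a * (a + 1) ^+ 2)^-1.
  by field; rewrite !gt_eqF.
by rewrite invr_ge0 mulr_ge0 ?sqr_ge0// ltW.
Qed.

Lemma sum_injective_le (I : finType) (Q : {pred I}) (k : I -> nat) (N : nat)
    (f : nat -> R) :
  (forall j, 0 <= f j) -> {in Q &, injective k} -> (forall i, (k i < N.+1)%N) ->
  \sum_(i in Q) f (k i) <= \sum_(j < N.+1) f j.
Proof.
move=> f0 kinj kN; pose k' i : 'I_N.+1 := inord (k i).
have k'E i : k' i = k i :> nat by rewrite inordK.
have -> : \sum_(i in Q) f (k i) = \sum_(j in [set k' i | i in Q]%SET) f j.
  rewrite big_imset/=; first by apply: eq_bigr => i _; rewrite k'E.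
  move=> i j iQ jQ /(congr1 (@nat_of_ord _)); rewrite !k'E.
  exact: kinj.
by rewrite big_mkcond; apply: ler_sum => j _; case: ifP.
Qed.

Context (I : finType) (P : {pred I}) (y : I -> R) (d : R).
Hypothesis d_gt0 : 0 < d.
Hypothesis sep : forall i j, i \in P -> j \in P -> i != j -> d <= `|y i - y j|.

(** On either side of y i the points lie in distinct cells of length d. *)
Lemma sum_separated_le (i : I) (f : nat -> R) (N : nat) : i \in P ->
  (forall j, 0 <= f j) ->
  (forall j, (Num.truncn (`|y i - y j| / d)%R < N.+1)%N) ->
  \sum_(j in P) f (Num.truncn (`|y i - y j| / d)) <= 2 * \sum_(k < N.+1) f k.
Proof.
move=> iP f0 kN; pose k j := Num.truncn (`|y i - y j| / d); change (forall j, (k j < N.+1)%N) in kN.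
change (\sum_(j in P) f (k j) <= 2 * \sum_(k < N.+1) f k).
have cell j j' : k j = k j' -> `| `|y i - y j| - `|y i - y j'| | < d.
  move=> kk.
  have bnd l : (k l)%:R * d <= `|y i - y l| /\ `|y i - y l| < (k l)%:R * d + d.
    have q0 : 0 <= `|y i - y l| / d by rewrite divr_ge0// ltW.
    have /andP[l1 l2] := truncn_itv q0.
    rewrite ler_pdivlMr// in l1; rewrite ltr_pdivrMr// in l2.
    by rewrite -natr1 mulrDl mul1r in l2.
  have [h1 h2] := bnd j; have [h3 h4] := bnd j'; rewrite -kk in h3 h4.
  by rewrite ltr_norml; apply/andP; split; lra.
rewrite (bigID (fun j => y j <= y i))/= mulr_natl mulr2n lerD//.
  have -> : \sum_(j in P | y j <= y i) f (k j)
      = \sum_(j in [pred j | (j \in P) && (y j <= y i)]) f (k j) by [].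
  apply: sum_injective_le => // j j' /andP[jP yj] /andP[j'P yj'] /cell.
  rewrite (ger0_norm (_ : 0 <= y i - y j)) ?(ger0_norm (_ : 0 <= y i - y j')) ?subr_ge0// => h.
  apply/eqP/negPn/negP => jj'.
  have := sep jP j'P jj'; rewrite leNgt; move/negP; apply.
  have -> : y j - y j' = - (y i - y j - (y i - y j')) by ring.
  by rewrite normrN.
have -> : \sum_(j in P | ~~ (y j <= y i)) f (k j)
    = \sum_(j in [pred j | (j \in P) && ~~ (y j <= y i)]) f (k j) by [].
apply: sum_injective_le => // j j' /andP[jP yj] /andP[j'P yj'] /cell.
rewrite -ltNge in yj; rewrite -ltNge in yj'.
rewrite (ltr0_norm (_ : y i - y j < 0)) ?(ltr0_norm (_ : y i - y j' < 0)) ?subr_lt0// => h.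
apply/eqP/negPn/negP => jj'.
have := sep jP j'P jj'; rewrite leNgt; move/negP; apply.
have -> : y j - y j' = - (y i - y j) - - (y i - y j') by ring.
by [].
Qed.

(** The kernel is at most 1/r, and decays like the inverse square of the
    distance, which is at least k d in the k-th cell. *)
Lemma schur_row (X : I -> R) (r : R) (i : I) : 0 < r ->
  (forall j, j \in P -> r <= X j <= 3 * r) -> i \in P ->
  \sum_(j in P) X j / (X j ^+ 2 + (y i - y j) ^+ 2) <= 2 / r + 12 * r / d ^+ 2.
Proof.
move=> r0 Xr iP.
pose f k := if k is k'.+1 then 3 * r / d ^+ 2 * k'.+1%:R ^- 2 else r^-1.
have f0 k : 0 <= f k.
  case: k => [|k]/=; first by rewrite invr_ge0 ltW.
  by rewrite !mulr_ge0 ?invr_ge0 ?sqr_ge0// ltW.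
pose k j := Num.truncn (`|y i - y j| / d).
pose N := (\max_j k j)%N.
have kN j : (k j < N.+1)%N by rewrite ltnS; exact: leq_bigmax.
apply: (@le_trans _ _ (\sum_(j in P) f (k j))).
  apply: ler_sum => j jP; have /andP[rX X3r] := Xr j jP.
  have X0 : 0 < X j by rewrite (lt_le_trans r0).
  have Y0 : 0 <= (y i - y j) ^+ 2 by rewrite sqr_ge0.
  have S0 : 0 < X j ^+ 2 + (y i - y j) ^+ 2 by rewrite ltr_pwDl// exprn_gt0.
  case kE : (k j) => [|k'] /=.
    rewrite ler_pdivrMr// mulrC ler_pdivlMr//.
    by apply: (@le_trans _ _ (X j ^+ 2)); [rewrite expr2 ler_pM2l|rewrite lerDl].
  have q0 : 0 <= `|y i - y j| / d by rewrite divr_ge0// ltW.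
  have /andP[+ _] := truncn_itv q0; rewrite -/(k j) kE ler_pdivlMr// => h.
  have kd : 0 < k'.+1%:R * d by rewrite mulr_gt0.
  have h2 : (k'.+1%:R * d) ^+ 2 <= (y i - y j) ^+ 2.
    by rewrite -[leRHS]real_normK ?num_real// ler_pXn2r// nnegrE ltW.
  apply: (@le_trans _ _ (X j / (k'.+1%:R * d) ^+ 2)).
    rewrite ler_pM2l// lef_pV2 ?posrE ?exprn_gt0//.
    by rewrite (le_trans h2)// lerDr sqr_ge0.
  apply: (@le_trans _ _ (3 * r / (k'.+1%:R * d) ^+ 2)).
    by rewrite ler_pM2r ?invr_gt0 ?exprn_gt0.
  by rewrite exprMn invfM mulrA mulrAC.
rewrite (le_trans (sum_separated_le iP f0 kN))//.
rewrite big_ord_recl/= -mulr_sumr mulrDr lerD2l.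
have -> : 12 * r / d ^+ 2 = 2 * (3 * r / d ^+ 2 * 2) by ring.
rewrite ler_pM2l// ler_wpM2l ?sum_inv_sqr//.
by rewrite !mulr_ge0 ?invr_ge0 ?sqr_ge0// ltW.
Qed.

End SeparatedPoints.


Section ExponentialSums.
Context (R : realType).

Lemma is_derive_bigsum (I : Type) (s : seq I) (P : pred I) (F : I -> R -> R)
    (f : I -> R) (x : R) :
  (forall i, P i -> is_derive x (1 : R) (F i) (f i)) ->
  is_derive x (1 : R) (fun t => \sum_(i <- s | P i) F i t) (\sum_(i <- s | P i) f i).
Proof.
move=> h; elim: s => [|i s IH].
  rewrite big_nil (_ : (fun _ => _) = cst 0); last first.
    by apply/funext => t; rewrite big_nil.
  exact: is_derive_cst.
rewrite big_cons.
have -> : (fun t => \sum_(j <- i :: s | P j) F j t) =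
    if P i then F i + (fun t => \sum_(j <- s | P j) F j t)
    else (fun t => \sum_(j <- s | P j) F j t).
  by apply/funext => t; rewrite big_cons; case: ifP.
by case: ifP => Pi //; apply: is_deriveD; exact: h.
Qed.

Lemma continuous_bigsum (I : Type) (s : seq I) (P : pred I) (F : I -> R -> R) :
  (forall i, P i -> continuous (F i)) ->
  continuous (fun t => \sum_(i <- s | P i) F i t).
Proof. by move=> h x; apply: cvg_bigsum => i Pi; exact: h. Qed.

Lemma continuous_mulrl (a : R) : continuous (fun s : R => a * s).
Proof. by move=> s; apply: cvgM; [exact: cvg_cst|exact: cvg_id]. Qed.

Lemma continuous_expR_scaled (a : R) : continuous (fun s : R => expR (a * s)).
Proof.
move=> s; apply: (@continuous_comp _ _ _ (fun s => a * s) expR).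
  exact: continuous_mulrl.
exact: continuous_expR.
Qed.

Lemma continuous_cos_scaled (a : R) : continuous (fun s : R => cos (a * s)).
Proof.
move=> s; apply: (@continuous_comp _ _ _ (fun s => a * s) cos).
  exact: continuous_mulrl.
exact: continuous_cos.
Qed.

Lemma continuous_sin_scaled (a : R) : continuous (fun s : R => sin (a * s)).
Proof.
move=> s; apply: (@continuous_comp _ _ _ (fun s => a * s) sin).
  exact: continuous_mulrl.
exact: continuous_sin.
Qed.

Context (I : finType) (P : {pred I}) (x y p q : I -> R) (r d : R).
Hypotheses (r_gt0 : 0 < r) (d_gt0 : 0 < d).
Hypothesis x_strip : forall i, i \in P -> r <= x i < 2 * r.
Hypothesis sep : forall i j, i \in P -> j \in P -> i != j -> d <= `|y i - y j|.

Let X i j := x i + x j - r.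
Let Y i j := y i - y j.
Let W i j := p i * p j + q i * q j.

Let X_bounds i j : i \in P -> j \in P -> r <= X i j <= 3 * r.
Proof.
move=> /x_strip/andP[a1 a2] /x_strip/andP[b1 b2].
by rewrite /X; apply/andP; split; lra.
Qed.

Let X_gt0 i j : i \in P -> j \in P -> 0 < X i j.
Proof. by move=> iP jP; have /andP[/(lt_le_trans r_gt0)] := X_bounds iP jP. Qed.

Let norm_gt0 i j : i \in P -> j \in P -> 0 < X i j ^+ 2 + Y i j ^+ 2.
Proof. by move=> iP jP; rewrite ltr_pwDl ?sqr_ge0// exprn_gt0// X_gt0. Qed.

(** The squared modulus of an exponential sum, weighted by the exponential of
    r s and averaged with that of the sum with conjugate exponents. The average
    leaves only the cosines of the frequency differences Y, whose integrals
    X / (X^2 + Y^2) are summable over separated frequencies; the integrals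
    1 / (X + i Y) that the modulus alone would give are not. *)
Definition sieve_energy (s : R) := \sum_(i in P) \sum_(j in P)
  W i j * (expR (- X i j * s) * cos (Y i j * s)).

Definition sieve_primitive (s : R) := \sum_(i in P) \sum_(j in P)
  W i j * (expR (- X i j * s) * (Y i j * sin (Y i j * s) - X i j * cos (Y i j * s))
    / (X i j ^+ 2 + Y i j ^+ 2)).

Lemma continuous_sieve_energy : continuous sieve_energy.
Proof.
apply: continuous_bigsum => i _; apply: continuous_bigsum => j _ s.
apply: cvgM; first exact: cvg_cst.
by apply: cvgM; [exact: continuous_expR_scaled|exact: continuous_cos_scaled].
Qed.

Lemma is_derive_sieve (s : R) :
  is_derive s (1 : R) sieve_primitive (sieve_energy s).
Proof.
apply: is_derive_bigsum => i iP; apply: is_derive_bigsum => j jP.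
have h := norm_gt0 iP jP.
apply: is_derive_eq; rewrite /GRing.scale/=.
by field; rewrite gt_eqF.
Qed.

Lemma sum_sqr (a : I -> R) :
  (\sum_(i in P) a i) ^+ 2 = \sum_(i in P) \sum_(j in P) a i * a j.
Proof.
by rewrite expr2 mulr_suml; apply: eq_bigr => i _; rewrite mulr_sumr.
Qed.

Lemma sieve_energyE (s : R) : sieve_energy s = expR (r * s) *
  ((\sum_(i in P) expR (- x i * s) * (p i * cos (y i * s))) ^+ 2 +
   (\sum_(i in P) expR (- x i * s) * (q i * sin (y i * s))) ^+ 2 +
   (\sum_(i in P) expR (- x i * s) * (q i * cos (y i * s))) ^+ 2 +
   (\sum_(i in P) expR (- x i * s) * (p i * sin (y i * s))) ^+ 2).
Proof.
rewrite !sum_sqr -!big_split/= mulr_sumr; apply: eq_bigr => i _.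
rewrite -!big_split/= mulr_sumr; apply: eq_bigr => j _.
have -> : - X i j * s = r * s + - x i * s + - x j * s by rewrite /X; ring.
have -> : Y i j * s = y i * s - y j * s by rewrite /Y; ring.
by rewrite !expRD cosB /W; ring.
Qed.

Lemma sieve_energy_ge0 (s : R) : 0 <= sieve_energy s.
Proof. by rewrite sieve_energyE mulr_ge0 ?expR_ge0// !addr_ge0// sqr_ge0. Qed.

(** By (u - v)^2 <= 2 u^2 + 2 v^2 in the real and in the imaginary part. *)
Lemma sqr_modulus_le (s : R) :
  (\sum_(i in P) expR (- x i * s) * (p i * cos (y i * s) - q i * sin (y i * s))) ^+ 2 +
  (\sum_(i in P) expR (- x i * s) * (p i * sin (y i * s) + q i * cos (y i * s))) ^+ 2
  <= 2 * (expR (- (r * s)) * sieve_energy s).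
Proof.
rewrite sieve_energyE (mulrA (expR _)) -expRD addNr expR0 mul1r.
under eq_bigr do rewrite mulrBr; under [X in _ + X ^+ 2]eq_bigr do rewrite mulrDr.
rewrite sumrB big_split/=.
set a := \sum_(i in P) _; set b := \sum_(i in P) _.
set c := \sum_(i in P) _; set e := \sum_(i in P) _.
have := sqr_ge0 (a + b); have := sqr_ge0 (c - e); rewrite !expr2; lra.
Qed.

(** The primitive is nondecreasing and tends to 0. *)
Lemma sieve_primitive_le0 (t : R) : 0 <= t -> sieve_primitive t <= 0.
Proof.
move=> t0; rewrite leNgt; apply/negP => Gt.
have mono s : t <= s -> sieve_primitive t <= sieve_primitive s.
  move=> ts; apply: (@ger0_derive1_ndecr _ sieve_primitive t s) => //.
  - by move=> z _; case: (is_derive_sieve z).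
  - by move=> z _; rewrite derive1E; case: (is_derive_sieve z) => _ ->; exact: sieve_energy_ge0.
  apply: continuous_subspaceT => z; apply/differentiable_continuous/derivable1_diffP.
  by case: (is_derive_sieve z).
pose C := \sum_(i in P) \sum_(j in P) `|W i j| *
  ((`|Y i j| + `|X i j|) / (X i j ^+ 2 + Y i j ^+ 2)).
have C0 : 0 <= C.
  apply: sumr_ge0 => i iP; apply: sumr_ge0 => j jP.
  apply: mulr_ge0 => //; apply: divr_ge0; first exact: addr_ge0.
  exact/ltW/norm_gt0.
have decay s : 0 <= s -> sieve_primitive s <= C * expR (- (r * s)).
  move=> s0; rewrite /C mulr_suml; apply: ler_sum => i iP.
  rewrite mulr_suml; apply: ler_sum => j jP.
  have D0 : 0 <= (X i j ^+ 2 + Y i j ^+ 2)^-1 by rewrite invr_ge0 ltW// norm_gt0.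
  rewrite (le_trans (ler_norm _))//.
  have -> : `|W i j| * ((`|Y i j| + `|X i j|) / (X i j ^+ 2 + Y i j ^+ 2)) * expR (- (r * s))
    = `|W i j| * (expR (- (r * s)) * (`|Y i j| + `|X i j|) * (X i j ^+ 2 + Y i j ^+ 2)^-1).
    by ring.
  rewrite !normrM (ger0_norm D0) (ger0_norm (expR_ge0 _)) ler_wpM2l// ler_wpM2r//.
  rewrite ler_pM ?expR_ge0//.
    have /andP[rX _] := X_bounds iP jP.
    by rewrite ler_expR mulNr lerN2 ler_wpM2r.
  rewrite (le_trans (ler_normB _ _))// lerD// normrM ler_piMr//.
    by rewrite ler_norml sin_geN1 sin_le1.
  by rewrite ler_norml cos_geN1 cos_le1.
pose s := t + C / sieve_primitive t / r.
have q0 : 0 <= C / sieve_primitive t / r.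
  by rewrite !divr_ge0// ltW.
have ts : t <= s by rewrite /s lerDl.
have s0 : 0 <= s by rewrite (le_trans t0).
have rs : C / sieve_primitive t <= r * s.
  rewrite -[leLHS](divfK (lt0r_neq0 r_gt0)) mulrC ler_pM2l// /s lerDr//.
have : sieve_primitive t <= C * expR (- (r * s)).
  by rewrite (le_trans (mono _ ts))// decay.
rewrite expRN ler_pdivlMr ?expR_gt0//.
apply/negP; rewrite -ltNge mulrC -ltr_pdivrMr//.
by rewrite (le_lt_trans rs)// (lt_le_trans _ (expR_ge1Dx _))// ltrDr.
Qed.

(** Schur's test for the symmetric kernel with entries X / (X^2 + Y^2). *)
Lemma sieve (t : R) : 0 <= t -> sieve_primitive t - sieve_primitive 0 <=
  (2 / r + 12 * r / d ^+ 2) * \sum_(i in P) (p i ^+ 2 + q i ^+ 2).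
Proof.
move=> t0.
pose k i j := X i j / (X i j ^+ 2 + Y i j ^+ 2).
pose n i := p i ^+ 2 + q i ^+ 2.
have kC i j : k i j = k j i.
  by rewrite /k /X /Y (addrC (x i)) -(sqrrN (y i - y j)) opprB.
have -> : sieve_primitive 0 = - \sum_(i in P) \sum_(j in P) W i j * k i j.
  rewrite -sumrN; apply: eq_bigr => i _; rewrite -sumrN; apply: eq_bigr => j _.
  by rewrite !mulr0 expR0 cos0 sin0 /k; ring.
rewrite opprK.
apply: (@le_trans _ _ (\sum_(i in P) \sum_(j in P) W i j * k i j)).
  by rewrite gerDr sieve_primitive_le0.
apply: (@le_trans _ _ (\sum_(i in P) \sum_(j in P)
    (n i / 2 * k i j + n j / 2 * k j i))).
  apply: ler_sum => i iP; apply: ler_sum => j jP.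
  rewrite (kC j i) -mulrDl ler_wpM2r//.
    by apply: divr_ge0; apply: ltW; [exact: X_gt0|exact: norm_gt0].
  rewrite /W /n; have := sqr_ge0 (p i - p j); have := sqr_ge0 (q i - q j).
  by rewrite !expr2; lra.
under eq_bigr do rewrite big_split/=.
rewrite big_split/= [X in _ + X]exchange_big/= -big_split/=.
rewrite mulr_sumr; apply: ler_sum => i iP.
rewrite -mulr_sumr -mulrDl -splitr mulrC ler_wpM2r ?addr_ge0 ?sqr_ge0//.
apply: (schur_row d_gt0 sep (X := X i)) => // j jP.
exact: X_bounds.
Qed.

End ExponentialSums.

(** * Bounding the state by the input *)

Section StateEstimates.
Context (R : realType) (X : completeNormedModType R[i]).
Context (dot : {dot X for Num.conj}).
Hypothesis dot_norm : forall x : X, dot x x = `|x| ^+ 2.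
Context (A : operator X) (T : R -> X -> X).
Hypotheses (T_C0 : C0_semigroup T) (A_gen : generator A T).
Context (K : R).
Hypothesis T_bound : forall t x, 0 <= t -> rnorm (T t x) <= K * rnorm x.
Context (phi psi : nat -> X) (lambda : nat -> R[i]) (m M : R).
Hypothesis phi_dense :
  dense [set x | exists N (a : nat -> R[i]), x = \sum_(n < N) a n *: phi n].
Hypotheses (m_gt0 : 0 < m) (M_gt0 : 0 < M).
Hypothesis phi_bounds : forall N (a : nat -> R[i]),
  m * \sum_(n < N) rnorm (a n) ^+ 2
    <= rnorm (\sum_(n < N) a n *: phi n) ^+ 2
    <= M * \sum_(n < N) rnorm (a n) ^+ 2.
Hypothesis phi_eigen : forall n, op_eigenvector A (lambda n) (phi n).
Hypothesis biorthogonal : forall n k, dot (phi n) (psi k) = (n == k)%:R.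
Context (b : X).
Notation mu := (@lebesgue_measure R).
Notation c n := (dot b (psi n)).

Lemma Re_cexp_scaled (l : R[i]) s : complex.Re (cexp (l * s%:C)) =
  expR (complex.Re l * s) * cos (complex.Im l * s).
Proof. by rewrite /cexp/= Re_mul Im_mul/= !mulr0 subr0 add0r. Qed.

Lemma Im_cexp_scaled (l : R[i]) s : complex.Im (cexp (l * s%:C)) =
  expR (complex.Re l * s) * sin (complex.Im l * s).
Proof. by rewrite /cexp/= Re_mul Im_mul/= !mulr0 subr0 add0r. Qed.

Lemma Re_bigsum (I : Type) (r : seq I) (P : pred I) (F : I -> R[i]) :
  complex.Re (\sum_(i <- r | P i) F i) = \sum_(i <- r | P i) complex.Re (F i).
Proof. exact: (big_morph _ (@Re_add R)). Qed.

Lemma Im_bigsum (I : Type) (r : seq I) (P : pred I) (F : I -> R[i]) :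
  complex.Im (\sum_(i <- r | P i) F i) = \sum_(i <- r | P i) complex.Im (F i).
Proof. exact: (big_morph _ (@Im_add R)). Qed.

Definition exp_sum N (P : {pred 'I_N}) (beta : nat -> R[i]) (s : R) : R[i] :=
  \sum_(n in P) beta n * cexp (lambda n * s%:C).

Lemma Re_exp_sum N (P : {pred 'I_N}) beta s : complex.Re (exp_sum P beta s) =
  \sum_(n in P) expR (complex.Re (lambda n) * s) *
    (complex.Re (beta n) * cos (complex.Im (lambda n) * s)
     - complex.Im (beta n) * sin (complex.Im (lambda n) * s)).
Proof.
rewrite Re_bigsum; apply: eq_bigr => n _.
by rewrite Re_mul Re_cexp_scaled Im_cexp_scaled; ring.
Qed.

Lemma Im_exp_sum N (P : {pred 'I_N}) beta s : complex.Im (exp_sum P beta s) =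
  \sum_(n in P) expR (complex.Re (lambda n) * s) *
    (complex.Re (beta n) * sin (complex.Im (lambda n) * s)
     + complex.Im (beta n) * cos (complex.Im (lambda n) * s)).
Proof.
rewrite Im_bigsum; apply: eq_bigr => n _.
by rewrite Im_mul Re_cexp_scaled Im_cexp_scaled; ring.
Qed.

Lemma continuous_Re_exp_sum N (P : {pred 'I_N}) beta :
  continuous (fun s => complex.Re (exp_sum P beta s)).
Proof.
under eq_fun do rewrite Re_exp_sum.
apply: continuous_bigsum => n _ s; apply: cvgM; first exact: continuous_expR_scaled.
apply: cvgB; apply: cvgM; try exact: cvg_cst.
  exact: continuous_cos_scaled.
exact: continuous_sin_scaled.
Qed.

Lemma continuous_Im_exp_sum N (P : {pred 'I_N}) beta :
  continuous (fun s => complex.Im (exp_sum P beta s)).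
Proof.
under eq_fun do rewrite Im_exp_sum.
apply: continuous_bigsum => n _ s; apply: cvgM; first exact: continuous_expR_scaled.
apply: cvgD; apply: cvgM; try exact: cvg_cst.
  exact: continuous_sin_scaled.
exact: continuous_cos_scaled.
Qed.

Lemma functional_exp_sum N (P : {pred 'I_N}) (w : nat -> R[i]) (a : R[i]) (s : R) :
  0 <= s ->
  rdot dot (T s (a *: b)) (\sum_(n in P) w n *: psi n) =
  complex.Re (a * exp_sum P (fun n => conjc (w n) * c n) s).
Proof.
move=> s0; rewrite rdot_sumr mulr_sumr Re_bigsum; apply: eq_bigr => n _.
rewrite /rdot dotZr (coef_semigroup dot_norm T_C0 A_gen T_bound phi_dense phi_eigen)//.
by rewrite dotZl; congr complex.Re; ring.
Qed.

Section Input.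
Context (u : R -> R[i]) (V t : R) (y : X).
Hypotheses (V_ge0 : 0 <= V) (t_ge0 : 0 <= t).
Hypothesis mRe :
  measurable_fun (`[0, +oo[%classic : set R) (fun s => complex.Re (u s)).
Hypothesis mIm :
  measurable_fun (`[0, +oo[%classic : set R) (fun s => complex.Im (u s)).
Hypothesis uV : {ae mu, forall s, (`[0, +oo[%classic : set R) s -> rnorm (u s) <= V}.
Hypothesis y_int : is_bochner_integral mu `[0, t] (fun s => T (t - s) (u s *: b)) y.

Lemma state_functional_le N (P : {pred 'I_N}) (w : nat -> R[i]) (H h : R -> R) :
  (forall s : R, is_derive s (1 : R) H (h s)) -> continuous h ->
  (forall s, V * rnorm (exp_sum P (fun n => conjc (w n) * c n) s) <= h s) ->
  rdot dot y (\sum_(n in P) w n *: psi n) <= H t - H 0.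
Proof.
move=> dH ch Ph.
apply: (functional_le dot_norm t_ge0 mRe mIm uV y_int _ _ _ dH ch Ph).
- by move=> s s0 st; apply: functional_exp_sum; rewrite subr_ge0.
- exact: continuous_Re_exp_sum.
- exact: continuous_Im_exp_sum.
Qed.

Lemma rdot_coef_sum N (P : {pred 'I_N}) :
  rdot dot y (\sum_(n in P) dot y (psi n) *: psi n) =
  \sum_(n in P) rnorm (dot y (psi n)) ^+ 2.
Proof.
rewrite rdot_sumr; apply: eq_bigr => n _; rewrite /rdot dotZr rnorm_sqrE.
by case: (dot y (psi n)) => p q /=; rewrite !expr2; ring.
Qed.

(** The kernel of a single mode decays exponentially at the rate
    - Re (lambda n). *)
Lemma coef_state_le n : complex.Re (lambda n) < 0 ->
  rnorm (dot y (psi n)) ^+ 2 <= V ^+ 2 * (rnorm (c n) ^+ 2 / complex.Re (lambda n) ^+ 2).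
Proof.
move=> l0; set a := complex.Re (lambda n) in l0 *.
pose P := [pred k : 'I_n.+1 | k == ord_max].
pose B := rnorm (dot y (psi n)) * rnorm (c n).
have B0 : 0 <= B by rewrite mulr_ge0 ?rnorm_ge0.
pose H (s : R) := V * (B / a) * expR (a * s).
pose h (s : R) := V * B * expR (a * s).
have dH (s : R) : is_derive s (1 : R) H (h s).
  apply: is_derive_eq; rewrite /GRing.scale/= /h.
  by field; rewrite lt_eqF.
have ch : continuous h.
  by move=> s; apply: cvgM; [exact: cvg_cst|exact: continuous_expR_scaled].
have := state_functional_le (P := P) (w := fun k => dot y (psi k)) dH ch.
rewrite rdot_coef_sum !(big_pred1 ord_max)//= => hle.
have {}hle : rnorm (dot y (psi n)) ^+ 2 <= H t - H 0.
  apply: hle => s; rewrite /exp_sum (big_pred1 ord_max)//= !rnormM rnormJ rnorm_cexp.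
  by rewrite Re_mul/= mulr0 subr0 /h /B -/a !mulrA.
have {}hle : rnorm (dot y (psi n)) ^+ 2 <= V * (B / - a).
  rewrite (le_trans hle)// /H mulr0 expR0 invrN mulrN mulrN -subr_ge0.
  have -> : - (V * (B / a)) - (V * (B / a) * expR (a * t) - V * (B / a) * 1) =
    V * (B / - a) * expR (a * t) by rewrite invrN; ring.
  apply: mulr_ge0; last exact: expR_ge0.
  by apply: mulr_ge0 => //; apply: divr_ge0 => //; rewrite oppr_ge0 ltW.
have [y0|y0] := eqVneq (rnorm (dot y (psi n))) 0.
  by rewrite y0 expr0n; apply: mulr_ge0; rewrite ?divr_ge0 ?sqr_ge0.
have y1 : 0 < rnorm (dot y (psi n)) by rewrite lt_neqAle eq_sym y0 rnorm_ge0.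
have h1 : rnorm (dot y (psi n)) <= V * (rnorm (c n) / - a).
  rewrite -(ler_pM2l y1) -expr2 (le_trans hle)// /B le_eqVlt; apply/orP; left.
  by apply/eqP; ring.
rewrite -[X in _ / X]sqrrN -expr_div_n -exprMn ler_pXn2r// nnegrE ?rnorm_ge0//.
by rewrite mulr_ge0// divr_ge0 ?rnorm_ge0// oppr_ge0 ltW.
Qed.

(** For th slightly above 2 V Q, the last term is absorbed by half of S. *)
Lemma optimize_parameter (S Q r : R) : 0 <= S -> 0 <= Q -> 0 < r ->
  (forall th, 0 < th -> S <= V * (th / (2 * r) + Q * S / th)) ->
  S <= 2 * V ^+ 2 * Q / r.
Proof.
move=> S0 Q0 r0 hS; apply/ler_addgt0Pr => e e0.
have V1 : 0 < V + 1 by rewrite ltr_pwDr.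
pose e' := e * r / (V + 1); have e'0 : 0 < e' by rewrite divr_gt0// mulr_gt0.
pose th := 2 * V * Q + e'.
have th0 : 0 < th by rewrite ltr_pwDr// !mulr_ge0.
have half : V * (Q * S / th) <= S / 2.
  have -> : V * (Q * S / th) = V * Q / th * S by ring.
  rewrite mulrC ler_wpM2l// ler_pdivrMr// /th; lra.
have Ve : V * (e' / r) <= e.
  rewrite /e'; have -> : V * (e * r / (V + 1) / r) = V / (V + 1) * e.
    by field; rewrite !gt_eqF.
  by rewrite ler_piMl ?ltW// ltr_pdivrMr// mul1r ltrDl.
have := hS th th0; rewrite mulrDr.
have -> : V * (th / (2 * r)) = (2 * V ^+ 2 * Q / r + V * (e' / r)) / 2.
  by rewrite /th; field; rewrite gt_eqF.
lra.
Qed.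

(** Testing the state against its own projection to the strip; the modulus of
    the kernel is majorized by the weighted arithmetic-geometric mean
    inequality, to which the sieve applies. *)
Lemma strip_state_le N (P : {pred 'I_N}) (r d G : R) : 0 < r -> 0 < d -> 0 <= G ->
  (forall n, n \in P -> r <= - complex.Re (lambda n) < 2 * r) ->
  (forall n k, n \in P -> k \in P -> n != k ->
     d <= `|complex.Im (lambda n) - complex.Im (lambda k)|) ->
  (forall n, n \in P -> rnorm (c n) ^+ 2 <= G) ->
  \sum_(n in P) rnorm (dot y (psi n)) ^+ 2 <=
    2 * V ^+ 2 * ((2 / r + 12 * r / d ^+ 2) * G) / r.
Proof.
move=> r0 d0 G0 Pr Pd PG.
set S := \sum_(n in P) _.
pose beta n := conjc (dot y (psi n)) * c n.
pose x (n : 'I_N) := - complex.Re (lambda n).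
pose v (n : 'I_N) := complex.Im (lambda n).
pose p (n : 'I_N) := complex.Re (beta n).
pose q (n : 'I_N) := complex.Im (beta n).
pose E := sieve_energy P x v p q r.
pose F := sieve_primitive P x v p q r.
have C0 : 0 <= 2 / r + 12 * r / d ^+ 2.
  by rewrite addr_ge0// divr_ge0 ?sqr_ge0// ?mulr_ge0// ltW.
apply: optimize_parameter => //; first by apply: sumr_ge0 => n _; exact: sqr_ge0.
  exact: mulr_ge0.
move=> th th0.
pose H (s : R) := V * (- (th / (2 * r)) * expR (- r * s) + F s / th).
pose h (s : R) := V * (th / 2 * expR (- r * s) + E s / th).
have dH (s : R) : is_derive s (1 : R) H (h s).
  have dF : is_derive s (1 : R) F (E s) by exact: is_derive_sieve.
  apply: is_derive_eq; rewrite /GRing.scale/= /h.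
  by field; rewrite !gt_eqF.
have ch : continuous h.
  move=> s; apply: cvgM; first exact: cvg_cst.
  apply: cvgD; apply: cvgM; try exact: cvg_cst.
    exact: continuous_expR_scaled.
  exact: continuous_sieve_energy.
have Ph (s : R) : V * rnorm (exp_sum P beta s) <= h s.
  rewrite /h ler_wpM2l//.
  have := @sqr_modulus_le R _ P x v p q r s.
  have -> : \sum_(i in P) expR (- x i * s) * (p i * cos (v i * s) - q i * sin (v i * s))
     = complex.Re (exp_sum P beta s).
    by rewrite Re_exp_sum; apply: eq_bigr => n _; rewrite /x opprK.
  have -> : \sum_(i in P) expR (- x i * s) * (p i * sin (v i * s) + q i * cos (v i * s))
     = complex.Im (exp_sum P beta s).
    by rewrite Im_exp_sum; apply: eq_bigr => n _; rewrite /x opprK.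
  rewrite -rnorm_sqrE -/E -mulNr.
  set e := expR _; have e0 : 0 < e by rewrite expR_gt0.
  move: (rnorm _) => w w2.
  have the : 0 < 2 * (th * e) by rewrite !mulr_gt0.
  have -> : th / 2 * e + E s / th = ((th * e) ^+ 2 + 2 * (e * E s)) / (2 * (th * e)).
    by field; rewrite !gt_eqF.
  rewrite ler_pdivlMr//; have := sqr_ge0 (w - th * e).
  rewrite sqrrB -mulr_natl; set a := th * e; lra.
have := state_functional_le (P := P) (w := fun k => dot y (psi k)) dH ch Ph.
rewrite rdot_coef_sum => /le_trans; apply.
rewrite /H -mulrBr ler_wpM2l// mulr0 expR0 mulr1.
have -> : - (th / (2 * r)) * expR (- r * t) + F t / th - (- (th / (2 * r)) + F 0 / th) =
  th / (2 * r) * (1 - expR (- r * t)) + (F t - F 0) / th by ring.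
apply: lerD.
  apply: ler_piMr; first by apply: divr_ge0; [exact: ltW|rewrite mulr_ge0// ltW].
  by rewrite gerBl expR_ge0.
rewrite ler_pM2r ?invr_gt0//.
have := @sieve R _ P x v p q r d r0 d0 Pr Pd t t_ge0.
move=> /le_trans; apply; rewrite -[leRHS]mulrA ler_wpM2l//.
rewrite mulr_sumr; apply: ler_sum => n nP.
by rewrite /p /q -rnorm_sqrE /beta rnormM rnormJ exprMn mulrC ler_wpM2r ?sqr_ge0// PG.
Qed.

End Input.
End StateEstimates.


(** * Summation over the dyadic strips *)

Section DyadicIndex.
Context (R : realType).

Lemma dyadic_index (x : R) : 0 < x -> exists k : int, 2 ^ k <= x /\ x < 2 ^ (k + 1).
Proof.
move=> x0; pose k := Num.floor (ln x / ln 2).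
have l2 : 0 < ln (2 : R) by rewrite ln_gt0// ltr1n.
have /andP[h1 h2] := floor_itv (ln x / ln 2).
have E (j : int) : (2 : R) ^ j = expR (j%:~R * ln 2).
  by rewrite -powR_intmul// /powR gt_eqF.
rewrite ler_pdivlMr// in h1; rewrite ltr_pdivrMr// in h2.
exists k; rewrite !E; split.
  by rewrite -[leRHS]lnK ?posrE// ler_expR.
by rewrite -[ltLHS]lnK ?posrE// ltr_expR.
Qed.

Lemma dyadic_gt0 (k : int) : 0 < (2 : R) ^ k.
Proof. by rewrite exprz_gt0. Qed.

Lemma dyadic_succ (k : int) : (2 : R) ^ (k + 1) = 2 * 2 ^ k.
Proof. by rewrite exprzDr ?unitfE// expr1z mulrC. Qed.

Lemma dyadic_opp_pred (k : int) : (2 : R) ^ (- k - 1) = 2 ^ (- k) / 2.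
Proof. by rewrite exprzDr ?unitfE. Qed.

End DyadicIndex.

Lemma sum_by_key (R : zmodType) (I : finType) (K : eqType) (P : {pred I}) (key : I -> K)
    (ks : seq K) (a : I -> R) : uniq ks -> (forall i, i \in P -> key i \in ks) ->
  \sum_(i in P) a i = \sum_(k <- ks) \sum_(i in [pred i | (i \in P) && (key i == k)]) a i.
Proof.
move=> uks ksP.
have -> : \sum_(k <- ks) \sum_(i in [pred i | (i \in P) && (key i == k)]) a i =
    \sum_(k <- ks) \sum_(i in P) if key i == k then a i else 0.
  by apply: eq_bigr => k _; rewrite -big_mkcondr.
rewrite exchange_big/=; apply: eq_bigr => i iP.
rewrite (bigD1_seq (key i)) ?ksP//= eqxx big1 ?addr0// => k.
by rewrite eq_sym => /negbTE ->.
Qed.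

Section TotalEstimate.
Context (R : realType) (X : completeNormedModType R[i]).
Context (dot : {dot X for Num.conj}).
Hypothesis dot_norm : forall x : X, dot x x = `|x| ^+ 2.
Context (A : operator X) (T : R -> X -> X).
Hypotheses (T_C0 : C0_semigroup T) (A_gen : generator A T).
Context (K : R).
Hypothesis T_bound : forall t x, 0 <= t -> rnorm (T t x) <= K * rnorm x.
Context (phi psi : nat -> X) (lambda : nat -> R[i]) (m M : R).
Hypothesis phi_dense :
  dense [set x | exists N (a : nat -> R[i]), x = \sum_(n < N) a n *: phi n].
Hypotheses (m_gt0 : 0 < m) (M_gt0 : 0 < M).
Hypothesis phi_bounds : forall N (a : nat -> R[i]),
  m * \sum_(n < N) rnorm (a n) ^+ 2
    <= rnorm (\sum_(n < N) a n *: phi n) ^+ 2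
    <= M * \sum_(n < N) rnorm (a n) ^+ 2.
Hypothesis phi_eigen : forall n, op_eigenvector A (lambda n) (phi n).
Hypothesis biorthogonal : forall n k, dot (phi n) (psi k) = (n == k)%:R.
Context (b : X).
Notation mu := (@lebesgue_measure R).
Notation c n := (dot b (psi n)).
Context (p d : R).
Hypotheses (p_gt0 : 0 < p) (d_gt0 : 0 < d).
Hypothesis gap : forall n k, n != k -> `|complex.Re (lambda n)| < p ->
  `|complex.Re (lambda k)| < p -> d <= `|complex.Im (lambda n) - complex.Im (lambda k)|.
Hypothesis Re_lt0 : forall n, complex.Re (lambda n) < 0.
Context (F : int -> R) (F_tot : R).
Hypothesis F_ge0 : forall k, 0 <= F k.
Hypothesis F_bound : forall n k, strip k (- lambda n) ->
  rnorm (c n) ^+ 2 / `|complex.Re (lambda n)| ^+ 2 <= F k.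
Hypothesis F_sum : forall ks, uniq ks -> \sum_(k <- ks) F k <= F_tot.
Context (u : R -> R[i]) (V t : R) (y : X).
Hypotheses (V_ge0 : 0 <= V) (t_ge0 : 0 <= t).
Hypothesis mRe :
  measurable_fun (`[0, +oo[%classic : set R) (fun s => complex.Re (u s)).
Hypothesis mIm :
  measurable_fun (`[0, +oo[%classic : set R) (fun s => complex.Im (u s)).
Hypothesis uV : {ae mu, forall s, (`[0, +oo[%classic : set R) s -> rnorm (u s) <= V}.
Hypothesis y_int : is_bochner_integral mu `[0, t] (fun s => T (t - s) (u s *: b)) y.

Lemma Re_oppc (z : R[i]) : complex.Re (- z) = - complex.Re z.
Proof. by case: z. Qed.

(** Modes with decay rate at least p are controlled one by one, the others strip
    by strip. *)
Lemma sum_state_le N : \sum_(n < N) rnorm (dot y (psi n)) ^+ 2 <=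
  V ^+ 2 * (rnorm b ^+ 2 / m / p ^+ 2 + 8 * (2 + 12 * p ^+ 2 / d ^+ 2) * F_tot).
Proof.
pose P := [pred n : 'I_N | - complex.Re (lambda n) < p].
have ex n : exists k : int, strip k (- lambda n).
  have [|k [k1 k2]] := @dyadic_index R (- complex.Re (lambda n)).
    by rewrite oppr_gt0.
  by exists k; rewrite /strip/= Re_oppc.
have [key keyP] := choice ex.
rewrite (bigID P)/= addrC mulrDr lerD//.
  apply: (@le_trans _ _ (\sum_(n < N) V ^+ 2 / p ^+ 2 * rnorm (c n) ^+ 2)).
    rewrite big_mkcond/=; apply: ler_sum => n _; case: ifP => [|_]; last first.
      by rewrite mulr_ge0 ?divr_ge0 ?sqr_ge0.
    rewrite -leNgt => pn.
    rewrite (le_trans (coef_state_le dot_norm T_C0 A_gen T_bound phi_dense phi_eigen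
      biorthogonal V_ge0 t_ge0 mRe mIm uV y_int (Re_lt0 n)))//.
    rewrite -mulrA ler_wpM2l ?sqr_ge0// mulrC ler_wpM2r ?sqr_ge0//.
    have l2 : 0 < complex.Re (lambda n) ^+ 2 by rewrite -sqrrN exprn_gt0// oppr_gt0.
    have p2 : 0 < p ^+ 2 by rewrite exprn_gt0.
    rewrite lef_pV2// -[leRHS]sqrrN ler_pXn2r// nnegrE ltW// oppr_gt0.
    exact: Re_lt0.
  rewrite -mulr_sumr.
  have := bessel dot_norm phi_dense m_gt0 phi_bounds biorthogonal b N.
  rewrite mulrC -ler_pdivlMr// => h.
  have -> : V ^+ 2 * (rnorm b ^+ 2 / m / p ^+ 2) = V ^+ 2 / p ^+ 2 * (rnorm b ^+ 2 / m).
    by ring.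
  by rewrite ler_wpM2l ?divr_ge0 ?sqr_ge0.
pose ks := undup [seq key (nat_of_ord n) | n : 'I_N].
have uks : uniq ks by exact: undup_uniq.
have -> : \sum_(n < N | - complex.Re (lambda n) < p) rnorm (dot y (psi n)) ^+ 2 =
  \sum_(n in P) rnorm (dot y (psi n)) ^+ 2 by [].
rewrite (@sum_by_key _ _ _ P (fun n : 'I_N => key n) ks)//; last first.
  by move=> n _; rewrite mem_undup; apply/mapP; exists n => //; rewrite mem_enum.
have C0 : 0 <= 2 + 12 * p ^+ 2 / d ^+ 2.
  by rewrite addr_ge0// divr_ge0 ?sqr_ge0// mulr_ge0 ?sqr_ge0.
apply: (@le_trans _ _ (\sum_(k <- ks) V ^+ 2 * (8 * (2 + 12 * p ^+ 2 / d ^+ 2)) * F k)).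
  apply: ler_sum => k _.
  set Q := [pred n : 'I_N | _].
  have [n nQ|Q0] := pickP Q; last first.
    by rewrite big_pred0// !mulr_ge0// sqr_ge0.
  have strip_k n' : n' \in Q ->
      2 ^ k <= - complex.Re (lambda n') /\ - complex.Re (lambda n') < 2 * 2 ^ k.
    move=> /andP[_ /eqP kn]; have := keyP n'.
    by rewrite kn /strip/= Re_oppc dyadic_succ.
  have rp : (2 : R) ^ k <= p.
    have [h _] := strip_k n nQ; rewrite (le_trans h)//.
    by move: nQ => /andP[/ltW].
  have r0 := dyadic_gt0 R k; set r := (2 : R) ^ k in r0 rp strip_k.
  have small n' : n' \in Q -> `|complex.Re (lambda n')| < p.
    by move=> /andP[+ _]; rewrite ltr0_norm.
  have G0 : 0 <= 4 * r ^+ 2 * F k.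
    by apply: mulr_ge0 => //; apply: mulr_ge0 => //; exact: sqr_ge0.
  have h := @strip_state_le R X dot dot_norm A T T_C0 A_gen K T_bound phi psi lambda
    phi_dense phi_eigen biorthogonal b u V t y V_ge0 t_ge0 mRe mIm uV y_int N Q r d
    (4 * r ^+ 2 * F k) r0 d_gt0 G0.
  rewrite (le_trans (h _ _ _))//.
  - by move=> n' /strip_k[h1 h2]; apply/andP.
  - by move=> n1 n2 /small s1 /small s2 n12; exact: gap.
  - move=> n' n'Q; have [h1 h2] := strip_k _ n'Q.
    have := F_bound (keyP n'); move: (n'Q) => /andP[_ /eqP ->].
    rewrite ler_pdivrMr; last by rewrite exprn_gt0// normr_gt0 lt_eqF.
    move=> /le_trans; apply; rewrite mulrC ler_wpM2r//.
    rewrite real_normK ?num_real// -sqrrN.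
    have -> : 4 * r ^+ 2 = (2 * r) ^+ 2 by ring.
    by rewrite ler_pXn2r// ?nnegrE ?oppr_ge0 ?mulr_ge0// ltW.
  have -> : 2 * V ^+ 2 * ((2 / r + 12 * r / d ^+ 2) * (4 * r ^+ 2 * F k)) / r =
    V ^+ 2 * (8 * (2 + 12 * r ^+ 2 / d ^+ 2)) * F k by field; rewrite !gt_eqF.
  rewrite ler_wpM2r// ler_wpM2l ?sqr_ge0// ler_pM2l// lerD2l ler_wpM2r//.
    by rewrite invr_ge0 sqr_ge0.
  by rewrite ler_pM2l// ler_pXn2r// nnegrE ltW.
rewrite -mulr_sumr -mulrA ler_wpM2l ?sqr_ge0// ler_wpM2l ?F_sum//.
by rewrite mulr_ge0.
Qed.

Lemma state_le : rnorm y <= V * (1 + M *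
  (rnorm b ^+ 2 / m / p ^+ 2 + 8 * (2 + 12 * p ^+ 2 / d ^+ 2) * F_tot)).
Proof.
set C := _ + _ * F_tot.
have Ft0 : 0 <= F_tot by have := @F_sum [::] isT; rewrite big_nil.
have C0 : 0 <= C.
  rewrite addr_ge0//.
    by apply: divr_ge0; [apply: divr_ge0|]; rewrite ?sqr_ge0// ltW.
  rewrite mulr_ge0// mulr_ge0// addr_ge0//.
  by rewrite divr_ge0 ?sqr_ge0// mulr_ge0 ?sqr_ge0.
have := upper_riesz dot_norm phi_dense m_gt0 M_gt0 phi_bounds biorthogonal sum_state_le.
rewrite -/C => h.
have MC : 0 <= M * C by rewrite mulr_ge0// ltW.
rewrite -(ler_pXn2r (n := 2))// ?nnegrE ?rnorm_ge0//; last by rewrite mulr_ge0// addr_ge0.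
rewrite (le_trans h)// exprMn mulrCA ler_wpM2l ?sqr_ge0//.
by rewrite expr2; nra.
Qed.

End TotalEstimate.

(** * Inputs that excite one mode in each strip *)

Section Pulses.
Context (R : realType).

Definition pulse_window (k : int) : set R := `[2 ^ (- k) / 2, 2 ^ (- k)[%classic.

Lemma pulse_window_disjoint (k l : int) (s : R) :
  pulse_window k s -> pulse_window l s -> k = l.
Proof.
rewrite /pulse_window/= !in_itv/= => /andP[k1 k2] /andP[l1 l2].
suff h i j : (i < j)%R -> 2 ^ (- i) / 2 <= s -> s < 2 ^ (- j) -> False.
  by have [kl|lk|] := ltgtP k l => //; exfalso; [exact: (h k l)|exact: (h l k)].
move=> ij i1 j2.
have := le_lt_trans i1 j2; apply/negP; rewrite -leNgt -dyadic_opp_pred.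
by rewrite ler_weXz2l ?ler1n//; lia.
Qed.

(** The phase cancels the oscillation of a mode of frequency v. *)
Definition pulse (k : int) (v s : R) : R[i] :=
  (\1_(pulse_window k) s * cos (v * s)) +i* (- (\1_(pulse_window k) s * sin (v * s))).

Lemma rnorm_pulse k v s : rnorm (pulse k v s) = \1_(pulse_window k) s.
Proof.
have i0 : 0 <= \1_(pulse_window k) s :> R by rewrite indicE; case: (_ \in _).
apply/eqP; rewrite -(eqrXn2 (n := 2))// ?rnorm_ge0//; apply/eqP.
by rewrite rnorm_sqrE/= sqrrN !exprMn -mulrDr cos2Dsin2 mulr1.
Qed.

Lemma pulse_eq0 k v s : ~ pulse_window k s -> pulse k v s = 0.
Proof.
by move=> h; apply/eqP; rewrite -rnorm_eq0 rnorm_pulse indicE memNset.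
Qed.

Lemma measurable_pulse_window k : measurable (pulse_window k).
Proof. exact: measurable_itv. Qed.

Lemma measurable_reflect (t : R) (g : R -> R) : measurable_fun (setT : set R) g ->
  measurable_fun (setT : set R) (fun s : R => g (t - s)).
Proof.
move=> mg; apply: (measurableT_comp mg).
apply: continuous_measurable_fun => s.
by apply: cvgB; [exact: cvg_cst|exact: cvg_id].
Qed.

Lemma measurable_Re_pulse k v t :
  measurable_fun (setT : set R) (fun s : R => complex.Re (pulse k v (t - s))).
Proof.
apply: (@measurable_reflect t (fun s => complex.Re (pulse k v s))).
apply: measurable_funM; first by apply: measurable_indic; exact: measurable_pulse_window.
by apply: continuous_measurable_fun; exact: continuous_cos_scaled.
Qed.

Lemma measurable_Im_pulse k v t :
  measurable_fun (setT : set R) (fun s : R => complex.Im (pulse k v (t - s))).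
Proof.
apply: (@measurable_reflect t (fun s => complex.Im (pulse k v s))).
apply: measurableT_comp => //.
apply: measurable_funM; first by apply: measurable_indic; exact: measurable_pulse_window.
by apply: continuous_measurable_fun; exact: continuous_sin_scaled.
Qed.

End Pulses.

Section LowerBound.
Context (R : realType) (X : completeNormedModType R[i]).
Context (dot : {dot X for Num.conj}).
Hypothesis dot_norm : forall x : X, dot x x = `|x| ^+ 2.
Context (A : operator X) (T : R -> X -> X).
Hypotheses (T_C0 : C0_semigroup T) (A_gen : generator A T).
Context (K : R).
Hypothesis T_bound : forall t x, 0 <= t -> rnorm (T t x) <= K * rnorm x.
Context (phi psi : nat -> X) (lambda : nat -> R[i]) (m M : R).
Hypothesis phi_dense :
  dense [set x | exists N (a : nat -> R[i]), x = \sum_(n < N) a n *: phi n].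
Hypotheses (m_gt0 : 0 < m) (M_gt0 : 0 < M).
Hypothesis phi_bounds : forall N (a : nat -> R[i]),
  m * \sum_(n < N) rnorm (a n) ^+ 2
    <= rnorm (\sum_(n < N) a n *: phi n) ^+ 2
    <= M * \sum_(n < N) rnorm (a n) ^+ 2.
Hypothesis phi_eigen : forall n, op_eigenvector A (lambda n) (phi n).
Hypothesis biorthogonal : forall n k, dot (phi n) (psi k) = (n == k)%:R.
Context (b : X).
Notation mu := (@lebesgue_measure R).
Notation c n := (dot b (psi n)).

Definition admissible (V : R) (u : R -> R[i]) :=
  [/\ measurable_fun (setT : set R) (fun s => complex.Re (u s)),
      measurable_fun (setT : set R) (fun s => complex.Im (u s))
    & forall s, rnorm (u s) <= V].

Definition state t (u : R -> R[i]) : X :=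
  bochner_integral mu `[0, t] (fun s => T (t - s) (u s *: b)).

Lemma state_is_bochner V t u : admissible V u ->
  is_bochner_integral mu `[0, t] (fun s => T (t - s) (u s *: b)) (state t u).
Proof.
move=> [mRe mIm uV].
have [y hy] := bochner_state dot_norm T_C0 T_bound b t mRe mIm uV.
by apply: (xgetPex 0); exists y.
Qed.

Lemma state_coef V t u n w : admissible V u ->
  mu.-integrable `[0, t] (EFin \o (fun s =>
    complex.Re (u s * (conjc w * c n * cexp (lambda n * (t - s)%:C))))) /\
  rdot dot (state t u) (w *: psi n) = \int[mu]_(s in `[0, t])
    complex.Re (u s * (conjc w * c n * cexp (lambda n * (t - s)%:C))).
Proof.
move=> uV; have [mRe mIm _] := uV.
pose P := [pred k : 'I_n.+1 | k == ord_max].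
apply: (functional_integral (T := T) (b := b)
  (P := fun s => conjc w * c n * cexp (lambda n * s%:C)) dot_norm).
- exact: measurable_funTS.
- exact: measurable_funTS.
- exact: state_is_bochner uV.
- move=> s s0 st.
  have := functional_exp_sum dot_norm T_C0 A_gen T_bound phi_dense phi_eigen biorthogonal
    b P (fun=> w) (u s) (s := t - s).
  by rewrite subr_ge0 => /(_ st); rewrite /exp_sum !(big_pred1 ord_max).
- have := @continuous_Re_exp_sum R lambda n.+1 P (fun k => conjc w * c k).
  by rewrite /exp_sum; under eq_fun do rewrite (big_pred1 ord_max)//.
have := @continuous_Im_exp_sum R lambda n.+1 P (fun k => conjc w * c k).
by rewrite /exp_sum; under eq_fun do rewrite (big_pred1 ord_max)//.
Qed.

(** The values w = 1 and w = i give the real and the imaginary part of each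
    coefficient. *)
Lemma eq_by_rdot (x y : X) :
  (forall w n, rdot dot x (w *: psi n) = rdot dot y (w *: psi n)) -> x = y.
Proof.
move=> h; apply: (coef_inj dot_norm phi_dense m_gt0 M_gt0 phi_bounds biorthogonal) => n.
have h1 := h 1 n; have h2 := h 'i n.
move: h1 h2; rewrite /rdot !dotZr.
case: (dot x (psi n)) => x1 x2; case: (dot y (psi n)) => y1 y2.
rewrite !Re_mul/= oppr0 !mul1r !mul0r !subr0 !sub0r !mulN1r !opprK.
by move=> -> ->.
Qed.

Lemma admissibleD V1 V2 (e : R) u1 u2 : admissible V1 u1 -> admissible V2 u2 ->
  admissible (V1 + `|e| * V2) (fun s => u1 s + e%:C * u2 s).
Proof.
move=> [a1 a2 a3] [b1 b2 b3]; split.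
- rewrite (_ : (fun s => _) = (fun s => complex.Re (u1 s) + e * complex.Re (u2 s))).
    by apply: measurable_funD => //; apply: measurable_funM => //; exact: measurable_cst.
  by apply/funext => s; rewrite Re_add Re_mul/= mul0r subr0.
- rewrite (_ : (fun s => _) = (fun s => complex.Im (u1 s) + e * complex.Im (u2 s))).
    by apply: measurable_funD => //; apply: measurable_funM => //; exact: measurable_cst.
  by apply/funext => s; rewrite Im_add Im_mul/= mul0r addr0.
move=> s; rewrite (le_trans (ler_rnormD _ _))// rnormM rnorm_real lerD//.
by rewrite ler_wpM2l.
Qed.

Lemma state_linear V1 V2 (e t : R) u1 u2 : admissible V1 u1 -> admissible V2 u2 ->
  state t (fun s => u1 s + e%:C * u2 s) = state t u1 + e%:C *: state t u2.
Proof.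
move=> h1 h2; have h3 := admissibleD e h1 h2.
apply: eq_by_rdot => w n.
have mD : measurable (`[0, t]%classic : set R) by exact: measurable_itv.
have [_ ->] := state_coef t n w h3.
have [i1 e1] := state_coef t n w h1; have [i2 e2] := state_coef t n w h2.
rewrite rdotDl rdotZl e1 e2 -RintegralZl// -RintegralD//; last first.
  by apply: (integrableZl _ e i2); exact: measurable_itv.
apply: eq_Rintegral => s _.
rewrite mulrDl Re_add -(mulrA e%:C) (Re_mul e%:C)/= mul0r subr0 //.
Qed.

Lemma admissible_pulse k v t : admissible 1 (fun s => pulse k v (t - s)).
Proof.
split; [exact: measurable_Re_pulse|exact: measurable_Im_pulse|].
by move=> s; rewrite rnorm_pulse indicE; case: (_ \in _).
Qed.

(** The window ends after time 2^(-k), by which the mode has decayed at most by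
    the factor e^(-2), and it has length 2^(-k) / 2. *)
Lemma pulse_state_ge k n t : strip k (- lambda n) -> 2 ^ (- k) <= t ->
  m * expR (- 4) / 16 * (rnorm (c n) ^+ 2 / `|complex.Re (lambda n)| ^+ 2)
    <= rnorm (state t (fun s => pulse k (complex.Im (lambda n)) (t - s))) ^+ 2.
Proof.
rewrite /strip/= Re_oppc dyadic_succ => -[k1 k2] kt.
set u := fun s => _; set a := complex.Re (lambda n) in k1 k2 *.
have adm : admissible 1 u by exact: admissible_pulse.
set D := 2 ^ (- k) in kt; have D0 : 0 < D by exact: dyadic_gt0.
have Dk : 2 ^ k = D^-1 by rewrite /D -invr_expz invrK.
have a0 : a < 0 by rewrite -oppr_gt0 (lt_le_trans _ k1)// dyadic_gt0.
have [int e] := state_coef t n (c n) adm.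
pose J : set R := `]t - D, t - D / 2]%classic.
have JE s : pulse_window k (t - s) <-> J s.
  by rewrite /pulse_window /J/= !in_itv/= -/D; split => /andP[h1 h2]; apply/andP; split; lra.
have intE s : complex.Re (u s * (conjc (c n) * c n * cexp (lambda n * (t - s)%:C))) =
    \1_J s * (rnorm (c n) ^+ 2 * expR (a * (t - s))).
  have -> : \1_J s = \1_(pulse_window k) (t - s) :> R.
    rewrite !indicE; congr (_%:R); congr nat_of_bool.
    by apply/idP/idP => /set_mem h; apply: mem_set; apply/JE.
  have cc : conjc (c n) * c n = (rnorm (c n) ^+ 2)%:C.
    by rewrite mulrC -sqr_normc rnormE -rmorphXn.
  rewrite cc /u /pulse; set i := \1_(_) _; set E := cexp _.
  have Ere : complex.Re E = _ := Re_cexp_scaled (lambda n) (t - s).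
  have Eim : complex.Im E = _ := Im_cexp_scaled (lambda n) (t - s).
  rewrite !Re_mul !Im_mul; move: E Ere Eim => E /= -> ->.
  rewrite !mul0r subr0 addr0 -/a.
  set v := complex.Im (lambda n) * (t - s); have := cos2Dsin2 v.
  have -> : i * cos v * (rnorm (c n) ^+ 2 * (expR (a * (t - s)) * cos v))
    - - (i * sin v) * (rnorm (c n) ^+ 2 * (expR (a * (t - s)) * sin v)) =
    i * (rnorm (c n) ^+ 2 * expR (a * (t - s))) * (cos v ^+ 2 + sin v ^+ 2) by ring.
  by move=> ->; rewrite mulr1.
have low : rnorm (c n) ^+ 2 * expR (- 2) * (D / 2) <=
    rdot dot (state t u) (c n *: psi n).
  rewrite e.
  have mD : measurable (`[0, t]%classic : set R) by exact: measurable_itv.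
  have mJ : measurable J by exact: measurable_itv.
  have muJ : mu J = (D / 2)%:E.
    rewrite lebesgue_measure_itv/= lte_fin ifT; last by lra.
    by rewrite -EFinD; congr EFin; lra.
  have iJ : mu.-integrable `[0, t] (EFin \o (\1_J : R -> R)).
    apply: measurable_bounded_integrable => //.
      exact: lebesgue_segment_fin.
    exists 1; split; first exact: num_real.
    move=> B hB s _; apply: (le_trans _ (ltW hB)); rewrite /= indicE.
    by case: (_ \in _); rewrite ?normr1 ?normr0.
  have -> : rnorm (c n) ^+ 2 * expR (- 2) * (D / 2) =
      \int[mu]_(s in `[0, t]) (rnorm (c n) ^+ 2 * expR (- 2) * \1_J s).
    rewrite RintegralZl//; congr (_ * _).
    rewrite /Rintegral integral_indic// (_ : _ `&` _ = J); last first.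
      apply/seteqP; split=> [s [//]|s Js]; split=> //.
      by move: Js; rewrite /J/= !in_itv/= => /andP[h1 h2]; apply/andP; split; lra.
    exact: (esym (congr1 fine muJ)).
  apply: le_Rintegral => //.
    by apply: (integrableZl _ (rnorm (c n) ^+ 2 * expR (- 2)) iJ); exact: measurable_itv.
  move=> s _; rewrite intE mulrC.
  rewrite indicE; have [/set_mem/JE|_] := boolP (s \in J); last by rewrite !mul0r.
  rewrite /pulse_window/= in_itv/= -/D => /andP[h1 h2].
  rewrite !mul1r ler_wpM2l ?sqr_ge0// ler_expR.
  have : (t - s) * - a <= D * (2 * D^-1).
    rewrite Dk in k2; apply: ler_pM; [|by rewrite oppr_ge0 ltW|exact: ltW|exact: ltW].
    by rewrite (le_trans _ h1)// ltW// divr_gt0.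
  have -> : D * (2 * D^-1) = 2 by field; rewrite gt_eqF.
  by lra.
have up : rdot dot (state t u) (c n *: psi n) <=
    rnorm (c n) * rnorm (dot (state t u) (psi n)).
  rewrite /rdot dotZr (le_trans (ler_norm _))// (le_trans (Re_le_rnorm _))//.
  by rewrite rnormM rnormJ.
have [c0|cn0] := eqVneq (rnorm (c n)) 0.
  by rewrite c0 expr0n/= mul0r mulr0 sqr_ge0.
have c1 : 0 < rnorm (c n) by rewrite lt_neqAle eq_sym cn0 rnorm_ge0.
have coef : rnorm (c n) * (expR (- 2) * (D / 2)) <= rnorm (dot (state t u) (psi n)).
  rewrite -(ler_pM2l c1); apply: le_trans up; apply: le_trans low.
  by rewrite le_eqVlt; apply/orP; left; apply/eqP; ring.
have := bessel dot_norm phi_dense m_gt0 phi_bounds biorthogonal (state t u) n.+1.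
apply: le_trans; rewrite big_ord_recr/= mulrDr.
rewrite -[leLHS]add0r lerD//.
  by apply: mulr_ge0; [exact: ltW|apply: sumr_ge0 => i _; exact: sqr_ge0].
apply: (@le_trans _ _ (m * (rnorm (c n) * (expR (- 2) * (D / 2))) ^+ 2)); last first.
  rewrite ler_pM2l// ler_pXn2r// ?nnegrE ?rnorm_ge0//.
  by rewrite !mulr_ge0 ?expR_ge0// ?rnorm_ge0// ltW.
have e4 : expR (- 2) ^+ 2 = expR (- 4) :> R.
  by rewrite expr2 -expRD; congr expR; ring.
have -> : m * (rnorm (c n) * (expR (- 2) * (D / 2))) ^+ 2 =
  m * expR (- 4) / 4 * (rnorm (c n) ^+ 2 * D ^+ 2) by rewrite -e4; field.
rewrite ler_pM//.
- by rewrite !mulr_ge0 ?expR_ge0// ltW.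
- by rewrite divr_ge0 ?sqr_ge0.
- by rewrite ler_wpM2l// ?mulr_ge0 ?expR_ge0// ?ltW//; lra.
rewrite ler_wpM2l ?sqr_ge0// ltr0_norm//.
rewrite -[leRHS]invrK lef_pV2 ?posrE ?exprn_gt0 ?oppr_gt0 ?invr_gt0 ?exprn_gt0//.
by rewrite -exprVn -Dk ler_pXn2r// nnegrE ltW// ?dyadic_gt0// oppr_gt0.
Qed.

(** Disjoint pulses can be superposed without increasing the maximum of the
    input, and by the parallelogram law the sign of each new pulse can be chosen
    so that the squared norms of the states add up. *)
Lemma superpose (ks : seq int) (n : int -> nat) t : uniq ks ->
  (forall k, k \in ks -> strip k (- lambda (n k)) /\ 2 ^ (- k) <= t) ->
  exists u, [/\ admissible 1 u,
    forall s, (forall k, k \in ks -> ~ pulse_window k (t - s)) -> u s = 0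
    & m * expR (- 4) / 16 * \sum_(k <- ks)
        (rnorm (c (n k)) ^+ 2 / `|complex.Re (lambda (n k))| ^+ 2)
      <= rnorm (state t u) ^+ 2].
Proof.
elim: ks => [_ _|k ks IH /= /andP[kks uks] hk].
  exists (fun=> 0); split=> //; last by rewrite big_nil mulr0 sqr_ge0.
  by split=> [||s]; [exact: measurable_cst|exact: measurable_cst|rewrite rnorm0].
have [|u [adm u0 hu]] := IH uks _.
  by move=> l lks; apply: hk; rewrite inE lks orbT.
have [sk kt] := hk k (mem_head _ _).
pose u' := fun s => pulse k (complex.Im (lambda (n k))) (t - s).
have adm' : admissible 1 u' by exact: admissible_pulse.
have hu' := pulse_state_ge sk kt; rewrite -/u' in hu'.
have admsum (e : R) : `|e| = 1 -> admissible 1 (fun s => u s + e%:C * u' s).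
  move=> e1; have [h1 h2 _] := admissibleD e adm adm'; split=> // s.
  have [ks'|ks'] := pselect (pulse_window k (t - s)).
    rewrite u0 ?add0r ?rnormM ?rnorm_real ?e1 ?mul1r; last first.
      move=> l lks lw; have kl := pulse_window_disjoint ks' lw.
      by rewrite kl lks in kks.
    by case: adm'.
  by rewrite /u' pulse_eq0// mulr0 addr0; case: adm.
have supp (e : R) s : (forall l, l \in k :: ks -> ~ pulse_window l (t - s)) ->
    u s + e%:C * u' s = 0.
  move=> h; rewrite u0 /u'.
    by rewrite pulse_eq0 ?mulr0 ?addr0//; apply: h; exact: mem_head.
  by move=> l lks; apply: h; rewrite inE lks orbT.
pose y := state t u; pose y' := state t u'.
have sE (e : R) : state t (fun s => u s + e%:C * u' s) = y + e%:C *: y'.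
  exact: (state_linear e t adm adm').
have nE (e : R) : `|e| = 1 -> rnorm (y + e%:C *: y') ^+ 2 =
    rnorm y ^+ 2 + rnorm y' ^+ 2 + 2 * (e * rdot dot y y').
  move=> e1; rewrite (rnorm_addZ_sqr dot_norm).
  by rewrite -[e ^+ 2]real_normK ?num_real// e1 expr1n mul1r.
pose e : R := if 0 <= rdot dot y y' then 1 else -1.
have e1 : `|e| = 1 by rewrite /e; case: ifP => _; rewrite ?normrN normr1.
have ew : 0 <= e * rdot dot y y'.
  rewrite /e; case: ifPn => [w|]; first by rewrite mul1r.
  by rewrite -ltNge => w; rewrite mulN1r oppr_ge0 ltW.
exists (fun s => u s + e%:C * u' s); split; [exact: admsum|exact: supp|].
rewrite sE (nE _ e1) big_cons mulrDr.
apply: (@le_trans _ _ (rnorm y ^+ 2 + rnorm y' ^+ 2)); first by rewrite addrC lerD.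
by rewrite lerDl mulr_ge0.
Qed.

Lemma sum_coef_le C : (forall u t, 0 <= t -> admissible 1 u -> rnorm (state t u) <= C) ->
  forall (ks : seq int) (n : int -> nat), uniq ks ->
  (forall k, k \in ks -> strip k (- lambda (n k))) ->
  \sum_(k <- ks) (rnorm (c (n k)) ^+ 2 / `|complex.Re (lambda (n k))| ^+ 2)
    <= C ^+ 2 / (m * expR (- 4) / 16).
Proof.
move=> hC ks n uks hk.
pose t := \sum_(k <- ks) (2 : R) ^ (- k).
have t0 : 0 <= t by apply: sumr_ge0 => k _; exact/ltW/dyadic_gt0.
have kt k : k \in ks -> 2 ^ (- k) <= t.
  move=> kks; rewrite /t (bigD1_seq k)//= lerDl.
  by apply: sumr_ge0 => l _; exact/ltW/dyadic_gt0.
have [|u [adm _ h]] := @superpose ks n t uks.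
  by move=> k kks; split; [exact: hk|exact: kt].
rewrite ler_pdivlMr; last by rewrite divr_gt0// mulr_gt0 ?expR_gt0.
have uC := hC u t t0 adm.
rewrite mulrC (le_trans h)// ler_pXn2r// nnegrE ?rnorm_ge0//.
by rewrite (le_trans _ uC)// rnorm_ge0.
Qed.

End LowerBound.

(** * Comparison functions and essential suprema *)

Section ComparisonExamples.
Context (R : realType).

Lemma linear_classK (C : R) : 0 < C -> classK (fun r => C * r).
Proof.
move=> C0; split; last by rewrite mulr0.
- apply: continuous_subspaceT; exact: continuous_mulrl.
- by move=> r r0; rewrite mulr_ge0// ltW.
- by move=> r s r0 rs; rewrite ltr_pM2l.
Qed.

Lemma linear_classKinfty (C : R) : 0 < C -> classKinfty (fun r => C * r).
Proof.
move=> C0; split; first exact: linear_classK.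
move=> M; exists ((`|M| + 1) / C); first by rewrite divr_ge0 ?addr_ge0// ltW.
by rewrite mulrC divfK ?gt_eqF// (le_lt_trans (ler_norm M))// ltrDl.
Qed.

Context (a : R).
Hypothesis a_gt0 : 0 < a.

Lemma powR_decay_gt0 (t : R) : 0 <= t -> 0 < (1 + t) `^ (- a).
Proof. by move=> t0; rewrite powR_gt0// ltr_pwDl. Qed.

Lemma powR_decay_lt (s t : R) : 0 < s -> s < t -> t `^ (- a) < s `^ (- a).
Proof.
move=> s0 st; have t0 : 0 < t by rewrite (lt_trans s0).
rewrite !powRN ltf_pV2 ?posrE ?powR_gt0//.
by rewrite gt0_ltr_powR// ?nnegrE ltW.
Qed.

Lemma powR_decay_cvg0 : (1 + t) `^ (- a) @[t --> +oo] --> (0 : R).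
Proof.
apply/cvgrPdist_lt => e e0; near=> t.
have t0 : 0 <= t by near: t; exact: nbhs_pinfty_ge.
rewrite sub0r normrN gtr0_norm ?powR_decay_gt0//.
have -> : e = ((e^-1) `^ a^-1) `^ (- a).
  by rewrite -powRrM mulrN mulVf ?gt_eqF// powRN powRr1 ?invr_ge0 ?ltW// invrK.
apply: powR_decay_lt; first by rewrite powR_gt0 ?invr_gt0.
apply: (@lt_trans _ _ t); last by rewrite ltrDr.
by near: t; exact: nbhs_pinfty_gt.
Unshelve. all: by end_near. Qed.

Lemma continuous_powR_decay (t : R) : 0 <= t ->
  (1 + s) `^ (- a) @[s --> t] --> (1 + t) `^ (- a).
Proof.
move=> t0; apply: (@cvg_comp _ _ _ (fun s => 1 + s) (fun s => s `^ (- a)) _ (nbhs (1 + t))).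
  by apply: cvgD; [exact: cvg_cst|exact: cvg_id].
have t1 : 0 < 1 + t by rewrite ltr_pwDl.
have : expR (- a * ln s) @[s --> 1 + t] --> expR (- a * ln (1 + t)).
  apply: (@cvg_comp _ _ _ (fun s => - a * ln s) expR _ (nbhs (- a * ln (1 + t)))).
    2: exact: continuous_expR.
  by apply: cvgM; [exact: cvg_cst|exact: continuous_ln].
rewrite {2}/powR gt_eqF//; apply: cvg_trans; apply: near_eq_cvg; near=> s.
by rewrite /powR gt_eqF//; near: s; exact: lt_nbhsr.
Unshelve. all: by end_near. Qed.

Lemma decay_classKL (C : R) : 0 < C -> classKL (fun r t => C * r * (1 + t) `^ (- a)).
Proof.
move=> C0; split.
- apply: continuous_in_subspaceT => -[r t] /set_mem/= [r0 t0].
  apply: cvgM.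
    by apply: cvgM; [exact: cvg_cst|exact: cvg_fst].
  apply: (@cvg_comp _ _ _ snd (fun s : R => (1 + s) `^ (- a)) _ (nbhs t)).
    exact: cvg_snd.
  exact: continuous_powR_decay.
- move=> t t0.
  rewrite (_ : (fun r => _) = (fun r => C * (1 + t) `^ (- a) * r)).
    by apply: linear_classK; rewrite mulr_gt0// powR_decay_gt0.
  by apply/funext => r; rewrite mulrAC.
move=> r r0; have Cr : 0 < C * r by rewrite mulr_gt0.
split.
- apply: continuous_in_subspaceT => t /set_mem/=; rewrite in_itv/= andbT => t0.
  by apply: cvgM; [exact: cvg_cst|exact: continuous_powR_decay].
- by move=> t t0; rewrite mulr_ge0// ltW// powR_decay_gt0.
- move=> s t s0 st; rewrite ltr_pM2l//; apply: powR_decay_lt; first by rewrite ltr_pwDl.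
  by rewrite ltrD2l.
rewrite -[X in _ --> X](mulr0 (C * r)); apply: cvgM; first exact: cvg_cst.
exact: powR_decay_cvg0.
Qed.

End ComparisonExamples.


Section EssentialSupremum.
Context (R : realType).
Notation mu := (@lebesgue_measure R).
Implicit Types (u : R -> R[i]).

Lemma lebesgue_setT_gt0 : (0 < mu [set: R])%E.
Proof.
apply: (@lt_le_trans _ _ (mu `[0%R, 1%R]%classic)).
  by rewrite lebesgue_measure_itv/= lte_fin ltr01 -EFinD lte_fin subr0.
apply: le_measure => //; apply: mem_set; [exact: measurable_itv|exact: measurableT].
Qed.

Lemma Linf_norm_ge0 u : (0 <= Linf_norm u)%E.
Proof.
apply: ess_sup_gee; first exact: lebesgue_setT_gt0.
apply: aeW => t; rewrite /patch; case: ifP => // _.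
by rewrite lee_fin rnorm_ge0.
Qed.

Lemma Linf_norm_le u (V : R) : (forall s, rnorm (u s) <= V) -> (Linf_norm u <= V%:E)%E.
Proof.
move=> uV; apply/ess_supP; apply: aeW => t; rewrite /patch; case: ifP => _.
  by rewrite lee_fin.
by rewrite lee_fin (le_trans _ (uV 0))// rnorm_ge0.
Qed.

Lemma Linf_norm_fin u : (Linf_norm u < +oo)%E -> Linf_norm u = (fine (Linf_norm u))%:E.
Proof. by move=> h; rewrite fineK// ge0_fin_numE// Linf_norm_ge0. Qed.

Lemma Linf_norm_ae u : (Linf_norm u < +oo)%E ->
  {ae mu, forall s, (`[0, +oo[%classic : set R) s -> rnorm (u s) <= fine (Linf_norm u)}.
Proof.
move=> fin.
have h := @ess_sup_ge _ _ _ mu ((fun t => (rnorm (u t))%:E) \_ `[0, +oo[).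
apply: ae_imply h => s hs sD; rewrite -lee_fin -Linf_norm_fin//.
by apply: le_trans hs; rewrite /patch mem_set.
Qed.

End EssentialSupremum.

(** * The two implications *)

Section Characterization.
Context (R : realType) (X : completeNormedModType R[i]).
Context (dot : {dot X for Num.conj}).
Hypothesis dot_norm : forall x : X, dot x x = `|x| ^+ 2.
Context (A : operator X) (T : R -> X -> X).
Hypotheses (T_C0 : C0_semigroup T) (A_gen : generator A T).
Context (phi psi : nat -> X) (lambda : nat -> R[i]) (m M : R).
Hypothesis phi_dense :
  dense [set x | exists N (a : nat -> R[i]), x = \sum_(n < N) a n *: phi n].
Hypotheses (m_gt0 : 0 < m) (M_gt0 : 0 < M).
Hypothesis phi_bounds : forall N (a : nat -> R[i]),
  m * \sum_(n < N) rnorm (a n) ^+ 2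
    <= rnorm (\sum_(n < N) a n *: phi n) ^+ 2
    <= M * \sum_(n < N) rnorm (a n) ^+ 2.
Hypothesis phi_eigen : forall n, op_eigenvector A (lambda n) (phi n).
Hypothesis biorthogonal : forall n k, dot (phi n) (psi k) = (n == k)%:R.
Context (b : X) (B : R[i]^o -> X).
Hypothesis B_b : forall v, B v = v *: b.
Context (alpha : R).
Hypothesis alpha_gt0 : 0 < alpha.
Notation mu := (@lebesgue_measure R).
Notation c n := (dot b (psi n)).

Lemma basis_norm n : m <= rnorm (phi n) ^+ 2 <= M.
Proof.
have := phi_bounds n.+1 (fun k => (k == n)%:R).
have -> : \sum_(k < n.+1) ((k : nat) == n)%:R *: phi k = phi n.
  rewrite big_ord_recr/= eqxx scale1r big1 ?add0r// => k _.
  by rewrite ltn_eqF ?ltn_ord// scale0r.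
have -> : \sum_(k < n.+1) rnorm (((k : nat) == n)%:R : R[i]) ^+ 2 = 1.
  rewrite big_ord_recr/= eqxx rnorm1 expr1n big1 ?add0r// => k _.
  by rewrite ltn_eqF ?ltn_ord// rnorm0 expr0n.
by rewrite !mulr1.
Qed.

Lemma mild_solutionE t x u :
  mild_solution T B t x u = T t x + state T b t u.
Proof.
rewrite /mild_solution /state; congr (_ + bochner_integral _ _ _).
by apply/funext => s; rewrite B_b.
Qed.

(** Only times in [0, t] matter: the semigroup is unconstrained at negative
    times, where the integrand need not vanish. *)
Lemma state0 t : 0 <= t -> state T b t (fun=> 0) = 0.
Proof.
move=> t0; rewrite /state /bochner_integral; case: xgetP => // y _ hy.
have mD : measurable (`[0, t]%classic : set R) by exact: measurable_itv.
have T0 s : s \in (`[0, t]%classic : set R) -> T (t - s) ((0 : R[i]) *: b) = 0.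
  move=> /set_mem; rewrite /= in_itv/= => /andP[s0 st].
  have Ts : bounded_linear (T (t - s)) by case: T_C0 => h _ _ _; apply: h; rewrite subr_ge0.
  by rewrite scale0r -[0 in LHS](subrr 0) (bounded_linearB _ _ Ts) subrr.
have m0 : measurable_fun `[0, t]%classic
    (fun s => rdot dot (T (t - s) ((0 : R[i]) *: b)) y).
  apply: (eq_measurable_fun (fun _ : R => 0 : R)); last exact: measurable_cst.
  by move=> s sD; rewrite T0// /rdot linear0l.
have [_ h] := functional_bochner (mu := mu) dot_norm mD (lebesgue_segment_fin t) hy m0.
apply/eqP; rewrite -rnorm_eq0 -sqrf_eq0 -(rdot_sqr dot_norm) h; apply/eqP.
transitivity (\int[mu]_(s in `[0, t]) (0 : R)).
  by apply: eq_Rintegral => s sD; rewrite T0// /rdot linear0l.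
by rewrite Rintegral_cst// mul0r.
Qed.

Section Necessity.
Context (gamma mu1 : R -> R).
Hypotheses (gamma_K : classKinfty gamma) (mu1_K : classKinfty mu1).
Hypothesis ugs : forall x0 u t, Linf u -> 0 <= t ->
  rnorm (mild_solution T B t x0 u) <= gamma (rnorm x0) + mu1 (fine (Linf_norm u)).

Let classK_le (f : R -> R) r s : classK f -> 0 <= r -> r <= s -> f r <= f s.
Proof.
move=> [_ _ f_lt _] r0; rewrite le_eqVlt => /orP[/eqP->//|rs].
exact/ltW/f_lt.
Qed.

Let Linf_zero : Linf (fun=> 0 : R[i]) /\ fine (Linf_norm (fun=> 0 : R[i])) = 0.
Proof.
have h : Linf_norm (fun=> 0 : R[i]) = 0%E.
  apply/eqP; rewrite eq_le Linf_norm_ge0 andbT; apply: Linf_norm_le => s.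
  by rewrite rnorm0.
rewrite h; split=> //; split; [exact: measurable_cst|exact: measurable_cst|].
by rewrite h.
Qed.

(** The input 0 turns the stability estimate into one for the semigroup. *)
Lemma UGS_semigroup_bound t x : 0 <= t -> rnorm (T t x) <= gamma 1 * rnorm x.
Proof.
move=> t0.
have [Linf0 norm0] := Linf_zero.
have Tg z : rnorm (T t z) <= gamma (rnorm z).
  have := ugs z Linf0 t0; rewrite mild_solutionE state0// addr0 norm0.
  by have [_ _ _ ->] := mu1_K.1; rewrite addr0.
have Tb : bounded_linear (T t) by case: T_C0 => h _ _ _; exact: h.
rewrite (le_trans (le_opnorm x Tb))// ler_wpM2r ?rnorm_ge0//.
apply: opnorm_le => z z1; rewrite (le_trans (Tg z))//.
by apply: classK_le gamma_K.1 _ z1; exact: rnorm_ge0.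
Qed.

Lemma UGS_state_bound u t : 0 <= t -> admissible 1 u -> rnorm (state T b t u) <= mu1 1.
Proof.
move=> t0 [mRe mIm u1].
have u_le : (Linf_norm u <= 1%:E)%E by exact: Linf_norm_le.
have u_fin : (Linf_norm u < +oo)%E by rewrite (le_lt_trans u_le)// ltry.
have Lu : Linf u by split => //; exact: measurable_funTS.
have := ugs 0 Lu t0; rewrite mild_solutionE rnorm0.
have Tb : bounded_linear (T t) by case: T_C0 => h _ _ _; exact: h.
have -> : T t 0 = 0 by rewrite -[0 in LHS](subrr 0) (bounded_linearB _ _ Tb) subrr.
have [_ _ _ ->] := gamma_K.1; rewrite !add0r => /le_trans; apply.
apply: classK_le mu1_K.1 _ _; first by apply: fine_ge0; exact: Linf_norm_ge0.
by rewrite -lee_fin -Linf_norm_fin.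
Qed.

(** In each nonempty strip one mode reaching half of the supremum is excited. *)
Lemma esum_Phi_fin : (\esum_(k in [set: int]) Phi lambda (fun n => c n) k < +oo)%E.
Proof.
pose q n := rnorm (c n) ^+ 2 / `|complex.Re (lambda n)| ^+ 2.
have q0 n : 0 <= q n by rewrite divr_ge0 ?sqr_ge0.
pose C := mu1 1 ^+ 2 / (m * expR (- 4) / 16).
have sum_q := sum_coef_le dot_norm T_C0 A_gen UGS_semigroup_bound phi_dense m_gt0 M_gt0
  phi_bounds phi_eigen biorthogonal (fun u t => @UGS_state_bound u t).
have C0 : 0 <= C.
  apply: divr_ge0; first exact: sqr_ge0.
  by apply: divr_ge0 => //; apply: mulr_ge0; [exact: ltW|exact: expR_ge0].
have qC n k : strip k (- lambda n) -> q n <= C.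
  move=> nk; have hs l : l \in [:: k] -> strip l (- lambda n) by rewrite inE => /eqP ->.
  by have := sum_q [:: k] (fun=> n) isT hs; rewrite big_seq1.
have pick k : exists n, (Phi lambda (fun n => c n) k <= (2 * q n)%:E)%E /\
    (strip k (- lambda n) \/ Phi lambda (fun n => c n) k = 0%E).
  rewrite /Phi; case: asboolP => [[n0 n0k]|nk]; last first.
    by exists 0%N; split; [rewrite lee_fin mulr_ge0|right].
  set S := ereal_sup _.
  have S_le : (S <= C%:E)%E.
    by apply: ge_ereal_sup => _ [n /= nk <-]; rewrite lee_fin; exact: qC nk.
  have S_ge n : strip k (- lambda n) -> ((q n)%:E <= S)%E.
    by move=> nk; apply: ereal_sup_ubound; exists n.
  have SE : S = (fine S)%:E.
    rewrite fineK// fin_numElt (lt_le_trans _ (S_ge _ n0k)) ?ltNyr//.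
    by rewrite (le_lt_trans S_le)// ltry.
  have [S0|S0] := leP (fine S) 0.
    by exists n0; split; [rewrite SE lee_fin (le_trans S0)// mulr_ge0|left].
  have half : ((fine S / 2)%:E < S)%E.
    by rewrite SE lte_fin ltr_pdivrMr// ltr_pMr// ltr1n.
  have [_ [n /= nk <-] hx] := ereal_sup_gt half.
  exists n; split; last by left.
  by rewrite SE lee_fin; move: hx; rewrite lte_fin -/(q n); lra.
have [n hn] := choice pick.
apply: (@le_lt_trans _ _ (2 * C)%:E); last exact: ltry.
apply: ge_ereal_sup => _ [F [F_fin _] <-].
rewrite fsbig_finite//=.
pose ks := [seq k <- fset_set F | `[< strip k (- lambda (n k)) >]].
have uks : uniq ks by rewrite filter_uniq// fset_uniq.
have hks k : k \in ks -> strip k (- lambda (n k)).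
  by rewrite mem_filter => /andP[/asboolP].
have := sum_q ks n uks hks; rewrite -/C => h.
apply: (@le_trans _ _ (\sum_(k <- ks) (2 * q (n k))%:E)%E).
  rewrite /ks big_filter [leRHS]big_mkcond/=; apply: lee_sum => k _.
  case: asboolP => [_|nk]; first by case: (hn k).
  by case: (hn k) => _ [//|->].
by rewrite sumEFin -mulr_sumr lee_fin ler_pM2l.
Qed.

Context (kappa : R -> R -> R) (mu2 : R -> R).
Hypotheses (kappa_KL : classKL kappa) (mu2_K : classKinfty mu2).
Hypothesis iss : forall x0 u t, dom A x0 -> Linf u -> 0 <= t ->
  rnorm (mild_solution T B t x0 u)
    <= kappa (graph_norm A x0) t + mu2 (fine (Linf_norm u)).
Hypothesis kappa_O : forall r, 0 < r ->
  bigO_infty (kappa r) (fun t => t `^ (- alpha^-1)).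
Hypothesis resolvent : resolvent_set A !=set0.

Lemma orbit_le_kappa t x r : dom A x -> 0 <= t -> graph_norm A x <= r ->
  rnorm (T t x) <= kappa r t.
Proof.
move=> xA t0 xr; have [Linf0 norm0] := Linf_zero.
have := iss xA Linf0 t0; rewrite mild_solutionE state0// addr0 norm0.
have [_ _ _ ->] := mu2_K.1; rewrite addr0 => /le_trans; apply.
have [_ kK _] := kappa_KL; apply: classK_le (kK t t0) _ xr.
by rewrite addr_ge0 ?rnorm_ge0.
Qed.

(** Eigenvalues close to 0 would give eigenvectors of bounded graph norm that
    decay arbitrarily slowly. *)
Lemma eigenvalues_away_from_0 : exists2 d, 0 < d & forall n, d <= rnorm (lambda n).
Proof.
(* c0 and c1 bound the norms of the basis vectors; t0 is a time at which vectors
   of graph norm at most 2 c1 have decayed to half of c0 *)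
pose c0 := Num.min 1 m; pose c1 := 1 + M.
have c0_gt0 : 0 < c0 by rewrite /c0 lt_min ltr01.
have c1_gt0 : 0 < c1 by rewrite addr_gt0.
have phi_ge n : c0 <= rnorm (phi n).
  have /andP[h _] := basis_norm n; rewrite /c0 ge_min.
  have [//|lt1] := leP 1 (rnorm (phi n)); apply/orP; right; apply: (le_trans h).
  by rewrite expr2 ler_piMr ?rnorm_ge0// ltW.
have phi_le n : rnorm (phi n) <= c1.
  have /andP[_ h] := basis_norm n.
  rewrite -(ler_pXn2r (n := 2))// ?nnegrE ?rnorm_ge0//; last exact: ltW.
  by apply: (le_trans h); rewrite /c1 expr2; nra.
have c2 : 0 < 2 * c1 by rewrite mulr_gt0.
have [_ _ kL] := kappa_KL; have [_ _ _ k0] := kL _ c2.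
have e0 : 0 < c0 / 2 by rewrite divr_gt0.
have [t0 t0_gt0 kt0] : exists2 t0, 0 < t0 & kappa (2 * c1) t0 < c0 / 2.
  have : \forall t \near +oo, 0 < t /\ kappa (2 * c1) t < c0 / 2.
    move/cvgrPdist_lt : k0 => /(_ _ e0) k0; near=> t; split.
      by near: t; exact: nbhs_pinfty_gt.
    have : `|0 - kappa (2 * c1) t| < c0 / 2 by near: t.
    by rewrite sub0r normrN; apply: le_lt_trans; exact: ler_norm.
  move=> [t1 [_ h]]; have [|h1 h2] := h (t1 + 1); first by rewrite /= ltrDl.
  by exists (t1 + 1).
exists (Num.min 1 (2 * t0)^-1).
  by rewrite lt_min ltr01 invr_gt0 mulr_gt0.
move=> n; rewrite ge_min; have [//|l1] := leP 1 (rnorm (lambda n)).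
apply/orP; right.
have [phiA _ Aphi] := phi_eigen n.
have graph : graph_norm A (phi n) <= 2 * c1.
  rewrite /graph_norm Aphi rnormZ -[X in X + _]mul1r -mulrDl.
  by rewrite ler_pM ?addr_ge0 ?rnorm_ge0// lerD2l ltW.
have := orbit_le_kappa phiA (ltW t0_gt0) graph.
rewrite (semigroup_eigenvector T_C0 A_gen UGS_semigroup_bound (phi_eigen n) (ltW t0_gt0)).
rewrite rnormZ rnorm_cexp Re_mul/= mulr0 subr0 => le_k.
have half : expR (complex.Re (lambda n) * t0) < 1 / 2.
  rewrite -(ltr_pM2r c0_gt0) (le_lt_trans (ler_wpM2l (expR_ge0 _) (phi_ge n)))//.
  by rewrite (le_lt_trans le_k)// (lt_le_trans kt0)//; lra.
have := le_lt_trans (expR_ge1Dx _) half => h.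
rewrite (le_trans _ (Re_le_rnorm _))//.
rewrite (le_trans _ (_ : - complex.Re (lambda n) <= _))//; last first.
  by rewrite -normrN ler_norm.
by rewrite -div1r ler_pdivrMr ?mulr_gt0//; lra.
Unshelve. all: by end_near. Qed.

Lemma resolvent_decay (S : X -> X) (C : R) : bounded_linear S -> 0 < C ->
  (forall x, rnorm x <= 1 -> dom A (S x) /\ graph_norm A (S x) <= C) ->
  forall t, 0 <= t -> 0 <= opnorm (T t \o S) <= kappa C t.
Proof.
move=> Sb C0 SC t t0.
have Tb : bounded_linear (T t) by case: T_C0 => h _ _ _; exact: h.
apply/andP; split; first by apply: opnorm_ge0; exact: bounded_linear_comp.
by apply: opnorm_le => x /SC[SA SxC]; exact: orbit_le_kappa.
Qed.

Lemma op_opp x : dom A x -> dom A (- x) /\ A (- x) = - A x.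
Proof.
move=> xA; have A0 : A 0 = 0.
  have [_] := op_linear 1 (dom0 A) (dom0 A).
  by rewrite scaler0 addr0 scale1r => /esym/eqP; rewrite -subr_eq0 addrK => /eqP.
have := op_linear (-1) xA (dom0 A).
by rewrite A0 !addr0 !scaleN1r.
Qed.

Lemma ISS_polynomially_stable : polynomially_stable A T alpha.
Proof.
have [l lA] := resolvent.
have shift := bounded_inverse_shift dot_norm T_C0 A_gen UGS_semigroup_bound phi_dense
  m_gt0 M_gt0 phi_bounds phi_eigen biorthogonal.
split.
  split.
    exists (gamma 1) => t t0; apply: opnorm_le => x x1.
    rewrite (le_trans (UGS_semigroup_bound x t0))// ler_piMr//.
    by have [_ h _ _] := gamma_K.1; exact: h.
  have [|S [Sb SR SL]] := shift l 1 1 lA ltr01.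
    move=> n; rewrite (le_trans _ (Re_le_rnorm _))// (le_trans _ (ler_norm _))//.
    rewrite Re_sub/= lerDl oppr_ge0.
    exact: (Re_eigenvalue_le0 T_C0 A_gen UGS_semigroup_bound phi_eigen).
  have AS x : A (S x) = S x - x.
    have [_] := SR x; rewrite scale1r => h; rewrite -[X in _ = _ - X]h.
    by rewrite opprB addrC subrK.
  exists S.
    split=> // [y|x xA]; first by have [h1 h2] := SR y; rewrite scale1r in h2.
    by have := SL x xA; rewrite scale1r.
  pose C := 2 * opnorm S + 1.
  have C0 : 0 < C by rewrite ltr_pwDr// mulr_ge0// opnorm_ge0.
  have SC x : rnorm x <= 1 -> dom A (S x) /\ graph_norm A (S x) <= C.
    move=> x1; split; first by case: (SR x).
    rewrite /graph_norm AS /C mulr_natl mulr2n -addrA lerD ?opnorm_ub//.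
    by rewrite (le_trans (ler_rnormB _ _))// lerD// opnorm_ub.
  have decay := resolvent_decay Sb C0 SC.
  have [_ _ kL] := kappa_KL; have [_ _ _ k0] := kL _ C0.
  apply: (squeeze_cvgr _ _ k0); last exact: cvg_cst.
  by near=> t; apply: decay; near: t; exact: nbhs_pinfty_ge.
have [d d0 dl] := eigenvalues_away_from_0.
have [|S' [S'b S'R S'L]] := shift l 0 d lA d0.
  by move=> n; rewrite sub0r rnormN.
pose S x := - S' x.
have Sb : bounded_linear S by exact: bounded_linear_opp.
have SR y : dom A (S y) /\ A (S y) = y.
  have [yA e] := S'R y; have [h1 h2] := op_opp yA; split=> //.
  by rewrite h2 -[RHS]e scale0r sub0r.
exists S.
  split=> // x xA; rewrite /S -[RHS](S'L x xA) scale0r sub0r.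
  by rewrite -scaleN1r -(bounded_linearZ _ _ S'b) scaleN1r.
pose C := opnorm S + 1.
have C0 : 0 < C by rewrite ltr_pwDr// opnorm_ge0.
have SC x : rnorm x <= 1 -> dom A (S x) /\ graph_norm A (S x) <= C.
  move=> x1; have [h1 h2] := SR x; split=> //.
  by rewrite /graph_norm h2 /C lerD ?opnorm_ub.
have decay := resolvent_decay Sb C0 SC.
have [N N0 hN] := kappa_O C0; exists N => //.
near=> t; apply: (@le_trans _ _ (kappa C t)); last by near: t.
have t0 : 0 <= t by near: t; exact: nbhs_pinfty_ge.
by have /andP[] := decay t t0.
Unshelve. all: by end_near. Qed.

End Necessity.

Section Sufficiency.
Context (K : R).
Hypothesis T_opnorm : forall t, 0 <= t -> opnorm (T t) <= K.
Context (S1 S0 : X -> X).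
Hypothesis S1_inv : bounded_inverse (dom A) (fun x => x - A x) S1.
Hypothesis S1_cvg : opnorm (T t \o S1) @[t --> +oo] --> (0 : R).
Hypothesis S0_inv : bounded_inverse (dom A) A S0.
Hypothesis S0_O : bigO_infty (fun t => opnorm (T t \o S0)) (fun t => t `^ (- alpha^-1)).
Hypothesis Phi_fin : (\esum_(k in [set: int]) Phi lambda (fun n => c n) k < +oo)%E.
Context (p d : R).
Hypotheses (p_gt0 : 0 < p) (d_gt0 : 0 < d).
Hypothesis gap : forall n k, n != k -> `|complex.Re (lambda n)| < p ->
  `|complex.Re (lambda k)| < p -> d <= `|complex.Im (lambda n) - complex.Im (lambda k)|.

Lemma opnorm_semigroup_bound t x : 0 <= t -> rnorm (T t x) <= K * rnorm x.
Proof.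
move=> t0; have Tb : bounded_linear (T t) by case: T_C0 => h _ _ _; exact: h.
by rewrite (le_trans (le_opnorm x Tb))// ler_wpM2r ?rnorm_ge0// T_opnorm.
Qed.

(** An eigenvector is in the range of the resolvent, so that its orbit tends
    to 0. *)
Lemma stable_eigenvalue_lt0 n : complex.Re (lambda n) < 0.
Proof.
rewrite ltNge; apply/negP => l0.
have [phiA phi0 Aphi] := phi_eigen n.
have [S1b _ S1L] := S1_inv.
pose v := phi n - A (phi n).
have phi_le t : 0 <= t -> rnorm (phi n) <= opnorm (T t \o S1) * rnorm v.
  move=> t0; have Tb : bounded_linear (T t) by case: T_C0 => h _ _ _; exact: h.
  have := le_opnorm v (bounded_linear_comp Tb S1b); apply: le_trans.
  rewrite /= /v S1L// (semigroup_eigenvector T_C0 A_gen opnorm_semigroup_bound (phi_eigen n) t0).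
  rewrite rnormZ rnorm_cexp Re_mul/= mulr0 subr0 ler_peMl ?rnorm_ge0//.
  by rewrite -[leLHS]expR0 ler_expR mulr_ge0.
have h0 : opnorm (T t \o S1) * rnorm v @[t --> +oo] --> (0 : R).
  by rewrite -[X in _ --> X](mul0r (rnorm v)); apply: cvgM => //; exact: cvg_cst.
have : rnorm (phi n) <= 0.
  apply: (@ler_cvg_to _ (nbhs +oo) _ _ (fun=> rnorm (phi n)) _ _ _ (cvg_cst _) h0).
  by near=> t; apply: phi_le; near: t; exact: nbhs_pinfty_ge.
by rewrite leNgt rnorm_gt0 phi0.
Unshelve. all: by end_near. Qed.

Lemma Phi_bounds : exists (F : int -> R) (F_tot : R),
  [/\ forall k, 0 <= F k,
      forall n k, strip k (- lambda n) ->
        rnorm (c n) ^+ 2 / `|complex.Re (lambda n)| ^+ 2 <= F k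
    & forall ks, uniq ks -> \sum_(k <- ks) F k <= F_tot].
Proof.
pose P k := Phi lambda (fun n => c n) k.
have P_ub n k : strip k (- lambda n) ->
    ((rnorm (c n) ^+ 2 / `|complex.Re (lambda n)| ^+ 2)%:E <= P k)%E.
  move=> nk; rewrite /P /Phi; case: asboolP => [_|[]]; last by exists n.
  by apply: ereal_sup_ubound; exists n.
have P0 k : (0 <= P k)%E.
  have [[n nk]|nk] := pselect (exists n, strip k (- lambda n)).
    by apply: le_trans (P_ub n k nk); rewrite lee_fin divr_ge0 ?sqr_ge0.
  by rewrite /P /Phi; case: asboolP.
have P_sum ks : uniq ks -> (\sum_(k <- ks) P k <= \esum_(k in [set: int]) P k)%E.
  move=> uks; apply: ereal_sup_ubound.
  exists [set` ks]; first by split => //; exact: finite_seq.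
  by rewrite -fsbig_seq.
have P_fin k : (P k < +oo)%E.
  by apply: le_lt_trans Phi_fin; have := P_sum [:: k] isT; rewrite big_seq1.
have PE k : P k = (fine (P k))%:E by rewrite fineK// ge0_fin_numE.
exists (fun k => fine (P k)), (fine (\esum_(k in [set: int]) P k)); split.
- by move=> k; exact: fine_ge0.
- by move=> n k nk; rewrite -lee_fin -PE; exact: P_ub.
move=> ks uks; rewrite -lee_fin -sumEFin fineK; last first.
  by rewrite ge0_fin_numE// esum_ge0.
by apply: le_trans (P_sum ks uks); apply: lee_sum => k _; rewrite -PE.
Qed.

(** If the integrand is not Bochner integrable, the state is 0 and the bound is
    trivial. *)
Lemma stable_state_bound : exists2 C : R, 0 < C & forall u t, Linf u -> 0 <= t ->
  rnorm (state T b t u) <= C * fine (Linf_norm u).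
Proof.
have [F [F_tot [F0 F_bound F_sum]]] := Phi_bounds.
pose C := 1 + M * (rnorm b ^+ 2 / m / p ^+ 2 + 8 * (2 + 12 * p ^+ 2 / d ^+ 2) * F_tot).
exists (`|C| + 1); first by rewrite ltr_pwDr.
move=> u t [mRe mIm u_fin] t0.
have V0 : 0 <= fine (Linf_norm u) by apply: fine_ge0; exact: Linf_norm_ge0.
rewrite /state /bochner_integral; case: xgetP => [y _ hy|_]; last first.
  by rewrite rnorm0 mulr_ge0// addr_ge0.
have := state_le dot_norm T_C0 A_gen opnorm_semigroup_bound phi_dense m_gt0 M_gt0
  phi_bounds phi_eigen biorthogonal p_gt0 d_gt0 gap stable_eigenvalue_lt0 F0 F_bound F_sum
  V0 t0 mRe mIm (Linf_norm_ae u_fin) hy.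
move/le_trans; apply; rewrite mulrC ler_wpM2r// -/C.
by rewrite (le_trans (ler_norm _))// lerDl.
Qed.

(** On a bounded time interval the power of 1 + t is bounded below; beyond time 1
    it is comparable to the same power of t. *)
Lemma stable_orbit_decay : exists2 C : R, 0 < C & forall x t, dom A x -> 0 <= t ->
  rnorm (T t x) <= C * graph_norm A x * (1 + t) `^ (- alpha^-1).
Proof.
have a0 : 0 < alpha^-1 by rewrite invr_gt0.
have [S0b _ S0L] := S0_inv.
have [N N0 [t1 [_ hN]]] := S0_O.
pose t2 := Num.max t1 1; have t2_ge : 1 <= t2 by rewrite le_max lexx orbT.
have t20 : 0 <= t2 by rewrite (le_trans ler01).
pose e := (1 + t2) `^ (- alpha^-1); have e0 : 0 < e by exact: powR_decay_gt0.
pose K0 := `|K| * opnorm S0.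
have K00 : 0 <= K0 by rewrite mulr_ge0// opnorm_ge0.
pose w : R := 2 `^ alpha^-1; have w0 : 0 < w by rewrite powR_gt0.
pose C := K0 / e + N * w + 1.
have Ke0 : 0 <= K0 / e by apply: divr_ge0 => //; exact: ltW.
have Nw0 : 0 <= N * w by apply: mulr_ge0; exact: ltW.
have C0 : 0 < C by rewrite ltr_pwDr// addr_ge0.
have bound t : 0 <= t -> opnorm (T t \o S0) <= C * (1 + t) `^ (- alpha^-1).
  move=> t0; have dt := powR_decay_gt0 alpha^-1 t0.
  have [tt|tt] := leP t t2.
    have et : e <= (1 + t) `^ (- alpha^-1).
      have [->//|tn] := eqVneq t t2.
      rewrite /e ltW//; apply: powR_decay_lt => //; first by rewrite ltr_pwDl.
      by rewrite ltrD2l lt_neqAle tn.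
    apply: (@le_trans _ _ K0).
      apply: opnorm_le => x x1 /=.
      rewrite (le_trans (opnorm_semigroup_bound _ t0))// /K0.
      rewrite (le_trans (ler_wpM2r (rnorm_ge0 _) (ler_norm K)))//.
      by rewrite ler_wpM2l// opnorm_ub.
    rewrite -[leLHS](divfK (lt0r_neq0 e0)); apply: ler_pM => //; first exact: ltW.
    by rewrite /C -addrA lerDl addr_ge0.
  have t1t : t1 < t by rewrite (le_lt_trans _ tt)// le_max lexx.
  apply: le_trans (hN t t1t) _.
  have t_gt0 : 0 < t by rewrite (le_lt_trans t20).
  have half : t `^ (- alpha^-1) <= ((1 + t) / 2) `^ (- alpha^-1).
    have t_gt1 : 1 < t by exact: le_lt_trans tt.
    by apply: ltW; apply: powR_decay_lt => //; lra.
  have split2 : (1 + t) `^ (- alpha^-1) * w = ((1 + t) / 2) `^ (- alpha^-1).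
    set q := (1 + t) / 2; have q0 : 0 <= q by rewrite /q; lra.
    have -> : 1 + t = q * 2 by rewrite /q divfK.
    by rewrite powRM// -mulrA (powRN 2) /w mulVf ?mulr1// gt_eqF.
  apply: (@le_trans _ _ (N * ((1 + t) `^ (- alpha^-1) * w))).
    by rewrite split2 ler_pM2l.
  rewrite mulrCA mulrC; apply: ler_wpM2r; first exact: ltW.
  by rewrite /C addrAC lerDr addr_ge0.
exists C => // x t xA t0.
have Tb : bounded_linear (T t) by case: T_C0 => h _ _ _; exact: h.
have := le_opnorm (A x) (bounded_linear_comp Tb S0b).
rewrite /= S0L// => /le_trans; apply.
have dt := powR_decay_gt0 alpha^-1 t0.
apply: (@le_trans _ _ (C * (1 + t) `^ (- alpha^-1) * rnorm (A x))).
  by rewrite ler_wpM2r ?rnorm_ge0// bound.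
rewrite mulrAC ler_wpM2r ?(ltW dt)// ler_pM2l// /graph_norm lerDr.
exact: rnorm_ge0.
Qed.

Lemma stable_polynomially_ISS : polynomially_ISS A T B alpha.
Proof.
have [C C0 stateC] := stable_state_bound.
have [D D0 orbitD] := stable_orbit_decay.
have a0 : 0 < alpha^-1 by rewrite invr_gt0.
have K1 : 0 < `|K| + 1 by rewrite ltr_pwDr.
split.
  exists (fun r => (`|K| + 1) * r), (fun r => C * r); split.
  - exact: linear_classKinfty.
  - exact: linear_classKinfty.
  move=> x u t Lu t0; rewrite mild_solutionE (le_trans (ler_rnormD _ _))// lerD//.
    rewrite (le_trans (opnorm_semigroup_bound _ t0))// ler_wpM2r ?rnorm_ge0//.
    by rewrite (le_trans (ler_norm K))// lerDl.
  exact: stateC.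
exists (fun r t => D * r * (1 + t) `^ (- alpha^-1)), (fun r => C * r); split.
- exact: decay_classKL.
- exact: linear_classKinfty.
- move=> x u t xA Lu t0; rewrite mild_solutionE (le_trans (ler_rnormD _ _))// lerD//.
    exact: orbitD.
  exact: stateC.
move=> r r0; exists (D * r); first by rewrite mulr_gt0.
near=> t; rewrite ler_pM2l ?mulr_gt0//.
have t0 : 0 < t by near: t; exact: nbhs_pinfty_gt.
by apply: ltW; apply: powR_decay_lt => //; rewrite ltrDr.
Unshelve. all: by end_near. Qed.

End Sufficiency.
End Characterization.

(** A positive infimum, possibly infinite, bounds all the distances below by a
    real number. *)
Lemma gap_separation (R : realType) (lambda : nat -> R[i]) (p : R) :
  (0 < ereal_inf
    [set (`|complex.Im (lambda nm.1) - complex.Im (lambda nm.2)|)%R%:E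
    | nm in [set nm : nat * nat |
        [/\ nm.1 <> nm.2, (`|complex.Re (lambda nm.1)| < p)%R
          & (`|complex.Re (lambda nm.2)| < p)%R]]])%E ->
  exists2 d : R, 0 < d & forall n k, n != k -> `|complex.Re (lambda n)| < p ->
    `|complex.Re (lambda k)| < p -> d <= `|complex.Im (lambda n) - complex.Im (lambda k)|.
Proof.
set S := ereal_inf _ => S0.
have S_le n k : n != k -> `|complex.Re (lambda n)| < p -> `|complex.Re (lambda k)| < p ->
    (S <= `|complex.Im (lambda n) - complex.Im (lambda k)|%:E)%E.
  by move=> /eqP nk hn hk; apply: ereal_inf_lbound; exists (n, k).
have [Sfin|Sinf] := boolP (S \is a fin_num).
  exists (fine S); first by rewrite -lte_fin fineK.
  by move=> n k nk hn hk; rewrite -lee_fin fineK// S_le.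
exists 1 => // n k nk hn hk; have := S_le n k nk hn hk.
move: Sinf; rewrite fin_numElt negb_and.
rewrite (lt_trans _ S0) ?ltNyr//= -leNgt leye_eq => /eqP ->.
by rewrite leye_eq.
Qed.

Theorem theorem4p10 (R : realType) (X : completeNormedModType R[i])
  (dot : {dot X for Num.conj})
  (dot_norm : forall x : X, dot x x = `|x| ^+ 2)
  (A : operator X) (T : R -> X -> X)
  (A_diag : op_diagonalizable A)
  (T_C0 : C0_semigroup T) (A_gen : generator A T)
  (phi psi : nat -> X) (lambda : nat -> R[i])
  (phi_riesz : riesz_basis phi)
  (phi_eigen : forall n, op_eigenvector A (lambda n) (phi n))
  (biorthogonal : forall n m, dot (phi n) (psi m) = (n == m)%:R)
  (B : R[i]^o -> X) (B_bounded : bounded_linear B)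
  (b : X) (B_b : forall v, B v = v *: b)
  (gap : exists2 p : R, 0 < p &
     (0 < ereal_inf
        [set (`|complex.Im (lambda nm.1) - complex.Im (lambda nm.2)|)%R%:E
        | nm in [set nm : nat * nat |
            [/\ nm.1 <> nm.2, (`|complex.Re (lambda nm.1)| < p)%R
              & (`|complex.Re (lambda nm.2)| < p)%R]]])%E)
  (alpha : R) (alpha_gt0 : 0 < alpha) :
  polynomially_ISS A T B alpha <->
  polynomially_stable A T alpha /\
  (\esum_(k in [set: int]) Phi lambda (fun n => dot b (psi n)) k < +oo)%E.
Proof.
have [phi_dense [m [M [m_gt0 M_gt0 phi_bounds]]]] := phi_riesz.
have [p p_gt0 /gap_separation[d d_gt0 sep]] := gap.
split.
  move=> [[gamma [mu1 [gammaK mu1K ugs]]] [kappa [mu2 [kappaKL mu2K iss kappaO]]]].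
  split.
    exact: (ISS_polynomially_stable dot_norm T_C0 A_gen phi_dense m_gt0 M_gt0 phi_bounds
      phi_eigen biorthogonal B_b gammaK mu1K ugs kappaKL mu2K iss kappaO A_diag.1).
  exact: (esum_Phi_fin dot_norm T_C0 A_gen phi_dense m_gt0 M_gt0 phi_bounds phi_eigen
    biorthogonal B_b gammaK mu1K ugs).
move=> [[[[K T_opnorm] [S1 S1_inv S1_cvg]] [S0 S0_inv S0_O]] Phi_fin].
exact: (stable_polynomially_ISS dot_norm T_C0 A_gen phi_dense m_gt0 M_gt0 phi_bounds
  phi_eigen biorthogonal B_b alpha_gt0 T_opnorm S1_inv S1_cvg S0_inv S0_O Phi_fin
  p_gt0 d_gt0 sep).
Qed.
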